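(* Let $f:\mathbb{R}^n\to\mathbb{R}$, $g:\mathbb{R}^n\to\mathbb{R}^m$, $h:\mathbb{R}^n\to\mathbb{R}^p$ be continuously differentiable, let $\kappa<n$ be an integer, and assume that $g$ and $h$ are semialgebraic. Let $(x^*,y^* )$ be an accumulation point of a sequence $\{(x^k,y^k)\}$ generated by the safeguarded augmented Lagrangian method (SALM), suppose that $(x^*,y^* )$ is feasible for the relaxation problem, and suppose that the CC-PAM-regularity condition holds at $x^*$. Then $(x^*,y^* )$ is a CC-M-stationary point, and there exists $z^*\in\mathbb{R}^n$ such that $(x^*,z^* )$ is a CC-S-stationary point.
   Context: CCOP is the problem $\min f(x)$ s.t. $g(x)\le0$, $h(x)=0$, $\|x\|_0\le\kappa$, where $\|x\|_0$ is the number of nonzero components of $x$. Its relaxation problem is $\min_{(x,y)} f(x)$ s.t. $g(x)\le 0$, $h(x)=0$, $x\circ y=0$, $n-\kappa-e^Ty\le0$, $y\le e$, where $e=(1,\dots,1)^T\in\mathbb{R}^n$ and $\circ$ is the componentwise product. $\nabla g(x)$, $\nabla h(x)$ have columns $\nabla g_i(x)$, $\nabla h_j(x)$. $I_g(x)=\{i:g_i(x)=0\}$, $I_\pm(x)=\{\imath:x_\imath\neq0\}$; $(\cdot)_+=\max\{\cdot,0\}$ and $\min$ of vectors are taken componentwise. A map is semialgebraic if its graph is a semialgebraic set (a finite union of sets defined by finitely many polynomial equalities and strict inequalities). Stationarity: let $(x,y)$ be feasible for the relaxation problem. It is CC-S-stationary (resp. CC-M-stationary) if there exists $(\lambda,\mu,\gamma)\in\mathbb{R}^m_+\times\mathbb{R}^p\times\mathbb{R}^n$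 with $\nabla f(x)+\nabla g(x)\lambda+\nabla h(x)\mu+\gamma=0$, $\lambda_i=0$ for all $i\notin I_g(x)$, and $\gamma_\imath=0$ for all $\imath$ with $y_\imath=0$ (resp. $\gamma_\imath=0$ for all $\imath\in I_\pm(x)$). CC-PAM-regularity: for $x\in\mathbb{R}^n$, $\alpha\ge0$, $\beta\ge0$, let $\Theta(x,\alpha,\beta)$ (which depends on the fixed $x^*$) be the set of all vectors $\nabla g(x)\lambda+\nabla h(x)\mu+\gamma$ with $(\lambda,\mu,\gamma)\in\mathbb{R}^m_+\times\mathbb{R}^p\times\mathbb{R}^n$ such that $\lambda_i=0$ for all $i\notin I_g(x^* )$; $\gamma_\imath=0$ for all $\imath\in I_\pm(x^* )$; and, with $\pi=\|(1,\lambda,\mu,\gamma)\|_\infty$: $\lambda_i g_i(x)\ge\alpha$ whenever $\lambda_i>\beta\pi$; $\mu_j h_j(x)\ge\alpha$ whenever $|\mu_j|>\beta\pi$; $\gamma_\imath x_\imath\ge\alpha$ whenever $|\gamma_\imath|>\beta\pi$. $\limsup_{x\to x^*,\,\alpha\downarrow0,\,\beta\downarrow0}\Theta(x,\alpha,\beta)$ is the set of all $z$ for which there exist $x^k\to x^*$, $\alpha_k\downarrow0$, $\beta_k\downarrow 0$ (with $\alpha_k,\beta_k>0$) and $z^k\in\Theta(x^k,\alpha_k,\beta_k)$ with $z^k\to z$. The CC-PAM-regularity condition holds at $x^*$ if this limsup is contained in $\Theta(x^*,0,0)$. Augmented Lagrangian: for $\Lambda=(\lambda,\mu,\gamma,\delta,\eta)\in\mathbb{R}^m_+\times\mathbb{R}^p\times\mathbb{R}^n\times\mathbb{R}_+\times\mathbb{R}^n_+$,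 $\rho>0$, $$\mathscr{L}(x,y,\Lambda,\rho)=f(x)+\tfrac{\rho}{2}\Big[\|(g(x)+\tfrac{\lambda}{\rho})_+\|^2+\|h(x)+\tfrac{\mu}{\rho}\|^2+\|x\circ y+\tfrac{\gamma}{\rho}\|^2+\|(n-\kappa-e^Ty+\tfrac{\delta}{\rho})_+\|^2+\|(y-e+\tfrac{\eta}{\rho})_+\|^2\Big].$$ SALM: Step 1: given $(x^0,y^0)$, $\lambda_{max}>0$, $\mu_{min}<\mu_{max}$, $\gamma_{min}<\gamma_{max}$, $\delta_{max}>0$, $\eta_{max}>0$, $\tau>1$, $\sigma>1$, $\{\epsilon_k\}\subset\mathbb{R}_+$ with $\epsilon_k\downarrow0$; choose $\bar\Lambda^0=(\bar\lambda^0,\bar\mu^0,\bar\gamma^0,\bar\delta^0,\bar\eta^0)\in[0,\lambda_{max}]^m\times[\mu_{min},\mu_{max}]^p\times[\gamma_{min},\gamma_{max}]^n\times[0,\delta_{max}]\times[0,\eta_{max}]^n$, $\rho_0>0$, and set $k=1$. Step 2: compute $(x^k,y^k)$ with $\|\nabla_{(x,y)}\mathscr{L}(x^k,y^k,\bar\Lambda^{k-1},\rho_{k-1})\|\le\epsilon_k$. Step 3: set $\lambda^k=(\rho_{k-1}g(x^k)+\bar\lambda^{k-1})_+$, $\mu^k=\rho_{k-1}h(x^k)+\bar\mu^{k-1}$, $\gamma^k=\rho_{k-1}x^k\circ y^k+\bar\gamma^{k-1}$, $\eta^k=(\rho_{k-1}(y^k-e)+\bar\eta^{k-1})_+$, $\delta^k=(\rho_{k-1}(n-\kappa-e^Ty^k)+\bar\delta^{k-1})_+$.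 Step 4: let $U^k=\min\{-g(x^k),\bar\lambda^{k-1}/\rho_{k-1}\}$, $V^k=\min\{-(n-\kappa-e^Ty^k),\bar\delta^{k-1}/\rho_{k-1}\}$, $R^k=\min\{-(y^k-e),\bar\eta^{k-1}/\rho_{k-1}\}$. If $k=1$ or $\max\{\|U^{k-1}\|,\|h(x^{k-1})\|,\|x^{k-1}\circ y^{k-1}\|,\|V^{k-1}\|,\|R^{k-1}\|\}\ge\tau\max\{\|U^k\|,\|h(x^k)\|,\|x^k\circ y^k\|,\|V^k\|,\|R^k\|\}$, set $\rho_k=\rho_{k-1}$; otherwise set $\rho_k=\sigma\rho_{k-1}$. Step 5: choose any $\bar\Lambda^k=(\bar\lambda^k,\bar\mu^k,\bar\gamma^k,\bar\delta^k,\bar\eta^k)$ in the same box as $\bar\Lambda^0$; set $k\leftarrow k+1$ and go to Step 2. (No stopping criterion is used: the method generates an infinite sequence.) *)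

(* Defs.v *)
From HB Require Import structures.
From mathcomp Require Import all_boot all_order all_algebra.
From mathcomp Require Import all_classical all_reals all_analysis.
(* Not imported: the notations of [mpoly] clash with those of MathComp-Analysis. *)
From mathcomp Require mpoly.

Set Implicit Arguments.
Unset Strict Implicit.
Unset Printing Implicit Defensive.

Import Order.TTheory GRing.Theory Num.Theory.
Import numFieldNormedType.Exports.

Local Open Scope classical_set_scope.
Local Open Scope ring_scope.

(* Vectors of R^n are row vectors.  The library norm [`|v|] on ['rV[R]_n] is the
   max-norm; it is used below only where the max-norm is meant. *)

Section Vectors.
Context {R : realType}.

Definition enorm n (v : 'rV[R]_n) : R := Num.sqrt (\sum_i v 0 i ^+ 2).

Definition hadamard n (u v : 'rV[R]_n) : 'rV[R]_n := map2_mx *%R u v.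

Definition pospart n (v : 'rV[R]_n) : 'rV[R]_n := map_mx (Num.max 0) v.

Definition vmin n (u v : 'rV[R]_n) : 'rV[R]_n := map2_mx Num.min u v.

Definition vsum n (v : 'rV[R]_n) : R := \sum_i v 0 i.

Definition vones n : 'rV[R]_n := const_mx 1.

Definition vnonneg n (v : 'rV[R]_n) : Prop := forall i, 0 <= v 0 i.

Definition vbox n (a b : R) (v : 'rV[R]_n) : Prop :=
  forall i, a <= v 0 i <= b.

Definition grad n (f : 'rV[R]_n -> R) (x : 'rV[R]_n) : 'rV[R]_n :=
  \row_i 'D_(delta_mx 0 i) f x.

Definition C1_scalar n (f : 'rV[R]_n -> R) : Prop :=
  (forall x, differentiable f x) /\ continuous (grad f).

(* ['J g x] is the n x m matrix whose j-th column is the gradient of g_j. *)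
Definition C1_vector n m (g : 'rV[R]_n -> 'rV[R]_m) : Prop :=
  (forall x, differentiable g x) /\ continuous (jacobian g).

(* The product of the matrix of gradients of g with the vector lam,
   transposed into a row vector. *)
Definition grad_comb n m (g : 'rV[R]_n -> 'rV[R]_m) (x : 'rV[R]_n)
    (lam : 'rV[R]_m) : 'rV[R]_n := lam *m ('J g x)^T.

End Vectors.

Section Semialgebraic.
Context {R : realType}.

Definition peval N (q : mpoly.mpoly N R) (z : 'rV[R]_N) : R :=
  mpoly.meval (fun i => z 0 i) q.

Definition basic_semialgebraic N (eqs ineqs : seq (mpoly.mpoly N R)) :
    pred 'rV[R]_N :=
  fun z => all (fun q => peval q z == 0) eqs
           && all (fun q => 0 < peval q z) ineqs.

Definition semialgebraic_set N (A : set 'rV[R]_N) : Prop :=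
  exists pieces : seq (seq (mpoly.mpoly N R) * seq (mpoly.mpoly N R)),
    A = [set z | has (fun d => basic_semialgebraic d.1 d.2 z) pieces].

Definition semialgebraic_map n m (g : 'rV[R]_n -> 'rV[R]_m) : Prop :=
  semialgebraic_set (range (fun x => row_mx x (g x))).

End Semialgebraic.

Section Problem.
Context {R : realType} {n m p : nat}.
Variables (f : 'rV[R]_n -> R) (g : 'rV[R]_n -> 'rV[R]_m)
          (h : 'rV[R]_n -> 'rV[R]_p) (kappa : int).

Implicit Types x y z : 'rV[R]_n.

Definition card_res y : R := n%:R - kappa%:~R - vsum y.

Definition relax_feasible x y : Prop :=
  [/\ forall i, g x 0 i <= 0, h x = 0, hadamard x y = 0,
      card_res y <= 0 & forall i, y 0 i <= 1].

Definition stationarity_eq x (lam : 'rV[R]_m) (mu : 'rV[R]_p)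
    (gam : 'rV[R]_n) : Prop :=
  grad f x + grad_comb g x lam + grad_comb h x mu + gam = 0.

Definition CC_S_stationary x y : Prop :=
  relax_feasible x y /\
  exists (lam : 'rV[R]_m) (mu : 'rV[R]_p) (gam : 'rV[R]_n),
    [/\ vnonneg lam, stationarity_eq x lam mu gam,
        forall i, g x 0 i <> 0 -> lam 0 i = 0 &
        forall i, y 0 i = 0 -> gam 0 i = 0].

Definition CC_M_stationary x y : Prop :=
  relax_feasible x y /\
  exists (lam : 'rV[R]_m) (mu : 'rV[R]_p) (gam : 'rV[R]_n),
    [/\ vnonneg lam, stationarity_eq x lam mu gam,
        forall i, g x 0 i <> 0 -> lam 0 i = 0 &
        forall i, x 0 i <> 0 -> gam 0 i = 0].

(* Max-norm of the concatenated vector (1, lam, mu, gam). *)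
Definition mult_size (lam : 'rV[R]_m) (mu : 'rV[R]_p) (gam : 'rV[R]_n) : R :=
  Num.max 1 (Num.max `|lam| (Num.max `|mu| `|gam|)).

Definition Theta (xs x : 'rV[R]_n) (alpha beta : R) : set 'rV[R]_n :=
  [set w | exists (lam : 'rV[R]_m) (mu : 'rV[R]_p) (gam : 'rV[R]_n),
    [/\ w = grad_comb g x lam + grad_comb h x mu + gam,
        vnonneg lam,
        forall i, g xs 0 i <> 0 -> lam 0 i = 0,
        forall i, xs 0 i <> 0 -> gam 0 i = 0 &
        let pi := mult_size lam mu gam in
        [/\ forall i, beta * pi < lam 0 i -> alpha <= lam 0 i * g x 0 i,
            forall j, beta * pi < `|mu 0 j| -> alpha <= mu 0 j * h x 0 j &
            forall i, beta * pi < `|gam 0 i| -> alpha <= gam 0 i * x 0 i]]].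

Definition limsup_Theta (xs : 'rV[R]_n) : set 'rV[R]_n :=
  [set z | exists (x : nat -> 'rV[R]_n) (alpha beta : nat -> R)
      (w : nat -> 'rV[R]_n),
    [/\ x @ \oo --> xs,
        (forall k, 0 < alpha k) /\ alpha @ \oo --> 0,
        (forall k, 0 < beta k) /\ beta @ \oo --> 0,
        forall k, Theta xs (x k) (alpha k) (beta k) (w k) &
        w @ \oo --> z]].

Definition CC_PAM_regular (xs : 'rV[R]_n) : Prop :=
  limsup_Theta xs `<=` Theta xs xs 0 0.

End Problem.

Record multipliers (R : realType) (n m p : nat) := Multipliers {
  m_lam : 'rV[R]_m;
  m_mu : 'rV[R]_p;
  m_gam : 'rV[R]_n;
  m_del : R;
  m_eta : 'rV[R]_n }.

Record salm_params (R : realType) := SalmParams {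
  lam_max : R;
  mu_min : R;
  mu_max : R;
  gam_min : R;
  gam_max : R;
  del_max : R;
  eta_max : R;
  tau : R;
  sigma : R;
  eps : nat -> R }.

(* Entry k holds the quantities with superscript or subscript k in the
   algorithm; [s_mult] is only constrained from k = 1 on. *)
Record salm_run (R : realType) (n m p : nat) := SalmRun {
  s_x : nat -> 'rV[R]_n;
  s_y : nat -> 'rV[R]_n;
  s_mult : nat -> multipliers R n m p;
  s_safe : nat -> multipliers R n m p;
  s_rho : nat -> R }.

Section SALM.
Context {R : realType} {n m p : nat}.
Variables (f : 'rV[R]_n -> R) (g : 'rV[R]_n -> 'rV[R]_m)
          (h : 'rV[R]_n -> 'rV[R]_p) (kappa : int).

Implicit Types (x y : 'rV[R]_n) (L : multipliers R n m p) (rho : R).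

Definition aug_lagrangian x y L rho : R :=
  f x + rho / 2 *
    (enorm (pospart (g x + rho^-1 *: m_lam L)) ^+ 2
   + enorm (h x + rho^-1 *: m_mu L) ^+ 2
   + enorm (hadamard x y + rho^-1 *: m_gam L) ^+ 2
   + (Num.max 0 (card_res kappa y + m_del L / rho)) ^+ 2
   + enorm (pospart (y - vones n + rho^-1 *: m_eta L)) ^+ 2).

Definition grad_aug_lagrangian x y L rho : 'rV[R]_(n + n) :=
  row_mx (grad (fun u => aug_lagrangian u y L rho) x)
         (grad (fun v => aug_lagrangian x v L rho) y).

Definition mult_update x y L rho : multipliers R n m p :=
  Multipliers
    (pospart (rho *: g x + m_lam L))
    (rho *: h x + m_mu L)
    (rho *: hadamard x y + m_gam L)
    (Num.max 0 (rho * card_res kappa y + m_del L))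
    (pospart (rho *: (y - vones n) + m_eta L)).

Definition progress_measure x y L rho : R :=
  Num.max (enorm (vmin (- g x) (rho^-1 *: m_lam L)))
  (Num.max (enorm (h x))
  (Num.max (enorm (hadamard x y))
  (Num.max `|Num.min (- card_res kappa y) (m_del L / rho)|
           (enorm (vmin (- (y - vones n)) (rho^-1 *: m_eta L)))))).

Definition in_safe_box (P : salm_params R) L : Prop :=
  [/\ vbox 0 (lam_max P) (m_lam L), vbox (mu_min P) (mu_max P) (m_mu L),
      vbox (gam_min P) (gam_max P) (m_gam L), 0 <= m_del L <= del_max P &
      vbox 0 (eta_max P) (m_eta L)].

Record salm_params_ok (P : salm_params R) : Prop := {
  lam_max_gt0 : 0 < lam_max P;
  mu_min_lt_max : mu_min P < mu_max P;
  gam_min_lt_max : gam_min P < gam_max P;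
  del_max_gt0 : 0 < del_max P;
  eta_max_gt0 : 0 < eta_max P;
  tau_gt1 : 1 < tau P;
  sigma_gt1 : 1 < sigma P;
  eps_ge0 : forall k, 0 <= eps P k;
  eps_cvg0 : eps P @ \oo --> 0 }.

(* [salm_progress S k.+1] is the quantity max{|U|, |h|, |x o y|, |V|, |R|} at
   iteration k.+1, which involves the safeguarded multipliers and the penalty
   parameter of iteration k. *)
Definition salm_progress (S : salm_run R n m p) (k : nat) : R :=
  progress_measure (s_x S k) (s_y S k) (s_safe S k.-1) (s_rho S k.-1).

Record salm_generated (P : salm_params R) (S : salm_run R n m p) : Prop := {
  salm_params_valid : salm_params_ok P;
  salm_rho0 : 0 < s_rho S 0;
  salm_safe : forall k, in_safe_box P (s_safe S k);
  salm_primal : forall k,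
    enorm (grad_aug_lagrangian (s_x S k.+1) (s_y S k.+1) (s_safe S k)
             (s_rho S k)) <= eps P k.+1;
  salm_mult : forall k,
    s_mult S k.+1 = mult_update (s_x S k.+1) (s_y S k.+1) (s_safe S k)
                      (s_rho S k);
  salm_penalty : forall k,
    s_rho S k.+1 =
      if (k.+1 == 1)%N || (tau P * salm_progress S k.+1 <= salm_progress S k)
      then s_rho S k else sigma P * s_rho S k }.

End SALM.

(* Main.v *)
(* Stationarity of the augmented Lagrangian in x says that
     grad f + grad g lam + grad h mu + gam o y
   tends to zero, so gam o y plays the role of the multiplier of the constraints
   x_i = 0. For the indices i with xs_i <> 0, where no multiplier is allowed, one
   must show gam_i y_i --> 0, which amounts to rho y_i^2 --> 0. Let F(x, y) be half
   the squared infeasibility of the relaxation problem. Since rho grad F stays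
   bounded, it is enough that F <= c |grad F| near (xs, ys) for every c > 0: then
   rho F --> 0, while F >= x_i^2 y_i^2 / 2.

   This inequality holds for every C^1 semialgebraic F at a zero z of F. Otherwise,
   for every small t > 0, the compact set of the points of the unit ball around z
   with F = t and |grad F| <= C t is nonempty. Its lexicographically smallest point
   is a curve with semialgebraic coordinates, which are monotone for small t; so
   the curve has finite length, whereas F = t and |grad F| <= C t force the length
   to be at least of the order of the variation of log t, which is infinite.
   Monotonicity comes from o-minimality: on one side of each t the coordinate u is
   above, equal to or below u t, with a type that does not depend on t for small t,
   and not every point of an interval can be a strict local minimum.

   After dropping the vanishing terms, bounded multipliers give stationarity by
   compactness. Unbounded multipliers have eventually the sign of their
   constraint as soon as they exceed the safeguards, so that - grad f xs belongs
   to the upper limit of the sets Theta and CC-PAM-regularity applies. *)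

Require Import Defs.
From HB Require Import structures.
From mathcomp Require Import all_boot all_order all_algebra.
From mathcomp Require Import all_classical all_reals all_analysis.
From mathcomp Require mpoly polyrcf ordered_qelim qe_rcf.
From mathcomp Require Import ring lra.

Set Implicit Arguments.
Unset Strict Implicit.
Unset Printing Implicit Defensive.

Import Order.TTheory GRing.Theory Num.Theory.
Import numFieldNormedType.Exports.

Local Open Scope classical_set_scope.
Local Open Scope ring_scope.

(** * Semialgebraic predicates and Tarski-Seidenberg *)

Section SemialgebraicPredicates.
Context {R : rcfType}.

(* A point of R^I is an environment [I -> R]: binding one more real variable is
   then the passage from the index type [I] to [option I]. *)
Inductive polyfun (I : Type) : ((I -> R) -> R) -> Prop :=
| polyfun_var i : polyfun (fun e => e i)
| polyfun_cst c : polyfun (fun=> c)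
| polyfunD u v : polyfun u -> polyfun v -> polyfun (fun e => u e + v e)
| polyfunM u v : polyfun u -> polyfun v -> polyfun (fun e => u e * v e).

(** Quantifier-free conditions, generated by strict polynomial inequalities; equalities and weak
    inequalities arise through negation. Closure under quantifiers is a theorem, [sdef_exists], not
    a constructor. *)
Inductive sdef (I : Type) : ((I -> R) -> Prop) -> Prop :=
| sdef_gt0 u : polyfun u -> sdef (fun e => 0 < u e)
| sdef_not P : sdef P -> sdef (fun e => ~ P e)
| sdef_and P Q : sdef P -> sdef Q -> sdef (fun e => P e /\ Q e).

Lemma polyfunN I (u : (I -> R) -> R) : polyfun u -> polyfun (fun e => - u e).
Proof.
move=> pu; have -> : (fun e => - u e) = (fun e => -1 * u e).
  by apply/funext => e; rewrite mulN1r.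
exact: polyfunM (polyfun_cst _ _) pu.
Qed.

Lemma polyfunB I (u v : (I -> R) -> R) :
  polyfun u -> polyfun v -> polyfun (fun e => u e - v e).
Proof. by move=> pu pv; apply: polyfunD => //; apply: polyfunN. Qed.

Lemma polyfunX I (u : (I -> R) -> R) k :
  polyfun u -> polyfun (fun e => u e ^+ k).
Proof.
move=> pu; elim: k => [|k ih]; first exact: polyfun_cst.
under eq_fun do rewrite exprS.
exact: polyfunM.
Qed.

Lemma polyfun_sum I J (s : seq J) (u : J -> (I -> R) -> R) :
  (forall j, polyfun (u j)) -> polyfun (fun e => \sum_(j <- s) u j e).
Proof.
move=> pu; elim: s => [|j s ih].
  by under eq_fun do rewrite big_nil; exact: polyfun_cst.
by under eq_fun do rewrite big_cons; exact: polyfunD.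
Qed.

Lemma polyfun_prod I J (s : seq J) (u : J -> (I -> R) -> R) :
  (forall j, polyfun (u j)) -> polyfun (fun e => \prod_(j <- s) u j e).
Proof.
move=> pu; elim: s => [|j s ih].
  by under eq_fun do rewrite big_nil; exact: polyfun_cst.
by under eq_fun do rewrite big_cons; exact: polyfunM.
Qed.

Lemma polyfun_subst I J (T : I -> (J -> R) -> R) (u : (I -> R) -> R) :
  (forall i, polyfun (T i)) -> polyfun u -> polyfun (fun e => u (T ^~ e)).
Proof.
move=> pT; elim=> [i|c|v w _ pv _ pw|v w _ pv _ pw].
- exact: pT.
- exact: polyfun_cst.
- exact: polyfunD pv pw.
- exact: polyfunM pv pw.
Qed.

Lemma eq_sdef I (P Q : (I -> R) -> Prop) :
  (forall e, P e <-> Q e) -> sdef P -> sdef Q.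
Proof. by move=> PQ; suff -> : P = Q by []; apply/funext => e; exact/propext. Qed.

(** [T] is most often a family of coordinate projections: this is how a predicate is moved between
    the index types [I], [option I] and [I + 'I_N]. *)
Lemma sdef_subst I J (T : I -> (J -> R) -> R) (P : (I -> R) -> Prop) :
  (forall i, polyfun (T i)) -> sdef P -> sdef (fun e => P (T ^~ e)).
Proof.
move=> pT; elim=> [u pu|Q _ sQ|Q1 Q2 _ sQ1 _ sQ2].
- exact: (sdef_gt0 (polyfun_subst pT pu)).
- exact: sdef_not sQ.
- exact: sdef_and sQ1 sQ2.
Qed.

Lemma sdef_or I (P Q : (I -> R) -> Prop) :
  sdef P -> sdef Q -> sdef (fun e => P e \/ Q e).
Proof.
move=> sP sQ; apply: eq_sdef (sdef_not (sdef_and (sdef_not sP) (sdef_not sQ))).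
move=> e; split; last by case=> ? [].
by move=> H; case: (pselect (P e)) => [|nP]; [left | right; apply: contrapT => nQ; apply: H].
Qed.

Lemma sdef_imp I (P Q : (I -> R) -> Prop) :
  sdef P -> sdef Q -> sdef (fun e => P e -> Q e).
Proof.
move=> sP sQ; apply: eq_sdef (sdef_not (sdef_and sP (sdef_not sQ))) => e.
by split=> [H Pe|H [/H]//]; apply: contrapT => nQ; apply: H.
Qed.

Lemma sdef_lt I (u v : (I -> R) -> R) :
  polyfun u -> polyfun v -> sdef (fun e => u e < v e).
Proof.
move=> pu pv; apply: eq_sdef (sdef_gt0 (polyfunB pv pu)) => e.
by rewrite subr_gt0.
Qed.

Lemma sdef_le I (u v : (I -> R) -> R) :
  polyfun u -> polyfun v -> sdef (fun e => u e <= v e).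
Proof.
move=> pu pv; apply: eq_sdef (sdef_not (sdef_lt pv pu)) => e.
by rewrite leNgt; split => /negP.
Qed.

Lemma sdef_eq I (u v : (I -> R) -> R) :
  polyfun u -> polyfun v -> sdef (fun e => u e = v e).
Proof.
move=> pu pv; apply: eq_sdef (sdef_and (sdef_le pu pv) (sdef_le pv pu)) => e.
by split=> [[? ?]|->]; [apply/eqP; rewrite eq_le; apply/andP|rewrite lexx].
Qed.

Lemma sdef_cst I (A : Prop) : sdef (fun _ : I -> R => A).
Proof.
case: (pselect A) => a.
  apply: eq_sdef (sdef_lt (polyfun_cst I 0) (polyfun_cst I 1)) => e.
  by rewrite ltr01.
apply: eq_sdef (sdef_lt (polyfun_cst I 0) (polyfun_cst I 0)) => e.
by rewrite ltxx.
Qed.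

Lemma sdef_all_seq I (J : eqType) (s : seq J) (P : J -> (I -> R) -> Prop) :
  (forall j, sdef (P j)) -> sdef (fun e => forall j, j \in s -> P j e).
Proof.
move=> sP; elim: s => [|a s ih]; first by apply: eq_sdef (sdef_cst _ True).
apply: eq_sdef (sdef_and (sP a) ih) => e; split=> [[Pa Ps] j|H].
  by rewrite inE => /predU1P[->|/Ps].
by split=> [|j js]; apply: H; rewrite inE ?eqxx ?js ?orbT.
Qed.

Lemma sdef_all_fin I (J : finType) (P : J -> (I -> R) -> Prop) :
  (forall j, sdef (P j)) -> sdef (fun e => forall j, P j e).
Proof.
move=> sP; apply: eq_sdef (sdef_all_seq (enum J) sP) => e.
by split=> H j => [|_]; apply: H; rewrite ?mem_enum.
Qed.

Lemma sdef_ex_seq I (J : eqType) (s : seq J) (P : J -> (I -> R) -> Prop) :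
  (forall j, sdef (P j)) -> sdef (fun e => exists2 j, j \in s & P j e).
Proof.
move=> sP; have sN j := sdef_not (sP j).
apply: eq_sdef (sdef_not (sdef_all_seq s sN)) => e; split.
  by move=> H; apply: contrapT => N; apply: H => j js Pj; apply: N; exists j.
by case=> j js Pj H; exact: (H j js).
Qed.

Lemma sdef_ex_fin I (J : finType) (P : J -> (I -> R) -> Prop) :
  (forall j, sdef (P j)) -> sdef (fun e => exists j, P j e).
Proof.
move=> sP; apply: eq_sdef (sdef_ex_seq (enum J) sP) => e.
by split=> [[j _ Pj]|[j Pj]]; exists j => //; rewrite mem_enum.
Qed.

(** * Translation into first-order formulas and back *)

Definition env_seq (I : finType) (e : I -> R) : seq R := [seq e i | i <- enum I].

Lemma nth_env_seq (I : finType) (e : I -> R) i :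
  (env_seq e)`_(enum_rank i) = e i.
Proof.
by rewrite (nth_map i) ?nth_enum_rank // -cardE ltn_ord.
Qed.

Lemma polyfun_term (I : finType) (v : I -> nat) (u : (I -> R) -> R) :
  polyfun u -> exists2 t : GRing.term R, GRing.rterm t &
    forall (s : seq R) e, (forall i, s`_(v i) = e i) -> GRing.eval s t = u e.
Proof.
elim=> [i|c|u1 u2 _ [t1 r1 h1] _ [t2 r2 h2]|u1 u2 _ [t1 r1 h1] _ [t2 r2 h2]].
- by exists (GRing.Var R (v i)) => // s e /= ->.
- by exists (GRing.Const c).
- by exists (GRing.Add t1 t2) => [|s e se]; rewrite /= ?r1 ?r2 // (h1 s e) ?(h2 s e).
- by exists (GRing.Mul t1 t2) => [|s e se]; rewrite /= ?r1 ?r2 // (h1 s e) ?(h2 s e).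
Qed.

(** The numbering [v] of the variables is left free: [sdef_exists] gives the bound variable the
    number [#|I|], just after those of [I]. *)
Lemma sdef_formula (I : finType) (v : I -> nat) (P : (I -> R) -> Prop) :
  sdef P -> exists2 f : ordered_qelim.ord.formula R, ordered_qelim.ord.rformula f &
    forall (s : seq R) e, (forall i, s`_(v i) = e i) ->
      (ordered_qelim.ord.holds s f <-> P e).
Proof.
elim=> [u /(polyfun_term v)[t rt ht]|Q _ [f rf hf]|Q1 Q2 _ [f1 r1 h1] _ [f2 r2 h2]].
- exists (ordered_qelim.ord.Lt (GRing.Const 0) t) => // s e se /=.
  by rewrite (ht s e).
- exists (ordered_qelim.ord.Not f) => // s e se /=.
  by split=> H /(hf s e se)/H.
- exists (ordered_qelim.ord.And f1 f2) => [|s e se] /=; first by rewrite r1 r2.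
  by split=> [[/(h1 s e se) ? /(h2 s e se) ?]|[/(h1 s e se) ? /(h2 s e se) ?]].
Qed.

Lemma eval_polyfun (I : finType) (t : GRing.term R) : GRing.rterm t ->
  polyfun (fun e : I -> R => GRing.eval (env_seq e) t).
Proof.
elim: t => //=.
- move=> n _; case: (ltnP n #|I|) => nI; last first.
    (* A variable numbered beyond the length of the environment reads the default value of [nth],
       which is 0. *)
    have -> : (fun e : I -> R => (env_seq e)`_n) = (fun=> 0).
      by apply/funext => e; rewrite nth_default // size_map -cardE.
    exact: polyfun_cst.
  have -> : (fun e : I -> R => (env_seq e)`_n) =
      (fun e => e (enum_val (Ordinal nI))).
    by apply/funext => e; rewrite -nth_env_seq enum_valK.
  exact: polyfun_var.
- by move=> c _; exact: polyfun_cst.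
- by move=> n _; exact: polyfun_cst.
- by move=> t1 h1 t2 h2 /andP[/h1 ? /h2 ?]; exact: polyfunD.
- by move=> t h /h; exact: polyfunN.
- move=> t h n /h pt; under eq_fun do rewrite -mulr_natr.
  exact: polyfunM pt (polyfun_cst _ _).
- by move=> t1 h1 t2 h2 /andP[/h1 ? /h2 ?]; exact: polyfunM.
- by move=> t h n /h; exact: polyfunX.
Qed.

Lemma qf_sdef (I : finType) (f : ordered_qelim.ord.formula R) :
  ordered_qelim.ord.qf_form f -> ordered_qelim.ord.rformula f ->
  sdef (fun e : I -> R => ordered_qelim.ord.qf_eval (env_seq e) f).
Proof.
elim: f => //=.
- by move=> b _ _; exact: sdef_cst.
- move=> t1 t2 _ /andP[r1 r2].
  apply: eq_sdef (sdef_eq (eval_polyfun I r1) (eval_polyfun I r2)) => e.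
  by split=> /eqP.
- by move=> t1 t2 _ /andP[r1 r2]; apply: sdef_lt; apply: eval_polyfun.
- by move=> t1 t2 _ /andP[r1 r2]; apply: sdef_le; apply: eval_polyfun.
- move=> f1 h1 f2 h2 /andP[q1 q2] /andP[r1 r2].
  by apply: eq_sdef (sdef_and (h1 q1 r1) (h2 q2 r2)) => e; split=> /andP.
- move=> f1 h1 f2 h2 /andP[q1 q2] /andP[r1 r2].
  by apply: eq_sdef (sdef_or (h1 q1 r1) (h2 q2 r2)) => e; split=> /orP.
- move=> f1 h1 f2 h2 /andP[q1 q2] /andP[r1 r2].
  by apply: eq_sdef (sdef_imp (h1 q1 r1) (h2 q2 r2)) => e; split=> /implyP.
- move=> f h q r.
  by apply: eq_sdef (sdef_not (h q r)) => e; split=> /negP.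
Qed.

(* Tarski-Seidenberg, by quantifier elimination for real closed fields. *)
Lemma sdef_exists (I : finType) (P : (I -> R) -> R -> Prop) :
  sdef (fun e : option I -> R => P (fun i => e (Some i)) (e None)) ->
  sdef (fun e => exists x, P e x).
Proof.
pose v (o : option I) : nat := if o is Some i then enum_rank i else #|I|.
move=> /(sdef_formula v)[f rf hf].
pose ef := ordered_qelim.ord.Exists #|I| f.
have ref : ordered_qelim.ord.rformula ef by [].
have wf := @qe_rcf.wf_QE_wproj R; have vf := @qe_rcf.valid_QE_wproj R.
have /andP[qg rg] := ordered_qelim.ord.quantifier_elim_wf wf ref.
apply: eq_sdef (qf_sdef I qg rg) => e.
pose ext x (o : option I) := if o is Some i then e i else x.
(* [set_nth] writes [x] at the first position past the end of [env_seq e], where the formula looks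
   for the bound variable. *)
have hx x : ordered_qelim.ord.holds (set_nth 0 (env_seq e) #|I| x) f <-> P e x.
  apply: (hf _ (ext x)) => -[i|] /=; rewrite nth_set_nth /= ?eqxx //.
  by rewrite (ltn_eqF (ltn_ord _)) nth_env_seq.
rewrite -(rwP (ordered_qelim.ord.quantifier_elim_rformP wf vf (env_seq e) ref)).
by split=> -[x /hx]; exists x.
Qed.

End SemialgebraicPredicates.

(** * Semialgebraic subsets of the line *)

Section OneVariable.
Context {R : realType}.

Lemma sdef_forall (I : finType) (P : (I -> R) -> R -> Prop) :
  sdef (fun e : option I -> R => P (fun i => e (Some i)) (e None)) ->
  sdef (fun e => forall x, P e x).
Proof.
move=> sP.
have := @sdef_exists R I (fun e x => ~ P e x) (sdef_not sP).
move/sdef_not; apply: eq_sdef => e; split => [H x|H [x]]; last exact.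
by apply: contrapT => nP; apply: H; exists x.
Qed.

(** Induction on [N]: the first coordinate joins the environment, whose index type becomes
    [option I], and [cons] puts it back in front of the others. *)
Lemma sdef_exists_vec N (I : finType) (P : (I -> R) -> ('I_N -> R) -> Prop) :
  sdef (fun e : I + 'I_N -> R => P (fun i => e (inl i)) (fun j => e (inr j))) ->
  sdef (fun e => exists z, P e z).
Proof.
elim: N I P => [|N ih] I P sP.
  pose T (i : I + 'I_0) : (I -> R) -> R :=
    match i with inl i => fun e => e i | inr _ => fun=> 0 end.
  have pT i : polyfun (T i).
    by case: i => i; [exact: polyfun_var|exact: polyfun_cst].
  apply: eq_sdef (sdef_subst pT sP) => e; split=> [H|[z]].
    by exists (fun=> 0).
  by rewrite /T /=; congr P; apply/funext => -[].
pose cons (x : R) (z : 'I_N -> R) (j : 'I_N.+1) :=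
  if unlift ord0 j is Some k then z k else x.
pose T (i : I + 'I_N.+1) : (option I + 'I_N -> R) -> R :=
  match i with
  | inl i => fun e => e (inl (Some i))
  | inr j => fun e => cons (e (inl None)) (fun k => e (inr k)) j
  end.
have pT i : polyfun (T i).
  case: i => [i|j] /=; first exact: polyfun_var.
  by rewrite /cons; case: unlift => [k|]; exact: polyfun_var.
have s2 := ih _ (fun e z => P (fun i => e (Some i)) (cons (e None) z))
  (sdef_subst pT sP).
apply: eq_sdef (sdef_exists (P := fun e x => exists z, P e (cons x z)) s2) => e.
split=> [[x [z Pz]]|[z Pz]]; first by exists (cons x z).
exists (z ord0), (fun k => z (lift ord0 k)).
move: Pz; congr P; apply/funext => j; rewrite /cons.
by case: unliftP => [k|] ->.
Qed.

Lemma sdef_forall_vec N (I : finType) (P : (I -> R) -> ('I_N -> R) -> Prop) :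
  sdef (fun e : I + 'I_N -> R => P (fun i => e (inl i)) (fun j => e (inr j))) ->
  sdef (fun e => forall z, P e z).
Proof.
move=> sP.
have := @sdef_exists_vec N I (fun e x => ~ P e x) (sdef_not sP).
move/sdef_not; apply: eq_sdef => e; split => [H x|H [x]]; last exact.
by apply: contrapT => nP; apply: H; exists x.
Qed.

Definition sdef1 (D : R -> Prop) := sdef (fun e : unit -> R => D (e tt)).

Lemma polyfun_poly (u : (unit -> R) -> R) :
  polyfun u -> exists p : {poly R}, forall t, u (fun=> t) = p.[t].
Proof.
elim=> [i|c|v w _ [p hp] _ [q hq]|v w _ [p hp] _ [q hq]].
- by exists 'X => t; rewrite hornerX.
- by exists c%:P => t; rewrite hornerC.
- by exists (p + q) => t; rewrite hp hq hornerD.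
- by exists (p * q) => t; rewrite hp hq hornerM.
Qed.

(** * One-sided germs of semialgebraic subsets of the line *)

Definition right_of (D : R -> Prop) (t : R) :=
  exists2 d, 0 < d & forall s, t < s < t + d -> D s.

Definition left_of (D : R -> Prop) (t : R) :=
  exists2 d, 0 < d & forall s, t - d < s < t -> D s.

Lemma right_of_and (D E : R -> Prop) t :
  right_of D t -> right_of E t -> right_of (fun s => D s /\ E s) t.
Proof.
move=> [d d0 hd] [e e0 he]; exists (Num.min d e); first by rewrite lt_min d0.
move=> s /andP[ts]; rewrite -ltrBlDl lt_min !ltrBlDl => /andP[sd se].
by split; [apply: hd|apply: he]; rewrite ts.
Qed.

(** A nonzero polynomial keeps a constant sign between [t] and its next root, so the truth value of
    an atom is constant just after [t]; negation and conjunction preserve this. *)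
Lemma sdef1_right (D : R -> Prop) t :
  sdef1 D -> right_of D t \/ right_of (fun s => ~ D s) t.
Proof.
suff H (P : (unit -> R) -> Prop) : sdef P ->
    right_of (fun s => P (fun=> s)) t \/ right_of (fun s => ~ P (fun=> s)) t.
  by move/H.
elim=> [u /polyfun_poly[p hp]|Q _ [h|h]|Q1 Q2 _ h1 _ h2].
- case: (eqVneq p 0) => [p0|p0].
    by right; exists 1 => // s _; rewrite hp p0 horner0 ltxx.
  have [y] := polyrcf.neighpr_wit (ltr_pwDr ltr01 (lexx t)) p0.
  rewrite /polyrcf.neighpr => hy.
  have nb : {in polyrcf.neighpr p t (t + 1),
      forall s, Num.sg p.[s] = polyrcf.sgp_right p t} := @polyrcf.sgr_neighpr _ _ _ _.
  have ty : t < polyrcf.next_root p t (t + 1).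
    by move: hy; rewrite in_itv /= => /andP[]; exact: lt_trans.
  have H s : t < s < t + (polyrcf.next_root p t (t + 1) - t) ->
      Num.sg p.[s] = polyrcf.sgp_right p t.
    by rewrite addrC subrK => hs; apply: nb; rewrite /polyrcf.neighpr in_itv.
  case: (ltrP 0 (polyrcf.sgp_right p t)) => sp; [left|right];
    exists (polyrcf.next_root p t (t + 1) - t); rewrite ?subr_gt0 // => s /H hs;
    rewrite hp; [rewrite -sgr_gt0 hs //|].
  by apply/negP; rewrite -leNgt -sgr_le0 hs.
- by right; case: h => d d0 hd; exists d => // s /hd hQ; exact.
- by left.
- case: h1 => [h1|[d d0 hd]]; last first.
    by right; exists d => // s /hd h [].
  case: h2 => [h2|[d d0 hd]]; last first.
    by right; exists d => // s /hd h [].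
  by left; exact: right_of_and.
Qed.

Lemma right_ofN (D : R -> Prop) t :
  right_of (fun s => D (- s)) (- t) -> left_of D t.
Proof.
move=> [d d0 hd]; exists d => // s hs; rewrite -[s]opprK; apply: hd.
by move: hs; lra.
Qed.

Lemma sdef1_left (D : R -> Prop) t :
  sdef1 D -> left_of D t \/ left_of (fun s => ~ D s) t.
Proof.
move=> sD.
have sN : sdef1 (fun s => D (- s)).
  have pT (i : unit) : polyfun (fun e : unit -> R => - e tt).
    exact: polyfunN (polyfun_var _).
  exact: sdef_subst pT sD.
by case: (sdef1_right (- t) sN) => h; [left|right]; exact: right_ofN h.
Qed.

Lemma sdef1_germ (D : R -> Prop) (e : R) : sdef1 D -> 0 < e ->
  exists2 d, 0 < d <= e &
    (forall t, 0 < t < d -> D t) \/ (forall t, 0 < t < d -> ~ D t).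
Proof.
move=> sD e0; case: (sdef1_right 0 sD) => -[d d0 hd];
  exists (Num.min d e); rewrite ?lt_min ?ge_min ?d0 ?e0 ?lexx ?orbT //;
  [left|right] => t; rewrite lt_min => /and3P[t0 td _];
  by apply: hd; rewrite t0 add0r.
Qed.

(** Let [r] be the supremum of the points of [[s, t]] where [u] is at least [u s]. Comparison on the
    left of [r] shows that [r] is such a point, and comparison on the right excludes [r < t]. *)
Lemma local_nondecreasing (u : R -> R) (a b : R) :
  (forall t, a < t < b -> exists2 d, 0 < d & forall s, a < s < b ->
     `|s - t| < d -> (t < s -> u t <= u s) /\ (s < t -> u s <= u t)) ->
  forall s t, a < s -> s <= t -> t < b -> u s <= u t.
Proof.
move=> loc s t as_ st tb.
pose A := [set r | s <= r <= t /\ u s <= u r].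
have As : A s by split; rewrite /= ?lexx.
have ubA : ubound A t by move=> r [/andP[]].
have supA : has_sup A by split; [exists s|exists t].
set r := sup A.
have sr : s <= r by apply: sup_ubound => //; exists t.
have rt : r <= t by apply: ge_sup => //; exists s.
have arb : a < r < b by rewrite (lt_le_trans as_ sr) (le_lt_trans rt tb).
have [d d0 hd] := loc r arb.
have [x [/andP[sx xt] ux] rx] := sup_adherent d0 supA.
have xr : x <= r by apply: sup_ubound; [exists t|split=> //; rewrite sx].
have ur : u s <= u r.
  move: xr; rewrite le_eqVlt => /predU1P[<-//|xr].
  apply: (le_trans ux); apply: (hd x _ _).2 => //.
    by rewrite (lt_le_trans as_ sx) (le_lt_trans xt tb).
  by rewrite ltr0_norm ?subr_lt0 // opprB ltrBlDr -ltrBlDl.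
move: rt; rewrite le_eqVlt => /predU1P[<-//|rt].
pose y := Num.min t (r + d / 2).
have ry : r < y by rewrite lt_min rt ltrDl divr_gt0.
have yt : y <= t by rewrite ge_min lexx.
have : A y.
  split; first by rewrite yt (le_trans sr) // ltW.
  apply: (le_trans ur); apply: (hd y _ _).1 => //.
    by rewrite (lt_trans _ ry) ?(lt_le_trans as_ sr) // (le_lt_trans yt).
  rewrite gtr0_norm ?subr_gt0 // ltrBlDl gt_min; apply/orP; right.
  by rewrite ltrD2l ltr_pdivrMr // ltr_pMr // ltr1n.
by move/(ub_le_sup (ex_intro _ t ubA)); rewrite leNgt ry.
Qed.

(* If [1/(n+1)] is the width of a window around [t] on which [u t] is the strict
   minimum, then [t |-> (n, floor (t (n+1)))] is injective, so that the interval
   would be countable. *)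
Lemma not_all_strict_local_min (u : R -> R) (a b : R) : a < b ->
  ~ (forall t, a < t < b -> exists2 d, 0 < d &
       forall s, a < s < b -> s != t -> `|s - t| < d -> u t < u s).
Proof.
move=> ab H.
have Hn t : exists n : nat, a < t < b ->
    forall s, a < s < b -> s != t -> `|s - t| < n.+1%:R^-1 -> u t < u s.
  case: (pselect (a < t < b)) => [/[dup] tab /H[d d0 hd]|]; last by exists 0%N.
  exists (Num.truncn d^-1) => _ s sab st sd; apply: hd => //.
  apply: (lt_trans sd); rewrite invf_plt ?posrE ?ltr0n //.
  exact: truncnS_gt.
have [n hn] := choice Hn.
pose k t := (n t, Num.floor (t * (n t).+1%:R)).
(* Two distinct points with the same key would be closer than their common window width, so each
   would have a strictly smaller value than the other. *)
have ik : {in `]a, b[%classic &, injective k}.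
  move=> s t; rewrite !inE /= !in_itv /= => sab tab [] nst.
  rewrite nst => fl; apply/eqP/negPn/negP => st.
  have N0 : 0 < (n t).+1%:R :> R by rewrite ltr0n.
  have dst : `|s - t| < (n t).+1%:R^-1.
    rewrite -[X in _ < X]mul1r ltr_pdivlMr // -[X in _ * X]gtr0_norm //.
    rewrite -normrM mulrBl.
    have /andP[] := floor_itv (s * (n t).+1%:R).
    have /andP[] := floor_itv (t * (n t).+1%:R).
    by rewrite fl !intrD ltr_norml; set m := _%:~R; lra.
  have := hn t tab s sab st dst.
  rewrite -nst in dst; rewrite distrC in dst; rewrite eq_sym in st.
  by move=> /lt_trans/(_ (hn s sab t tab st dst)); rewrite ltxx.
have cab : countable `]a, b[%classic.
  apply/countable_injP; exists (pickle \o k) => s t sab tab /=.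
  by move/(pcan_inj pickleK); exact: ik.
(* A countable set has Lebesgue measure zero, whereas this interval has measure [b - a]. *)
have := countable_lebesgue_measure0 cab.
rewrite lebesgue_measure_itv /= lte_fin ab -EFinB => -[] /eqP.
by rewrite subr_eq0 gt_eqF.
Qed.

End OneVariable.

(** * Semialgebraic functions and eventual monotonicity *)

Section SemialgebraicFunctions.
Context {R : realType}.

(** Semialgebraic functions through their graph, [None] being the coordinate of the value. *)
Definition sfun (I : Type) (u : (I -> R) -> R) :=
  sdef (fun e : option I -> R => u (fun i => e (Some i)) = e None).

Lemma sdef_exists_fin (J I : finType) (P : (I -> R) -> (J -> R) -> Prop) :
  sdef (fun e : I + J -> R => P (fun i => e (inl i)) (fun j => e (inr j))) ->
  sdef (fun e => exists z, P e z).
Proof.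
pose T (i : I + J) : (I + 'I_#|J| -> R) -> R :=
  match i with inl i => fun e => e (inl i) | inr j => fun e => e (inr (enum_rank j)) end.
have pT i : polyfun (T i) by case: i => i; exact: polyfun_var.
move=> /(sdef_subst pT) sP.
apply: eq_sdef (sdef_exists_vec
  (P := fun e z => P e (fun j => z (enum_rank j))) sP) => e.
split=> [[z Pz]|[z Pz]]; first by exists (fun j => z (enum_rank j)).
exists (fun k => z (enum_val k)); move: Pz; congr P.
by apply/funext => j; rewrite enum_rankK.
Qed.

Lemma sfun_poly I (u : (I -> R) -> R) : polyfun u -> sfun u.
Proof.
move=> pu; apply: sdef_eq; last exact: polyfun_var.
by apply: (polyfun_subst (T := fun i (e : option I -> R) => e (Some i))) => // i;
   exact: polyfun_var.
Qed.

Lemma sfun_subst I J (T : I -> (J -> R) -> R) (u : (I -> R) -> R) :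
  (forall i, polyfun (T i)) -> sfun u -> sfun (fun e => u (T ^~ e)).
Proof.
move=> pT su.
pose T' (o : option I) : (option J -> R) -> R :=
  if o is Some i then fun e => T i (fun j => e (Some j)) else fun e => e None.
have pT' o : polyfun (T' o).
  case: o => [i|] /=; last exact: polyfun_var.
  by apply: (polyfun_subst (T := fun i (e : option J -> R) => e (Some i))) => // j;
   exact: polyfun_var.
exact: sdef_subst pT' su.
Qed.

(** Unlike polynomials, semialgebraic functions are substituted through a quantifier: [P] holds at
    [T ^~ e] iff it holds at some [z] with [T j e = z j] for all [j]. *)
Lemma sdef_app (J I : finType) (T : J -> (I -> R) -> R) (P : (J -> R) -> Prop) :
  (forall j, sfun (T j)) -> sdef P -> sdef (fun e => P (T ^~ e)).
Proof.
move=> sT sP.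
suff : sdef (fun e => exists z : J -> R, (forall j, T j e = z j) /\ P z).
  apply: eq_sdef => e; split=> [[z [Tz]]|PT]; last by exists (T ^~ e).
  by congr P; apply/funext.
apply: sdef_exists_fin; apply: sdef_and.
  apply: sdef_all_fin => j.
  pose T' (o : option I) : (I + J -> R) -> R :=
    if o is Some i then fun e => e (inl i) else fun e => e (inr j).
  have pT' o : polyfun (T' o) by case: o => [i|]; exact: polyfun_var.
  exact: sdef_subst pT' (sT j).
by apply: (sdef_subst (T := fun j (e : I + J -> R) => e (inr j))) => // j;
   exact: polyfun_var.
Qed.

Lemma sfun_app (J I : finType) (T : J -> (I -> R) -> R) (u : (J -> R) -> R) :
  (forall j, sfun (T j)) -> sfun u -> sfun (fun e => u (T ^~ e)).
Proof.
move=> sT su.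
pose T' (o : option J) : (option I -> R) -> R :=
  if o is Some j then fun e => T j (fun i => e (Some i)) else fun e => e None.
have sT' o : sfun (T' o).
  case: o => [j|] /=; last exact: sfun_poly (polyfun_var _).
  by apply: (sfun_subst (T := fun i (e : option I -> R) => e (Some i))) => // i;
   exact: polyfun_var.
exact: sdef_app sT' su.
Qed.

Section Closure.
Variable I : finType.
Implicit Types u v : (I -> R) -> R.

Lemma sfun_var i : sfun (fun e : I -> R => e i).
Proof. exact: sfun_poly (polyfun_var _). Qed.

Lemma sfun_cst c : sfun (fun _ : I -> R => c).
Proof. exact: sfun_poly (polyfun_cst _ _). Qed.

(** Binary operations and relations are substitutions into functions of two variables, indexed by
    [bool]. *)
Let pair_fun u v (b : bool) := if b then u else v.

Let sfun_pair u v : sfun u -> sfun v -> forall b, sfun (pair_fun u v b).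
Proof. by move=> su sv []. Qed.

Lemma sfunD u v : sfun u -> sfun v -> sfun (fun e => u e + v e).
Proof.
move=> su sv; apply: (sfun_app (sfun_pair su sv)
  (u := fun z : bool -> R => z true + z false)).
by apply: sfun_poly; apply: polyfunD; exact: polyfun_var.
Qed.

Lemma sfunM u v : sfun u -> sfun v -> sfun (fun e => u e * v e).
Proof.
move=> su sv; apply: (sfun_app (sfun_pair su sv)
  (u := fun z : bool -> R => z true * z false)).
by apply: sfun_poly; apply: polyfunM; exact: polyfun_var.
Qed.

Lemma sfunN u : sfun u -> sfun (fun e => - u e).
Proof.
move=> su; under eq_fun do rewrite -mulN1r.
exact: sfunM (sfun_cst _) su.
Qed.

Lemma sfunB u v : sfun u -> sfun v -> sfun (fun e => u e - v e).
Proof. by move=> su sv; exact: sfunD su (sfunN sv). Qed.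

Lemma sfunX u k : sfun u -> sfun (fun e => u e ^+ k).
Proof.
move=> su; elim: k => [|k ih]; first exact: sfun_cst.
by under eq_fun do rewrite exprS; exact: sfunM.
Qed.

Lemma sfun_sum (J : Type) (s : seq J) (u : J -> (I -> R) -> R) :
  (forall j, sfun (u j)) -> sfun (fun e => \sum_(j <- s) u j e).
Proof.
move=> su; elim: s => [|j s ih].
  by under eq_fun do rewrite big_nil; exact: sfun_cst.
by under eq_fun do rewrite big_cons; exact: sfunD.
Qed.

Lemma sdef_ltf u v : sfun u -> sfun v -> sdef (fun e => u e < v e).
Proof.
move=> su sv; apply: (sdef_app (sfun_pair su sv)
  (P := fun z : bool -> R => z true < z false)).
by apply: sdef_lt; exact: polyfun_var.
Qed.

Lemma sdef_lef u v : sfun u -> sfun v -> sdef (fun e => u e <= v e).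
Proof.
move=> su sv; apply: (sdef_app (sfun_pair su sv)
  (P := fun z : bool -> R => z true <= z false)).
by apply: sdef_le; exact: polyfun_var.
Qed.

Lemma sdef_eqf u v : sfun u -> sfun v -> sdef (fun e => u e = v e).
Proof.
move=> su sv; apply: (sdef_app (sfun_pair su sv)
  (P := fun z : bool -> R => z true = z false)).
by apply: sdef_eq; exact: polyfun_var.
Qed.

End Closure.

Lemma sfun_max0 (I : finType) (u : (I -> R) -> R) :
  sfun u -> sfun (fun e => Num.max 0 (u e)).
Proof.
move=> su.
have s0 : sfun (fun z : unit -> R => Num.max 0 (z tt)).
  apply: (@eq_sdef R (option unit) (fun e =>
    (e (Some tt) <= 0 /\ e None = 0) \/ (0 <= e (Some tt) /\ e None = e (Some tt)))).
    move=> e; case: (leP 0 (e (Some tt))) => h; last first.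
      by split=> [[[_ ->]|[]]|<-] //; left; rewrite ltW.
    split=> [[[h' ->]|[_ ->]//]|<-]; last by right.
    by apply/eqP; rewrite eq_le h h'.
  by apply: sdef_or; apply: sdef_and;
     do ?[apply: sdef_le|apply: sdef_eq]; exact: polyfun_var || exact: polyfun_cst.
exact: (sfun_app (fun=> su) s0).
Qed.

Definition sfun1 (u : R -> R) := sfun (fun e : unit -> R => u (e tt)).

Lemma sfun1_app (I : finType) (u : R -> R) (v : (I -> R) -> R) :
  sfun1 u -> sfun v -> sfun (fun e => u (v e)).
Proof. by move=> su sv; exact: (sfun_app (fun=> sv) su). Qed.

(** Unfolding the quantifiers of [right_of] shows that the behaviour of a semialgebraic [u] just
    after [t] is a semialgebraic condition on [t], to which [sdef1_germ] applies in turn. *)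
Lemma sdef_right_of (I : finType) (P : (I -> R) -> R -> Prop) t :
  sdef (fun e : option I -> R => P (fun i => e (Some i)) (e None)) -> sfun t ->
  sdef (fun e => right_of (P e) (t e)).
Proof.
move=> sP st.
apply: (@eq_sdef R I (fun e => exists d, 0 < d /\
   forall s, t e < s /\ s < t e + d -> P e s)).
  move=> e; split=> [[d [d0 hd]]|[d d0 hd]]; exists d => //.
    by move=> s /andP; exact: hd.
  by split=> // s /andP; exact: hd.
have st2 : sfun (fun e : option (option I) -> R => t (fun i => e (Some (Some i)))).
  apply: (sfun_subst (T := fun i (e : option (option I) -> R) => e (Some (Some i)))) => // i.
  exact: polyfun_var.
apply: sdef_exists; apply: sdef_and.
  by apply: sdef_ltf; [exact: sfun_cst|exact: sfun_var].
apply: sdef_forall; apply: sdef_imp.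
  apply: sdef_and; apply: sdef_ltf => //; do ?exact: sfun_var.
  by apply: sfunD => //; exact: sfun_var.
pose T (o : option I) : (option (option I) -> R) -> R :=
  if o is Some i then fun e => e (Some (Some i)) else fun e => e None.
have pT o : polyfun (T o) by case: o => [i|]; exact: polyfun_var.
exact: sdef_subst pT sP.
Qed.

Lemma sdef_left_of (I : finType) (P : (I -> R) -> R -> Prop) t :
  sdef (fun e : option I -> R => P (fun i => e (Some i)) (e None)) -> sfun t ->
  sdef (fun e => left_of (P e) (t e)).
Proof.
move=> sP st.
apply: (@eq_sdef R I (fun e => right_of (fun s => P e (- s)) (- t e))).
  move=> e; split=> [/right_ofN//|[d d0 hd]]; exists d => // s hs.
  by apply: hd; move: hs; lra.
apply: sdef_right_of; last exact: sfunN.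
pose T (o : option I) : (option I -> R) -> R :=
  if o is Some i then fun e => e (Some i) else fun e => - e None.
have pT o : polyfun (T o).
  by case: o => [i|]; [exact: polyfun_var|exact: polyfunN (polyfun_var _)].
exact: sdef_subst pT sP.
Qed.

Lemma sdef1_germ3 (A B C : R -> Prop) (e : R) : sdef1 A -> sdef1 B -> 0 < e ->
  (forall t, [\/ A t, B t | C t]) ->
  exists2 d, 0 < d <= e & [\/ forall t, 0 < t < d -> A t,
    forall t, 0 < t < d -> B t | forall t, 0 < t < d -> C t].
Proof.
move=> sA sB e0 ABC.
have [d /andP[d0 de] [hA|hA]] := sdef1_germ sA e0.
  by exists d; [rewrite d0|constructor 1].
have [d' /andP[d'0 dd'] [hB|hB]] := sdef1_germ sB d0.
  by exists d'; [rewrite d'0 (le_trans dd')|constructor 2].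
exists d'; first by rewrite d'0 (le_trans dd').
constructor 3 => t /andP[t0 td']; case: (ABC t) => //.
  by move/(hA t); rewrite t0 (lt_le_trans td' dd') => /(_ isT).
by move/(hB t); rewrite t0 td' => /(_ isT).
Qed.

(** * Monotonicity near 0 of a semialgebraic function of one variable *)

Section Monotone.
Variable u : R -> R.
Hypothesis su : sfun1 u.

(** [Q] receives the value at [t] first, so [ltQ] on the left means that [u] is larger than [u t]
    just before [t]. *)
Let right_type (Q : R -> R -> Prop) t := right_of (fun s => Q (u t) (u s)) t.
Let left_type (Q : R -> R -> Prop) t := left_of (fun s => Q (u t) (u s)) t.
Let ltQ (a b : R) : Prop := a < b.
Let eqQ (a b : R) : Prop := a = b.
Let gtQ (a b : R) : Prop := b < a.

Let sd (Q : R -> R -> Prop) :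
  sdef (fun z : bool -> R => Q (z true) (z false)) ->
  sdef (fun e : option unit -> R => Q (u (e (Some tt))) (u (e None))).
Proof.
move=> sQ; pose T (b : bool) (e : option unit -> R) :=
  u (e (if b then Some tt else None)).
have sT b : sfun (T b) by case: b; exact: sfun1_app su (sfun_var _).
exact: (sdef_app sT sQ).
Qed.

Let sd_right Q : sdef (fun z : bool -> R => Q (z true) (z false)) ->
  sdef1 (right_type Q).
Proof. by move=> /sd sQ; exact: sdef_right_of sQ (sfun_var tt). Qed.

Let sd_left Q : sdef (fun z : bool -> R => Q (z true) (z false)) ->
  sdef1 (left_type Q).
Proof. by move=> /sd sQ; exact: sdef_left_of sQ (sfun_var tt). Qed.

Let sd_lt : sdef (fun z : bool -> R => ltQ (z true) (z false)).
Proof. by apply: sdef_lt; exact: polyfun_var. Qed.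

Let sd_eq : sdef (fun z : bool -> R => eqQ (z true) (z false)).
Proof. by apply: sdef_eq; exact: polyfun_var. Qed.

Let s1 t : sdef1 (fun s => u t < u s).
Proof. by apply: sdef_ltf; [exact: sfun_cst|exact: sfun1_app su (sfun_var _)]. Qed.

Let s2 t : sdef1 (fun s => u s < u t).
Proof. by apply: sdef_ltf; [exact: sfun1_app su (sfun_var _)|exact: sfun_cst]. Qed.

Lemma right_trichotomy t :
  [\/ right_type ltQ t, right_type eqQ t | right_type gtQ t].
Proof.
case: (sdef1_right t (s1 t)) => [|h1]; first by constructor 1.
case: (sdef1_right t (s2 t)) => [|h2]; first by constructor 3.
constructor 2; have [d d0 hd] := right_of_and h1 h2; exists d => // s /hd[].
by move=> /negP + /negP; rewrite -!leNgt => ? ?; apply/eqP; rewrite eq_le; apply/andP.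
Qed.

Lemma left_trichotomy t :
  [\/ left_type ltQ t, left_type eqQ t | left_type gtQ t].
Proof.
case: (sdef1_left t (s1 t)) => [|[d1 d10 h1]]; first by constructor 1.
case: (sdef1_left t (s2 t)) => [|[d2 d20 h2]]; first by constructor 3.
constructor 2; exists (Num.min d1 d2); first by rewrite lt_min d10.
move=> s /andP[]; rewrite ltrBlDr -ltrBlDl lt_min => /andP[sd1 sd2] st.
have /negP := h1 s ltac:(by rewrite st andbT ltrBlDr -ltrBlDl).
have /negP := h2 s ltac:(by rewrite st andbT ltrBlDr -ltrBlDl).
by rewrite -!leNgt => ? ?; apply/eqP; rewrite eq_le; apply/andP.
Qed.

Let local_mono d :
  (forall t, 0 < t < d -> right_type ltQ t \/ right_type eqQ t) ->
  (forall t, 0 < t < d -> left_type gtQ t \/ left_type eqQ t) ->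
  forall s t, 0 < s -> s <= t -> t < d -> u s <= u t.
Proof.
move=> hr hl; apply: local_nondecreasing => t td.
have [r r0 hr'] : exists2 r, 0 < r & forall s, t < s < t + r -> u t <= u s.
  case: (hr t td) => -[r r0 h]; exists r => // s /h; first exact: ltW.
  by rewrite /eqQ => ->.
have [l l0 hl'] : exists2 l, 0 < l & forall s, t - l < s < t -> u s <= u t.
  case: (hl t td) => -[l l0 h]; exists l => // s /h; first exact: ltW.
  by rewrite /eqQ => ->.
exists (Num.min r l); first by rewrite lt_min r0.
move=> s sd'; rewrite lt_min !ltr_norml => /andP[rs ls].
by split=> ts; [apply: hr'|apply: hl']; lra.
Qed.

(** [u] would be constant just before [d / 2]; two points [s < s'] of that stretch, with [s'] close
    to [s], then contradict the irreflexivity of [Q]. *)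
Let left_eq_right d Q : 0 < d -> (forall a, ~ Q a a) ->
  (forall t, 0 < t < d -> right_type Q t) ->
  ~ (forall t, 0 < t < d -> left_type eqQ t).
Proof.
move=> d0 irr hr hl.
have [l l0 h] := hl (d / 2) ltac:(lra).
pose s := Num.max (d / 4) (d / 2 - l / 2).
have sl : d / 2 - l < s < d / 2 by rewrite /s lt_max gt_max; lra.
have s0 : 0 < s by rewrite lt_max; lra.
have [r' r0 h'] := hr s ltac:(lra).
pose s' := Num.min (s + r' / 2) ((s + d / 2) / 2).
have s's : s < s' < s + r' by rewrite /s' lt_min gt_min; lra.
have s'd : s' < d / 2 by rewrite /s' gt_min; lra.
have := h' s' s's; have <- := h s ltac:(lra).
have <- := h s' ltac:(lra); exact: irr.
Qed.

Let right_eq_left d Q : 0 < d -> (forall a, ~ Q a a) ->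
  (forall t, 0 < t < d -> right_type eqQ t) ->
  ~ (forall t, 0 < t < d -> left_type Q t).
Proof.
move=> d0 irr hr hl.
have [l l0 h] := hr (d / 2) ltac:(lra).
pose s := Num.min (3 * d / 4) (d / 2 + l / 2).
have sl : d / 2 < s < d / 2 + l by rewrite /s lt_min gt_min; lra.
have sd' : s < d by rewrite /s gt_min; lra.
have [r' r0 h'] := hl s ltac:(lra).
pose s' := Num.max (s - r' / 2) ((s + d / 2) / 2).
have s's : s - r' < s' < s by rewrite /s' lt_max gt_max; lra.
have s'd : d / 2 < s' by rewrite /s' lt_max; lra.
have := h' s' s's; have <- := h s ltac:(lra).
have <- := h s' ltac:(lra); exact: irr.
Qed.

(** The left type is also the same for all small [t]. Larger values on the left would make every
    point a strict local minimum, and equal values would contradict the strict right type; smaller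
    values on the left give monotonicity. *)
Lemma right_lt_nondecreasing d : 0 < d ->
  (forall t, 0 < t < d -> right_type ltQ t) ->
  exists2 d', 0 < d' <= d &
    forall s t, 0 < s -> s <= t -> t < d' -> u s <= u t.
Proof.
move=> d0 hr.
have [d' /andP[d'0 dd'] H] := sdef1_germ3 (sd_left sd_lt) (sd_left sd_eq) d0 left_trichotomy.
have hr' t : 0 < t < d' -> right_type ltQ t by move=> ?; apply: hr; lra.
exists d'; first by rewrite d'0.
case: H => hl.
- exfalso; apply: (@not_all_strict_local_min R u 0 d' d'0) => t td.
  have [r r0 h1] := hr' t td; have [l l0 h2] := hl t td.
  exists (Num.min r l); first by rewrite lt_min r0.
  move=> s _; rewrite neq_lt lt_min !ltr_norml => /orP[st|st] /andP[? ?].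
    by apply: h2; lra.
  by apply: h1; lra.
- have irr a : ~ ltQ a a by rewrite /ltQ ltxx.
  by case: (left_eq_right d'0 irr hr' hl).
- by apply: local_mono => t td; left; [exact: hr'|exact: hl].
Qed.

(** A strict left type would contradict constancy on the right, so [u] is locally constant on both
    sides. *)
Lemma right_eq_nondecreasing d : 0 < d ->
  (forall t, 0 < t < d -> right_type eqQ t) ->
  exists2 d', 0 < d' <= d &
    forall s t, 0 < s -> s <= t -> t < d' -> u s <= u t.
Proof.
move=> d0 hr.
have [d' /andP[d'0 dd'] H] := sdef1_germ3 (sd_left sd_lt) (sd_left sd_eq) d0 left_trichotomy.
have hr' t : 0 < t < d' -> right_type eqQ t by move=> ?; apply: hr; lra.
exists d'; first by rewrite d'0.
case: H => hl.
- have irr a : ~ ltQ a a by rewrite /ltQ ltxx.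
  by case: (right_eq_left d'0 irr hr' hl).
- by apply: local_mono => t td; right; [exact: hr'|exact: hl].
- have irr a : ~ gtQ a a by rewrite /gtQ ltxx.
  by case: (right_eq_left d'0 irr hr' hl).
Qed.

Lemma right_cases (e : R) : 0 < e -> exists2 d, 0 < d <= e &
  [\/ forall t, 0 < t < d -> right_of (fun s => u t < u s) t,
      forall t, 0 < t < d -> right_of (fun s => u t = u s) t
    | forall t, 0 < t < d -> right_of (fun s => u s < u t) t].
Proof.
by move=> e0; exact: sdef1_germ3 (sd_right sd_lt) (sd_right sd_eq) e0 right_trichotomy.
Qed.

End Monotone.

Theorem sfun1_eventually_monotone (u : R -> R) (e : R) : sfun1 u -> 0 < e ->
  exists2 d, 0 < d <= e &
    (forall s t, 0 < s -> s <= t -> t < d -> u s <= u t) \/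
    (forall s t, 0 < s -> s <= t -> t < d -> u t <= u s).
Proof.
move=> su e0; have [d /andP[d0 de] []] := right_cases su e0.
- move=> /(right_lt_nondecreasing su d0)[d' /andP[d'0 dd'] h].
  by exists d'; [rewrite d'0 (le_trans dd')|left].
- move=> /(right_eq_nondecreasing su d0)[d' /andP[d'0 dd'] h].
  by exists d'; [rewrite d'0 (le_trans dd')|left].
- move=> h.
  have sNu : sfun1 (fun t => - u t) by exact: sfunN su.
  have h' t : 0 < t < d -> right_of (fun s => - u t < - u s) t.
    by move/h => -[r r0 hr]; exists r => // s /hr; rewrite ltrN2.
  have [d' /andP[d'0 dd'] h2] := right_lt_nondecreasing sNu d0 h'.
  exists d'; [by rewrite d'0 (le_trans dd')|right] => s t s0 st td.
  by rewrite -lerN2; exact: h2.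
Qed.

End SemialgebraicFunctions.

(** * The gradient inequality *)

Section RowVectors.
Context {R : realType}.

Lemma coord_le_norm n (x : 'rV[R]_n) i : `|x 0 i| <= `|x|.
Proof.
rewrite [leRHS]mx_normrE; exact: (le_bigmax _ (fun ij => `|x ij.1 ij.2|) (ord0, i)).
Qed.

Lemma norm_rV_le n (x : 'rV[R]_n) c : 0 <= c ->
  (forall i, `|x 0 i| <= c) -> `|x| <= c.
Proof.
move=> c0 xc; rewrite [leLHS]mx_normrE; apply/bigmax_leP; split=> // -[i j] _ /=.
by rewrite ord1.
Qed.

Lemma norm_rV_le_sum n (x : 'rV[R]_n) : `|x| <= \sum_i `|x 0 i|.
Proof.
apply: norm_rV_le => [|i]; first by apply: sumr_ge0.
by rewrite (bigD1 i) //= lerDl sumr_ge0.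
Qed.

Lemma closed_le_continuous (T : topologicalType) (u : T -> R) c :
  continuous u -> closed [set z | u z <= c].
Proof. by move=> cu; apply: (preimage_closed _ (@closed_le R c)) => z _; exact: cu. Qed.

Lemma closed_eq_continuous (T : topologicalType) (u : T -> R) c :
  continuous u -> closed [set z | u z = c].
Proof. by move=> cu; apply: (preimage_closed _ (@closed_eq R c)) => z _; exact: cu. Qed.

(** * Lexicographic minima of compact sets *)

Definition lexlt n (z z' : 'I_n -> R) :=
  exists i : 'I_n, (forall j : 'I_n, (j < i)%N -> z j = z' j) /\ z i < z' i.

(** The coordinates are minimised one after the other: at stage [k] the next one is minimised over
    the compact set of points of [A] that share the first [k] coordinates of the current
    minimiser. *)
Lemma exists_lexmin n (A : set 'rV[R]_n) : compact A -> A !=set0 ->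
  exists2 z, A z & forall z', A z' ->
    (forall j, z' 0 j = z 0 j) \/ lexlt (fun j => z 0 j) (fun j => z' 0 j).
Proof.
move=> cA A0.
suff H k : exists2 z, A z & forall z', A z' ->
    (forall j : 'I_n, (j < k)%N -> z' 0 j = z 0 j) \/
    lexlt (fun j => z 0 j) (fun j => z' 0 j).
  have [z Az hz] := H n; exists z => // z' /hz[h|]; last by right.
  by left=> j; exact: h.
elim: k => [|k [z Az hz]]; first by case: A0 => z Az; exists z => // z' _; left.
case: (ltnP k n) => [kn|nk]; last first.
  exists z => // z' /hz[h|]; last by right.
  by left=> j _; apply: h; exact: leq_trans (ltn_ord j) nk.
pose B := A `&` [set z' | forall j : 'I_n, (j < k)%N -> z' 0 j = z 0 j].
have cB : compact B.
  apply: compact_closedI => //.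
  rewrite (_ : [set _ | _] =
    \bigcap_(j in [set j : 'I_n | (j < k)%N]) [set z' | z' 0 j = z 0 j]) //.
  by apply: closed_bigI => j _; apply: closed_eq_continuous; exact: coord_continuous.
pose o := Ordinal kn.
have [c cB' minc] := @EVT_min_rV R n (fun z => z 0 o) B (ex_intro _ z (conj Az (fun _ _ => erefl))) cB
   (continuous_subspaceT (@coord_continuous _ _ _ 0 o)).
move: cB'; rewrite inE => -[Ac hc].
exists c => // z' Az'.
case: (pselect (forall j : 'I_n, (j < k)%N -> z' 0 j = z 0 j)) => [h|nh]; last first.
  case: (hz z' Az') => [//|[i [h zi]]].
  have ik : (i < k)%N.
    rewrite ltnNge; apply/negP => ki; apply: nh => j jk; rewrite h //.
    exact: leq_trans ki.
  right; exists i; split=> [j ji|]; last by rewrite hc.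
  by rewrite hc ?h // (ltn_trans ji).
have := minc z'; rewrite !inE => /(_ (conj Az' h)).
rewrite le_eqVlt => /predU1P[cz|cz]; [left|right].
  move=> j; rewrite ltnS leq_eqVlt => /predU1P[jk|jk].
    by rewrite (_ : j = o) //; exact/val_inj.
  by rewrite hc // h.
by exists o; split=> //= j jk; rewrite hc // h.
Qed.

Lemma lexmin_unique n (P : ('I_n -> R) -> Prop) z1 z2 :
  P z1 -> (forall z', P z' -> (forall j, z' j = z1 j) \/ lexlt z1 z') ->
  P z2 -> (forall z', P z' -> (forall j, z' j = z2 j) \/ lexlt z2 z') ->
  z1 = z2.
Proof.
move=> P1 h1 P2 h2; apply/funext => k.
case: (h1 _ P2) => [->//|[i [hi zi]]].
case: (h2 _ P1) => [->//|[j [hj zj]]].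
exfalso; case: (ltngtP i j) => [ij|ji|/val_inj ij].
- by move: zi; rewrite hj // ltxx.
- by move: zj; rewrite hi // ltxx.
- by move: zj; rewrite -ij => /(lt_trans zi); rewrite ltxx.
Qed.

(** The smallest of finitely many thresholds works for all indices, because each [Q j] persists
    below its own threshold. *)
Lemma fin_pos_choice (J : finType) (e : R) (Q : J -> R -> Prop) : 0 < e ->
  (forall j, exists2 d, 0 < d <= e & forall d', 0 < d' <= d -> Q j d') ->
  exists2 d, 0 < d <= e & forall j, Q j d.
Proof.
move=> e0 H.
suff [d de hd] : exists2 d, 0 < d <= e &
    forall j, j \in enum J -> forall d', 0 < d' <= d -> Q j d'.
  exists d => // j; apply: (hd j); first by rewrite mem_enum.
  by case/andP: de => ->; rewrite lexx.
elim: (enum J) => [|a s [d /andP[d0 de] hd]]; first by exists e; rewrite ?e0 ?lexx.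
have [c /andP[c0 ce] hc] := H a.
exists (Num.min c d); first by rewrite lt_min c0 d0 ge_min ce.
move=> j; rewrite inE => /predU1P[->|js] d' /andP[d'0]; rewrite le_min => /andP[dc dd].
  by apply: hc; rewrite d'0.
by apply: hd => //; rewrite d'0.
Qed.

End RowVectors.

(** * Gradients: first-order estimate and epsilon-delta description *)

Section Gradient.
Context {R : realType} {n : nat}.
Implicit Types (F : 'rV[R]_n -> R) (z w : 'rV[R]_n).

Lemma diff_grad F z w : differentiable F z ->
  'd F z w = \sum_j w 0 j * grad F z 0 j.
Proof.
move=> dF; rewrite [w in LHS]row_sum_delta linear_sum; apply: eq_bigr => j _.
by rewrite linearZ /= mxE deriveE.
Qed.

(** The max-norm of the gradient is paired with its dual norm, the sum of the coordinate increments.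
    The latter telescopes along a curve with monotone coordinates. *)
Lemma differentiable_lipschitz F z eta : differentiable F z -> 0 < eta ->
  exists2 d, 0 < d & forall z', `|z' - z| < d ->
    `|F z' - F z| <= (`|grad F z| + eta) * \sum_j `|z' 0 j - z 0 j|.
Proof.
move=> dF eta0; have /diff_locally/eqaddoP/(_ _ eta0)/nbhs_ballP[d d0 hd] := dF.
exists d => // z' zz'.
have := hd (z' - z); rewrite /= -ball_normE /= sub0r normrN => /(_ zz').
rewrite !fctE /= subrK /cst opprD addrA => h.
set S := \sum_j _.
have zS : `|z' - z| <= S.
  by apply: (le_trans (norm_rV_le_sum _)); apply: ler_sum => j _; rewrite !mxE.
have dS : `|'d F z (z' - z)| <= `|grad F z| * S.
  rewrite diff_grad // mulr_sumr; apply: (le_trans (ler_norm_sum _ _ _)).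
  apply: ler_sum => j _; rewrite normrM mulrC ler_pM ?coord_le_norm //.
  by rewrite !mxE.
rewrite -[F z' - F z](subrK ('d F z (z' - z))).
apply: (le_trans (ler_normD _ _)); rewrite mulrDl addrC lerD //.
by apply: (le_trans h); rewrite ler_pM2l.
Qed.

(** Multiplication by [t] clears the difference quotient and squaring removes absolute values, so
    the right-hand side is a semialgebraic condition on [d] whenever [F] is semialgebraic. *)
Lemma derive_graph F z v (d : R) : derivable F z v ->
  'D_v F z = d <-> forall eps, 0 < eps -> exists delta, 0 < delta /\
    forall t, - delta < t /\ t < delta ->
      (F (z + t *: v) - F z - d * t) ^+ 2 <= (eps * t) ^+ 2.
Proof.
move=> dF.
have sqE (a b : R) : 0 < b -> forall t, (a ^+ 2 <= (b * t) ^+ 2) = (`|a| <= b * `|t|).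
  move=> b0 t; rewrite -[in RHS](gtr0_norm b0) -normrM.
  rewrite -(real_normK (num_real a)) -(real_normK (num_real (b * t))).
  by rewrite ler_sqr ?nnegrE.
have H (eps : R) : 0 < eps -> exists delta, 0 < delta /\ forall t, - delta < t /\ t < delta ->
      `|F (z + t *: v) - F z - 'D_v F z * t| <= eps * `|t|.
  move=> e0; move: (dF) => /cvgrPdist_le/(_ _ e0)/nbhs_ballP[delta d0 hd].
  exists delta; split=> // t [t1 t2].
  have [->|t0] := eqVneq t 0; first by rewrite scale0r addr0 subrr mulr0 subr0 normr0 mulr0.
  have := hd t; rewrite /= -ball_normE /= sub0r normrN ltr_norml t1 t2 => /(_ isT t0) h.
  rewrite -ler_pdivrMr ?normr_gt0 // -normfV -normrM.
  move: h; rewrite distrC /= [z + _]addrC; congr (`|_| <= _).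
  by rewrite mulrBl mulfK // mulrC.
split=> [<- eps e0|h].
  have [delta [d0 hd]] := H eps e0; exists delta; split=> // t /hd.
  by rewrite sqE.
apply/eqP; rewrite -subr_eq0 -normr_le0; apply/ler_addgt0Pl => eps e0; rewrite addr0.
have e20 : 0 < eps / 2 by rewrite divr_gt0.
have [d1 [d10 h1]] := H _ e20; have [d2 [d20 h2]] := h _ e20.
(* Both linear approximations are tested at a common [t], which bounds the distance between the two
   slopes by [eps]. *)
pose t := Num.min d1 d2 / 2.
have t0 : 0 < t by rewrite divr_gt0 // lt_min d10.
have t1 : t < d1 by rewrite ltr_pdivrMr // gt_min; apply/orP; left; lra.
have t2 : t < d2 by rewrite ltr_pdivrMr // gt_min; apply/orP; right; lra.
have := h1 t; have := h2 t; rewrite sqE // !(gtr0_norm t0).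
move=> /(_ ltac:(lra)) a /(_ ltac:(lra)) b.
rewrite -(ler_pM2r t0) -[X in _ * X <= _](gtr0_norm t0) -normrM.
move: a b; rewrite !ler_norml; lra.
Qed.

End Gradient.

(** * The curve of lexicographically smallest points of the slices, and its length *)

Section GradientInequality.
Context {R : realType}.

Definition sfunv n (F : 'rV[R]_n -> R) :=
  sfun (fun e : 'I_n -> R => F (\row_j e j)).

Lemma sfunv_app n (F : 'rV[R]_n -> R) (I : finType)
    (T : 'I_n -> (I -> R) -> R) : sfunv F -> (forall j, sfun (T j)) ->
  sfun (fun e => F (\row_j T j e)).
Proof. by move=> sF sT; exact: (sfun_app sT sF). Qed.

Variables (n : nat) (F : 'rV[R]_n -> R).
Hypotheses (C1F : C1_scalar F) (sF : sfunv F).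
Variables (z0 : 'rV[R]_n) (Fz0 : F z0 = 0) (C : R) (C0 : 0 < C).

Definition slice t : set 'rV[R]_n :=
  [set z | `|z - z0| <= 1 /\ F z = t /\ `|grad F z| <= C * t].

(* [slice] with the partial derivatives replaced by their epsilon-delta
   definition, in which squares stand for absolute values. *)
Definition slicef t (z : 'I_n -> R) :=
  (forall i, z0 0 i - 1 <= z i /\ z i <= z0 0 i + 1) /\ F (\row_j z j) = t /\
  (forall i, exists d, (forall eps, 0 < eps -> exists delta, 0 < delta /\
      forall s, - delta < s /\ s < delta ->
        (F (\row_j (z j + s * (j == i)%:R)) - F (\row_j z j) - d * s) ^+ 2
          <= (eps * s) ^+ 2) /\ - (C * t) <= d /\ d <= C * t).

Lemma sliceE t z : 0 < t -> slice t z <-> slicef t (fun j => z 0 j).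
Proof.
have zE : \row_j z 0 j = z by apply/rowP => j; rewrite mxE.
have dE i s : \row_j (z 0 j + s * (j == i)%:R) = z + s *: delta_mx 0 i.
  by apply/rowP => j; rewrite !mxE eqxx.
have dF i : derivable F z (delta_mx 0 i : 'rV_n) by apply: diff_derivable; exact: C1F.1.
move=> t0; rewrite /slice /slicef /= zE; split=> [[h1 [h2 h3]]|[h1 [h2 h3]]].
  split.
    move=> i; have := le_trans (coord_le_norm (z - z0) i) h1.
    by rewrite !mxE ler_norml; lra.
  split=> // i; exists (grad F z 0 i); split.
    move=> eps e0.
    have [delta [d0 hd]] := (derive_graph (grad F z 0 i) (dF i)).1 (esym (mxE _ _ _ _)) eps e0.
    by exists delta; split=> // s /hd; rewrite dE.
  by have := le_trans (coord_le_norm (grad F z) i) h3; rewrite ler_norml => /andP[].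
split.
  by apply: norm_rV_le => // i; have := h1 i; rewrite !mxE ler_norml; lra.
split=> //; apply: norm_rV_le => [|i]; first by rewrite mulr_ge0 ?ltW.
have [d [hd [d1 d2]]] := h3 i; rewrite mxE.
rewrite ((derive_graph d (dF i)).2 _) ?ler_norml ?d1 //.
move=> eps /hd[delta [d0 hd']]; exists delta; split=> // s /hd'.
by rewrite dE.
Qed.

Lemma sdef_slicef (I : finType) (t : (I -> R) -> R) (z : 'I_n -> (I -> R) -> R) :
  sfun t -> (forall j, sfun (z j)) -> sdef (fun e => slicef (t e) (z ^~ e)).
Proof.
pose T (o : option 'I_n) (e : I -> R) := if o is Some j then z j e else t e.
move=> st sz; have sT o : sfun (T o) by case: o => [j|]; [exact: sz|exact: st].
suff sS : sdef (fun e : option 'I_n -> R => slicef (e None) (fun j => e (Some j))).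
  exact: (sdef_app sT sS).
apply: sdef_and.
  apply: sdef_all_fin => i.
  by apply: sdef_and; apply: sdef_le; do ?exact: polyfun_var; exact: polyfun_cst.
apply: sdef_and.
  by apply: sdef_eqf; [apply: sfunv_app => // j; exact: sfun_var|exact: sfun_var].
apply: sdef_all_fin => i; apply: sdef_exists; apply: sdef_and; last first.
  apply: sdef_and; apply: sdef_lef; do ?exact: sfun_var; do ?apply: sfunN;
    by apply: sfunM; [exact: sfun_cst|exact: sfun_var].
apply: sdef_forall; apply: sdef_imp.
  by apply: sdef_ltf; [exact: sfun_cst|exact: sfun_var].
apply: sdef_exists; apply: sdef_and.
  by apply: sdef_ltf; [exact: sfun_cst|exact: sfun_var].
apply: sdef_forall; apply: sdef_imp.
  by apply: sdef_and; apply: sdef_ltf; do ?apply: sfunN; exact: sfun_var.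
apply: sdef_lef; apply: sfunX; last by apply: sfunM; exact: sfun_var.
apply: sfunB; last by apply: sfunM; exact: sfun_var.
apply: sfunB; apply: sfunv_app => // j; last exact: sfun_var.
by apply: sfunD; [exact: sfun_var|apply: sfunM; [exact: sfun_var|exact: sfun_cst]].
Qed.

Definition lexmin_slice t z := slicef t z /\ forall z', slicef t z' ->
  (forall j, z' j = z j) \/ lexlt z z'.

Lemma sdef_lexmin_slice (I : finType) (t : (I -> R) -> R)
    (z : 'I_n -> (I -> R) -> R) :
  sfun t -> (forall j, sfun (z j)) -> sdef (fun e => lexmin_slice (t e) (z ^~ e)).
Proof.
pose T (o : option 'I_n) (e : I -> R) := if o is Some j then z j e else t e.
move=> st sz; have sT o : sfun (T o) by case: o => [j|]; [exact: sz|exact: st].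
suff sS : sdef (fun e : option 'I_n -> R => lexmin_slice (e None) (fun j => e (Some j))).
  exact: (sdef_app sT sS).
apply: sdef_and; first by apply: sdef_slicef => [|j]; exact: sfun_var.
apply: sdef_forall_vec; apply: sdef_imp.
  by apply: sdef_slicef => [|j]; exact: sfun_var.
apply: sdef_or.
  by apply: sdef_all_fin => j; apply: sdef_eq; exact: polyfun_var.
apply: sdef_ex_fin => i; apply: sdef_and; last by apply: sdef_lt; exact: polyfun_var.
apply: sdef_all_fin => j; apply: sdef_imp; first exact: sdef_cst.
by apply: sdef_eq; exact: polyfun_var.
Qed.

(* Taking the lexicographic minimum makes the choice of a point of each slice
   semialgebraic. *)
Definition curve t : 'I_n -> R :=
  if pselect (exists z, lexmin_slice t z) is left h then projT1 (cid h) else fun=> 0.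

Lemma curveP t : (exists z, lexmin_slice t z) -> lexmin_slice t (curve t).
Proof. by rewrite /curve; case: pselect => // h _; case: cid. Qed.

Lemma curve_sfun i : sfun1 (fun t => curve t i).
Proof.
(* The second alternative accounts for the default value 0 of [curve] where no smallest point
   exists. *)
apply: (@eq_sdef R (option unit) (fun e =>
  (exists z, lexmin_slice (e (Some tt)) z /\ z i = e None) \/
  (~ (exists z, lexmin_slice (e (Some tt)) z) /\ e None = 0))).
  move=> e; split=> [[[z [hz <-]]|[nz ->]]|<-].
  - have [h1 h2] := curveP (ex_intro _ z hz); have [h3 h4] := hz.
    by rewrite (lexmin_unique h1 h2 h3 h4).
  - by rewrite /curve; case: pselect.
  - case: (pselect (exists z, lexmin_slice (e (Some tt)) z)) => h.
      by left; exists (curve (e (Some tt))); split=> //; exact: curveP.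
    by right; split=> //; rewrite /curve; case: pselect.
have sL : sdef (fun e : option unit + 'I_n -> R =>
    lexmin_slice (e (inl (Some tt))) (fun j => e (inr j))).
  by apply: sdef_lexmin_slice => [|j]; exact: sfun_var.
apply: sdef_or.
  apply: sdef_exists_vec; apply: sdef_and; first exact: sL.
  by apply: sdef_eq; exact: polyfun_var.
apply: sdef_and; first by apply: sdef_not; apply: sdef_exists_vec.
by apply: sdef_eq; [exact: polyfun_var|exact: polyfun_cst].
Qed.

Lemma slice_compact t : compact (slice t).
Proof.
apply: bounded_closed_compact.
  exists (1 + `|z0|); split; first exact: num_real.
  move=> M hM z [h _] /=; apply: le_trans (ltW hM).
  rewrite -[z in leLHS](subrK z0); apply: (le_trans (ler_normD _ _)).
  by rewrite lerD2r.
have c1 : continuous (fun z : 'rV[R]_n => `|z - z0|).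
  move=> z; apply: (@cvg_norm _ _ _ (nbhs z)).
  by apply: cvgB; [exact: cvg_id|exact: cvg_cst].
have c2 : continuous F by move=> z; apply: differentiable_continuous; exact: C1F.1.
have c3 : continuous (fun z => `|grad F z|).
  by move=> z; apply: (@cvg_norm _ _ _ (nbhs z)); exact: C1F.2.
apply: closedI; first exact: closed_le_continuous.
by apply: closedI; [exact: closed_eq_continuous|exact: closed_le_continuous].
Qed.

Lemma slice_curve t : 0 < t -> slice t !=set0 -> slice t (\row_j curve t j).
Proof.
move=> t0 st.
have [z sz hz] := exists_lexmin (@slice_compact t) st.
have : lexmin_slice t (curve t).
  apply: curveP; exists (fun j => z 0 j); split; first exact/sliceE.
  move=> z' hz'; have := hz (\row_j z' j).
  have E : (fun j => (\row_j0 z' j0) 0 j) = z' by apply/funext => j; rewrite mxE.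
  rewrite E => /(_ _)[|h|]; last by right.
    by apply/sliceE => //; rewrite E.
  by left=> j; rewrite -h mxE.
move=> [h _]; apply/sliceE => //.
by rewrite (_ : (fun j => _) = curve t) //; apply/funext => j; rewrite mxE.
Qed.

(** The levels with a nonempty slice form a semialgebraic set, so near 0 either all positive levels
    or none belong to it. The points violating the inequality have [F z] positive, and arbitrarily
    small by continuity, which excludes the second case. *)
Lemma slice_nonempty :
  (forall r, 0 < r -> exists2 z, `|z - z0| < r & `|grad F z| < C * F z) ->
  exists2 e, 0 < e & forall t, 0 < t < e -> slice t !=set0.
Proof.
move=> H.
have sD : sdef1 (fun t => exists z, slicef t z).
  by apply: sdef_exists_vec; apply: sdef_slicef => [|j]; exact: sfun_var.
have [d /andP[d0 _] [hd|hd]] := sdef1_germ sD ltr01.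
  exists d => // t td; have [z hz] := hd t td; exists (\row_j z j).
  apply/sliceE; first by case/andP: td.
  by rewrite (_ : (fun j => _) = z) //; apply/funext => j; rewrite mxE.
have cF : {for z0, continuous F} by apply: differentiable_continuous; exact: C1F.1.
move: cF => /cvgrPdist_lt/(_ _ d0)/nbhs_ballP[r r0 hr].
have [z zr hz] := H (Num.min r 1) ltac:(by rewrite lt_min r0 ltr01).
move: zr; rewrite lt_min => /andP[zr z1].
have Fz : 0 < F z by rewrite -(pmulr_rgt0 _ C0); exact: le_lt_trans hz.
have Fd : F z < d.
  have := hr z; rewrite -ball_normE /= distrC => /(_ zr).
  by rewrite Fz0 sub0r normrN gtr0_norm.
case: (hd (F z)); first by rewrite Fz.
by exists (fun j => z 0 j); apply/sliceE => //; split; [exact: ltW|split=> //; exact: ltW].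
Qed.

Lemma ln_sub_le (s t : R) : 0 < s -> 0 < t -> ln t - ln s <= (t - s) / s.
Proof.
move=> s0 t0; rewrite -ln_div ?posrE // mulrBl divff ?gt_eqF //.
have := expR_ge1Dx (ln (t / s)).
by rewrite lnK ?posrE ?divr_gt0 //; lra.
Qed.

Theorem gradient_inequality :
  exists2 r, 0 < r & forall z, `|z - z0| < r -> C * F z <= `|grad F z|.
Proof.
apply: contrapT => H.
have {}H r : 0 < r -> exists2 z, `|z - z0| < r & `|grad F z| < C * F z.
  move=> r0; apply: contrapT => H2; apply: H; exists r => // z zr.
  by rewrite leNgt; apply/negP => h; apply: H2; exists z.
have [e e0 he] := slice_nonempty H.
have zt t : 0 < t < e -> slice t (\row_j curve t j).
  by move=> te; apply: slice_curve; [case/andP: te|exact: he].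
pose mono i d := exists sg : R, (sg = 1 \/ sg = -1) /\
  forall s t, 0 < s -> s <= t -> t < d -> sg * curve s i <= sg * curve t i.
have [d /andP[d0 de] hd] : exists2 d, 0 < d <= e & forall i, mono i d.
  apply: fin_pos_choice => // i.
  have [d dd [hd|hd]] := sfun1_eventually_monotone (curve_sfun i) e0;
    exists d => // d' /andP[_ dd'].
    exists 1; split; first by left.
    by move=> s t s0 st td; rewrite !mul1r; apply: hd => //; exact: lt_le_trans dd'.
  exists (-1); split; first by right.
  by move=> s t s0 st td; rewrite !mulN1r lerN2; apply: hd => //; exact: lt_le_trans dd'.
have [sg hsg] := choice hd.
(* With the signs of monotonicity, [W t - W s] is the sum [S t s] of the coordinate increments; it
   is at most [2 n] because the curve stays in the unit ball around [z0]. *)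
pose W t := \sum_i sg i * curve t i.
pose S t s := \sum_i `|curve t i - curve s i|.
have SC t s : S t s = S s t by apply: eq_bigr => i _; rewrite distrC.
have SW s t : 0 < s -> s <= t -> t < d -> S t s = W t - W s.
  move=> s0 st td; rewrite /W -sumrB; apply: eq_bigr => i _.
  have [sg1 /(_ _ _ s0 st td)] := hsg i; rewrite -mulrBr.
  case: sg1 => ->; rewrite ?mul1r ?mulN1r => h.
    by rewrite ger0_norm ?subr_ge0.
  by rewrite ler0_norm // subr_le0; move: h; rewrite lerN2.
have S2 s t : 0 < s -> s <= t -> t < d -> S t s <= 2 * n%:R.
  move=> s0 st td; have cz r : 0 < r < e -> forall i, `|curve r i - z0 0 i| <= 1.
    move=> re i; have [h _] := zt r re.
    by have := le_trans (coord_le_norm _ i) h; rewrite !mxE.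
  have : S t s <= \sum_(i < n) 2.
    apply: ler_sum => i _.
    have := cz s ltac:(lra) i; have := cz t ltac:(lra) i.
    by rewrite !ler_norml; lra.
  by rewrite sumr_const card_ord -[leRHS]mulr_natr.
(* Where the curve jumps at [t0] the bound is trivial, hence no continuity of the
   curve is needed. *)
have locS t0 : 0 < t0 < d -> exists2 r, 0 < r & forall t, 0 < t < d ->
    `|t - t0| < r -> `|t - t0| / (2 * C * t0) <= S t t0.
  move=> /andP[t00 t0d].
  have [_ [Fz gz]] := zt t0 ltac:(lra).
  have Ct0 : 0 < C * t0 by rewrite mulr_gt0.
  (* The slack [C * t0] turns the gradient bound [C * t0] into the Lipschitz constant [2 * C * t0];
     the radius in [t] chosen next settles the case where the curve moves by at least [r]. *)
  have [r r0 hr] := differentiable_lipschitz (C1F.1 (\row_j curve t0 j)) Ct0.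
  exists (2 * C * t0 * r) => [|t /andP[t1 t2] tr].
    by rewrite mulr_gt0 // -mulrA mulr_gt0.
  have C20 : 0 < 2 * C * t0 by rewrite -mulrA mulr_gt0.
  have SE : \sum_j `|(\row_j curve t j) 0 j - (\row_j curve t0 j) 0 j| = S t t0.
    by apply: eq_bigr => j _; rewrite !mxE.
  rewrite ler_pdivrMr //.
  case: (ltrP `|\row_j curve t j - \row_j curve t0 j| r) => h.
    have := hr _ h; have [_ [-> _]] := zt t ltac:(lra).
    rewrite Fz SE => /le_trans; apply.
    rewrite [leRHS]mulrC ler_wpM2r ?sumr_ge0 // -mulrA mulr2n mulrDl mul1r.
    by rewrite lerD2r.
  apply: (le_trans (ltW tr)); rewrite [leRHS]mulrC ler_pM2l // (le_trans h) //.
  rewrite -SE; apply: le_trans (norm_rV_le_sum _) _.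
  by apply: ler_sum => j _; rewrite !mxE.
(* Near [t0] one has [|ln t - ln t0| <= 2 |t - t0| / t0], so a length of at least
   [|t - t0| / (2 C t0)] dominates the variation of [ln t / (4 C)]. *)
pose V t := W t - (4 * C)^-1 * ln t.
have Vmono : forall s t, 0 < s -> s <= t -> t < d -> V s <= V t.
  apply: local_nondecreasing => t0 t0d; have /andP[t00 t0d'] := t0d.
  have [r r0 hr] := locS t0 t0d.
  (* Staying within [t0 / 2] of [t0] keeps [t > t0 / 2], hence [1 / t <= 2 / t0]. *)
  exists (Num.min r (t0 / 2)); first by rewrite lt_min r0 divr_gt0.
  move=> t td; have /andP[t1 t2] := td; rewrite lt_min => /andP[tr th].
  have aE : `|t - t0| / (2 * C * t0) = (4 * C)^-1 * (2 * `|t - t0| / t0).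
    by field; rewrite !gt_eqF.
  have {hr} h := hr t td tr; rewrite aE in h.
  have K0 : 0 < (4 * C)^-1 by rewrite invr_gt0 mulr_gt0.
  split=> [tt|tt].
    rewrite SW ?(ltW tt) // in h.
    have l1 : ln t - ln t0 <= 2 * `|t - t0| / t0.
      apply: (le_trans (ln_sub_le t00 t1)).
      by rewrite ler_pM2r ?invr_gt0 // gtr0_norm ?subr_gt0 //; lra.
    have := ler_pM2l K0 (ln t - ln t0) (2 * `|t - t0| / t0); rewrite l1 /V mulrBr.
    lra.
  rewrite SC SW ?(ltW tt) // in h.
  have l1 : ln t0 - ln t <= 2 * `|t - t0| / t0.
    apply: (le_trans (ln_sub_le t1 t00)).
    rewrite ltr0_norm ?subr_lt0 // opprB [2 * _]mulrC -mulrA ler_pM2l ?subr_gt0 //.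
    rewrite -[X in X <= _]mul1r ler_pdivrMr // mulrAC ler_pdivlMr // mul1r.
    by move: th; rewrite ltr_norml; lra.
  have := ler_pM2l K0 (ln t0 - ln t) (2 * `|t - t0| / t0); rewrite l1 /V mulrBr.
  lra.
have K0 : 0 < (4 * C)^-1 by rewrite invr_gt0 mulr_gt0.
(* Going from [t] down to [t * expR (- M)] lowers the logarithm by [M], hence costs a length of at
   least [2 n + 1], more than the available [2 n]. *)
pose M : R := (2 * n%:R + 1) * (4 * C).
have M0 : 0 <= M by rewrite mulr_ge0 ?addr_ge0 ?mulr_ge0 ?ler01 ?(ltW C0) //.
pose t := d / 2; have t0 : 0 < t by rewrite divr_gt0.
have td : t < d by rewrite /t; lra.
pose s := t * expR (- M); have s0 : 0 < s by rewrite mulr_gt0 ?expR_gt0.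
have st : s <= t by rewrite ger_pMr // -expR0 ler_expR oppr_le0.
have lns : ln s = ln t - M by rewrite lnM ?posrE ?expR_gt0 // expRK.
have := S2 s t s0 st td; rewrite SW //.
have := Vmono s t s0 st td; rewrite /V lns mulrBr.
have -> : (4 * C)^-1 * M = 2 * n%:R + 1 by rewrite mulrC mulfK // gt_eqF // mulr_gt0.
lra.
Qed.

End GradientInequality.

(** * Semialgebraic maps *)

Section SemialgebraicMaps.
Context {R : realType}.

Lemma polyfun_peval N (q : mpoly.mpoly N R) :
  polyfun (fun e : 'I_N -> R => peval q (\row_j e j)).
Proof.
rewrite /peval; under eq_fun do rewrite mpoly.mevalE.
apply: polyfun_sum => m; apply: polyfunM; first exact: polyfun_cst.
apply: polyfun_prod => i; apply: polyfunX.
by under eq_fun do rewrite mxE; exact: polyfun_var.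
Qed.

Lemma sdef_all I (J : Type) (s : seq J) (P : J -> (I -> R) -> bool) :
  (forall j, sdef (fun e => P j e)) -> sdef (fun e => all (P ^~ e) s).
Proof.
move=> sP; elim: s => [|j s ih] /=; first exact: sdef_cst.
by apply: eq_sdef (sdef_and (sP j) ih) => e; split=> /andP.
Qed.

Lemma sdef_has I (J : Type) (s : seq J) (P : J -> (I -> R) -> bool) :
  (forall j, sdef (fun e => P j e)) -> sdef (fun e => has (P ^~ e) s).
Proof.
move=> sP; elim: s => [|j s ih] /=; first exact: sdef_cst.
by apply: eq_sdef (sdef_or (sP j) ih) => e; split=> /orP.
Qed.

Lemma sdef_semialgebraic N (A : set 'rV[R]_N) :
  semialgebraic_set A -> sdef (fun e : 'I_N -> R => A (\row_j e j)).
Proof.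
move=> [s ->]; apply: (@sdef_has _ _ s (fun d e =>
  basic_semialgebraic d.1 d.2 (\row_j e j))) => d.
have s1 : sdef (fun e : 'I_N -> R => all (fun q => peval q (\row_j e j) == 0) d.1).
  apply: (@sdef_all _ _ _ (fun q e => peval q (\row_j e j) == 0)) => q.
  apply: eq_sdef (sdef_eq (polyfun_peval q) (polyfun_cst _ 0)) => e.
  by split=> /eqP.
have s2 : sdef (fun e : 'I_N -> R => all (fun q => 0 < peval q (\row_j e j)) d.2).
  apply: (@sdef_all _ _ _ (fun q e => 0 < peval q (\row_j e j))) => q.
  exact: sdef_lt (polyfun_cst _ 0) (polyfun_peval q).
by apply: eq_sdef (sdef_and s1 s2) => e; split=> /andP.
Qed.

(** The graph of the component [k] is the projection of the graph of [g] that forgets the other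
    components. *)
Lemma sfunv_semialgebraic n m (g : 'rV[R]_n -> 'rV[R]_m) k :
  semialgebraic_map g -> sfunv (fun x => g x 0 k).
Proof.
move=> /sdef_semialgebraic sA.
pose T (j : 'I_(n + m)) : (option 'I_n + 'I_m -> R) -> R :=
  match fintype.split j with inl i => fun e => e (inl (Some i)) | inr i => fun e => e (inr i) end.
have pT j : polyfun (T j) by rewrite /T; case: fintype.split => i; exact: polyfun_var.
pose G := range (fun x => row_mx x (g x)).
have sG : sdef (fun e => G (\row_j T j e)) := sdef_subst pT sA.
apply: (eq_sdef (P := fun e : option 'I_n -> R => exists y : 'I_m -> R,
    G (row_mx (\row_i e (Some i)) (\row_i y i)) /\ y k = e None)).
  move=> e; split=> [[y [[x _ /eq_row_mx[-> ->]] <-]]|<-]; first by rewrite mxE.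
  exists (fun i => g (\row_i e (Some i)) 0 i); split=> //.
  exists (\row_i e (Some i)) => //; congr row_mx.
  by apply/rowP => j; rewrite mxE.
apply: sdef_exists_vec; apply: sdef_and; last by apply: sdef_eq; exact: polyfun_var.
apply: eq_sdef sG => e; rewrite (_ : \row_j _ =
  row_mx (\row_i e (inl (Some i))) (\row_i e (inr i))) //.
by apply/rowP => j; rewrite !mxE /T; case: fintype.split => i; rewrite mxE.
Qed.

End SemialgebraicMaps.

(** * The gradient of the augmented Lagrangian *)

Section Differentials.
Context {R : realType} {V : normedModType R}.
Implicit Types (u v du dv : V -> R) (z : V).

(** The differential is recorded as a plain function, so that the rules of calculus compose and
    [eq_has_diff] can rearrange the result. *)
Definition has_diff z u du := differentiable u z /\ forall w, 'd u z w = du w.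

Lemma has_diff_cst z (c : R) : has_diff z (fun=> c) (fun=> 0).
Proof. by split=> [|w]; [exact: differentiable_cst|rewrite diff_cst]. Qed.

Lemma has_diffD z u v du dv : has_diff z u du -> has_diff z v dv ->
  has_diff z (fun x => u x + v x) (fun w => du w + dv w).
Proof.
move=> [du1 du2] [dv1 dv2]; split; first exact: differentiableD.
by move=> w; rewrite (diffD du1 dv1) /= du2 dv2.
Qed.

Lemma has_diffM z u v du dv : has_diff z u du -> has_diff z v dv ->
  has_diff z (fun x => u x * v x) (fun w => u z * dv w + v z * du w).
Proof.
move=> [du1 du2] [dv1 dv2]; split; first exact: differentiableM.
by move=> w; rewrite (diffM du1 dv1) /= -dv2 -du2.
Qed.

Lemma eq_has_diff z u du dv : (forall w, du w = dv w) ->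
  has_diff z u du -> has_diff z u dv.
Proof. by move=> e [d1 d2]; split=> // w; rewrite d2. Qed.

Lemma has_diffZ z (c : R) u du : has_diff z u du ->
  has_diff z (fun x => c * u x) (fun w => c * du w).
Proof.
move=> h; apply: eq_has_diff (has_diffM (has_diff_cst z c) h) => w.
by rewrite mulr0 addr0.
Qed.

Lemma has_diffN z u du : has_diff z u du ->
  has_diff z (fun x => - u x) (fun w => - du w).
Proof.
move=> /(has_diffZ (-1)) h; under eq_fun do rewrite -mulN1r.
by apply: eq_has_diff h => w; rewrite mulN1r.
Qed.

Lemma has_diff_sum z (I : Type) (s : seq I) (u du : I -> V -> R) :
  (forall i, has_diff z (u i) (du i)) ->
  has_diff z (fun x => \sum_(i <- s) u i x) (fun w => \sum_(i <- s) du i w).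
Proof.
move=> h; elim: s => [|i s ih].
  under eq_fun do rewrite big_nil.
  by apply: eq_has_diff (has_diff_cst z 0) => w; rewrite big_nil.
under eq_fun do rewrite big_cons.
by apply: eq_has_diff (has_diffD (h i) ih) => w; rewrite big_cons.
Qed.

(** The remainder is quadratic even across the kink, whence the differentiability of the squared
    positive part everywhere. *)
Lemma sqr_pos_expansion (t s : R) :
  `|Num.max 0 (t + s) ^+ 2 - Num.max 0 t ^+ 2 - 2 * Num.max 0 t * s| <= s ^+ 2.
Proof.
rewrite ler_norml.
by case: (leP 0 t) => t0; case: (leP 0 (t + s)) => ts0; apply/andP; split; nra.
Qed.

Lemma is_derive_sqr_pos (t : R) :
  is_derive t (1 : R) (fun s : R => Num.max 0 s ^+ 2) (2 * Num.max 0 t).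
Proof.
set phi := fun s : R => Num.max 0 s ^+ 2.
suff h : h^-1 *: ((phi \o shift t) (h *: (1 : R)) - phi t) @[h --> (0 : R)^']
    --> 2 * Num.max 0 t.
  split; first by apply/cvg_ex; exists (2 * Num.max 0 t).
  exact/cvg_lim.
apply/cvgrPdist_le => e e0; near=> h.
have h0 : h != 0 by near: h; exact: nbhs_dnbhs_neq.
have he : `|h| <= e by near: h; apply: dnbhs0_le.
rewrite distrC /= /phi [h *: 1]mulr1 -[_ *: _]/(_ * _) [h + t]addrC.
rewrite -[_ - 2 * _](mulKf h0) normrM.
have -> : h * (h^-1 * (Num.max 0 (t + h) ^+ 2 - Num.max 0 t ^+ 2) - 2 * Num.max 0 t) =
    Num.max 0 (t + h) ^+ 2 - Num.max 0 t ^+ 2 - 2 * Num.max 0 t * h.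
  by rewrite mulrBr mulrA divff // mul1r [h * _]mulrC.
rewrite normfV ler_pdivrMl ?normr_gt0 //.
apply: (le_trans (sqr_pos_expansion _ _)).
by rewrite -(real_normK (num_real h)) expr2 ler_wpM2l.
Unshelve. all: by end_near. Qed.

Lemma has_diff_sqr_pos z u du : has_diff z u du ->
  has_diff z (fun x => Num.max 0 (u x) ^+ 2) (fun w => 2 * Num.max 0 (u z) * du w).
Proof.
move=> [du1 du2]; have [d1 d2] := is_derive_sqr_pos (u z).
have dphi : differentiable (fun s : R => Num.max 0 s ^+ 2) (u z).
  exact/derivable1_diffP.
split; first exact: (differentiable_comp du1 dphi).
move=> w; rewrite (diff_comp du1 dphi) /= diff1E // derive1E d2 du2.
by rewrite -[_ *: _]/(_ * _) mulrC.
Qed.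

End Differentials.

(** * The differential of the augmented Lagrangian in [x] and [y] jointly *)

Section RowDifferentials.
Context {R : realType}.

Lemma has_diff_coord n (i : 'I_n) (z : 'rV[R]_n) :
  has_diff z (fun x => x 0 i) (fun w => w 0 i).
Proof.
have lin : linear (fun x : 'rV[R]_n => x 0 i : R^o) by move=> a x y; rewrite !mxE.
pose linM := GRing.isLinear.Build _ _ _ _ _ lin.
pose linL : {linear 'rV[R]_n -> R^o} := HB.pack (fun x : 'rV[R]_n => x 0 i : R^o) linM.
split; first exact: differentiable_coord.
move=> w; rewrite -[LHS]/('d (linL : _ -> R^o) z w) diff_lin //.
exact: coord_continuous.
Qed.

Lemma has_diff_comp (U V : normedModType R) (u : V -> R) (du : V -> R) (G : U -> V) z :
  differentiable G z -> has_diff (G z) u du ->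
  has_diff z (fun x => u (G x)) (fun w => du ('d G z w)).
Proof.
move=> dG [du1 du2]; split; first exact: (differentiable_comp dG du1).
by move=> w; rewrite (diff_comp dG du1) /= du2.
Qed.

Lemma diff_lsubmx m n (z : 'rV[R]_(m + n)) w : 'd (@lsubmx R 1 m n) z w = lsubmx w.
Proof. by rewrite diff_lin //; exact: continuous_lsubmx. Qed.

Lemma diff_rsubmx m n (z : 'rV[R]_(m + n)) w : 'd (@rsubmx R 1 m n) z w = rsubmx w.
Proof. by rewrite diff_lin //; exact: continuous_rsubmx. Qed.

Lemma has_diff_lsub m n (z : 'rV[R]_(m + n)) (u du : 'rV[R]_m -> R) :
  has_diff (lsubmx z) u du ->
  has_diff z (fun x => u (lsubmx x)) (fun w => du (lsubmx w)).
Proof.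
move=> h; apply: eq_has_diff (has_diff_comp (@differentiable_lsubmx R 1 m n z) h) => w.
by rewrite diff_lsubmx.
Qed.

Lemma has_diff_rsub m n (z : 'rV[R]_(m + n)) (u du : 'rV[R]_n -> R) :
  has_diff (rsubmx z) u du ->
  has_diff z (fun x => u (rsubmx x)) (fun w => du (rsubmx w)).
Proof.
move=> h; apply: eq_has_diff (has_diff_comp (@differentiable_rsubmx R 1 m n z) h) => w.
by rewrite diff_rsubmx.
Qed.

Lemma enorm_sqr n (v : 'rV[R]_n) : enorm v ^+ 2 = \sum_i v 0 i ^+ 2.
Proof. by rewrite sqr_sqrtr // sumr_ge0 // => i _; exact: sqr_ge0. Qed.

(** Transposition of the Jacobian: it turns the differentials of [g] produced by the chain rule into
    a linear form in [w] with coefficient vector [grad_comb g x lam]. *)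
Lemma sum_grad_comb n m (g : 'rV[R]_n -> 'rV[R]_m) x (lam : 'rV[R]_m) w :
  \sum_i lam 0 i * 'd g x w 0 i = \sum_k w 0 k * grad_comb g x lam 0 k.
Proof.
have -> : 'd g x w = w *m 'J g x by rewrite mul_rV_lin1.
transitivity ((lam *m (w *m 'J g x)^T) 0 0).
  by rewrite mxE; apply: eq_bigr => i _; rewrite [X in _ = _ * X]mxE.
have <- : (w *m (grad_comb g x lam)^T)^T = lam *m (w *m 'J g x)^T.
  by rewrite /grad_comb !trmx_mul !trmxK mulmxA.
rewrite mxE [LHS]mxE; apply: eq_bigr => k _; congr (_ * _).
by rewrite mxE.
Qed.

Variables (n m p : nat) (f : 'rV[R]_n -> R) (g : 'rV[R]_n -> 'rV[R]_m)
  (h : 'rV[R]_n -> 'rV[R]_p) (kappa : int).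
Hypotheses (hf : C1_scalar f) (hg : C1_vector g) (hh : C1_vector h).

(** [lagr_x] and [lagr_y] are the partial gradients of the ordinary Lagrangian of the relaxation
    problem with multipliers [U]; at the updated multipliers they are those of the augmented
    Lagrangian. *)
Definition lagr_x x y (U : multipliers R n m p) : 'rV[R]_n :=
  grad f x + grad_comb g x (m_lam U) + grad_comb h x (m_mu U) + hadamard (m_gam U) y.

Definition lagr_y x (U : multipliers R n m p) : 'rV[R]_n :=
  hadamard (m_gam U) x - const_mx (m_del U) + m_eta U.

(** A function of a single vector, so that one gradient inequality covers [x] and [y] together. *)
Definition joint_lagrangian L rho (z : 'rV[R]_(n + n)) : R :=
  aug_lagrangian f g h kappa (lsubmx z) (rsubmx z) L rho.

Lemma joint_lagrangianE L rho : joint_lagrangian L rho = fun z =>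
  f (lsubmx z) + rho / 2 *
   (\sum_i Num.max 0 (g (lsubmx z) 0 i + rho^-1 * m_lam L 0 i) ^+ 2 +
    \sum_j (h (lsubmx z) 0 j + rho^-1 * m_mu L 0 j) ^+ 2 +
    \sum_i (lsubmx z 0 i * rsubmx z 0 i + rho^-1 * m_gam L 0 i) ^+ 2 +
    Num.max 0 (n%:R - kappa%:~R - \sum_i rsubmx z 0 i + m_del L / rho) ^+ 2 +
    \sum_i Num.max 0 (rsubmx z 0 i - 1 + rho^-1 * m_eta L 0 i) ^+ 2).
Proof.
apply/funext => z; rewrite /joint_lagrangian /aug_lagrangian !enorm_sqr.
congr (_ + _ * (_ + _ + _ + _ + _)); apply: eq_bigr => i _; rewrite ?mxE //.
all: by rewrite /pospart /hadamard !mxE.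
Qed.

Lemma has_diff_sqr (V : normedModType R) (z : V) u du : has_diff z u du ->
  has_diff z (fun x => u x ^+ 2) (fun w => 2 * u z * du w).
Proof.
move=> hu; apply: eq_has_diff (has_diffM hu hu) => w.
by rewrite -mulrDl mulrC -mulr2n mulr_natl mulrC.
Qed.

Lemma has_diffDc (V : normedModType R) (z : V) (u du : V -> R) c :
  has_diff z u du -> has_diff z (fun x => u x + c) du.
Proof.
move=> hu; apply: eq_has_diff (has_diffD hu (has_diff_cst z c)) => w.
by rewrite addr0.
Qed.

Lemma max0_scale (c a b : R) : 0 < c ->
  c * Num.max 0 (a + c^-1 * b) = Num.max 0 (c * a + b).
Proof.
move=> c0; rewrite maxr_pMr ?(ltW c0) // mulr0 mulrDr mulrA divff ?mul1r //.
by rewrite gt_eqF.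
Qed.

Lemma has_diff_lagrangian L rho z : 0 < rho ->
  let x := lsubmx z in let y := rsubmx z in
  let U := mult_update g h kappa x y L rho in
  has_diff z (joint_lagrangian L rho) (fun w =>
    \sum_i (lsubmx w 0 i * lagr_x x y U 0 i) +
    \sum_i (rsubmx w 0 i * lagr_y x U 0 i)).
Proof.
move=> rho0 x y U; rewrite joint_lagrangianE.
have rN : rho != 0 by rewrite gt_eqF.
have dX i : has_diff z (fun z => lsubmx z 0 i) (fun w => lsubmx w 0 i).
  exact: (has_diff_lsub (has_diff_coord i _)).
have dY i : has_diff z (fun z => rsubmx z 0 i) (fun w => rsubmx w 0 i).
  exact: (has_diff_rsub (has_diff_coord i _)).
have dvec q (G : 'rV[R]_n -> 'rV[R]_q) i : (forall x, differentiable G x) ->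
    has_diff z (fun z => G (lsubmx z) 0 i) (fun w => 'd G x (lsubmx w) 0 i).
  move=> dG; apply: (has_diff_lsub (u := fun x => G x 0 i) (du := fun w => 'd G x w 0 i)).
  exact: (has_diff_comp (dG _) (has_diff_coord i _)).
have H0 : has_diff z (fun z => f (lsubmx z)) (fun w => \sum_i lsubmx w 0 i * grad f x 0 i).
  apply: (has_diff_lsub (du := fun w => \sum_i w 0 i * grad f x 0 i)).
  by split=> [|w]; [exact: hf.1|rewrite diff_grad //; exact: hf.1].
(* [max0_scale] turns [rho] times the shifted positive part into the updated multiplier, which
   leaves the factor [2 / rho] that cancels [rho / 2] at the end. *)
have H1 : has_diff z (fun z => \sum_i Num.max 0 (g (lsubmx z) 0 i + rho^-1 * m_lam L 0 i) ^+ 2)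
   (fun w => 2 / rho * \sum_i lsubmx w 0 i * grad_comb g x (m_lam U) 0 i).
  apply: eq_has_diff (has_diff_sum (index_enum _) (fun i => has_diff_sqr_pos (has_diffDc _ (dvec _ g i hg.1)))) => w.
  rewrite -sum_grad_comb mulr_sumr; apply: eq_bigr => i _.
  rewrite [m_lam U]/= [pospart _ 0 i]mxE !mxE -max0_scale // !mulrA.
  by rewrite mulfVK.
have H2 : has_diff z (fun z => \sum_i (h (lsubmx z) 0 i + rho^-1 * m_mu L 0 i) ^+ 2)
   (fun w => 2 / rho * \sum_i lsubmx w 0 i * grad_comb h x (m_mu U) 0 i).
  apply: eq_has_diff (has_diff_sum (index_enum _) (fun i => has_diff_sqr (has_diffDc _ (dvec _ h i hh.1)))) => w.
  rewrite -sum_grad_comb mulr_sumr; apply: eq_bigr => i _.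
  by rewrite [m_mu U]/= !mxE; field.
have H3 : has_diff z (fun z => \sum_i (lsubmx z 0 i * rsubmx z 0 i + rho^-1 * m_gam L 0 i) ^+ 2)
   (fun w => 2 / rho * \sum_i m_gam U 0 i * (lsubmx w 0 i * y 0 i + rsubmx w 0 i * x 0 i)).
  apply: eq_has_diff (has_diff_sum (index_enum _) (fun i => has_diff_sqr (has_diffDc _ (has_diffM (dX i) (dY i))))) => w.
  rewrite mulr_sumr; apply: eq_bigr => i _.
  by rewrite [m_gam U]/= !mxE; field.
have H4 : has_diff z (fun z => Num.max 0 (n%:R - kappa%:~R - \sum_i rsubmx z 0 i + m_del L / rho) ^+ 2)
   (fun w => 2 / rho * (m_del U * - \sum_i rsubmx w 0 i)).
  have dS := has_diffDc (n%:R - kappa%:~R) (has_diffN (has_diff_sum (index_enum _) dY)).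
  under eq_fun do rewrite [n%:R - _ - _]addrC.
  apply: eq_has_diff (has_diff_sqr_pos (has_diffDc (m_del L / rho) dS)) => w.
  rewrite [m_del U]/= /card_res /vsum [- _ + _]addrC [m_del L / rho]mulrC.
  by rewrite -max0_scale //; field.
have H5 : has_diff z (fun z => \sum_i Num.max 0 (rsubmx z 0 i - 1 + rho^-1 * m_eta L 0 i) ^+ 2)
   (fun w => 2 / rho * \sum_i m_eta U 0 i * rsubmx w 0 i).
  apply: eq_has_diff (has_diff_sum (index_enum _) (fun i => has_diff_sqr_pos (has_diffDc _ (has_diffDc _ (dY i))))) => w.
  rewrite mulr_sumr; apply: eq_bigr => i _.
  rewrite [m_eta U]/= [pospart _ 0 i]mxE !mxE -max0_scale // !mulrA.
  by rewrite mulfVK.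
apply: eq_has_diff (has_diffD H0 (has_diffZ (rho / 2)
  (has_diffD (has_diffD (has_diffD (has_diffD H1 H2) H3) H4) H5))) => w.
clearbody U.
rewrite -!mulrDr mulrA [rho / 2 * _](_ : _ = 1); last by field.
rewrite mul1r !mulrN mulr_sumr -sumrN -!big_split /=.
apply: eq_bigr => i _.
rewrite /lagr_x /lagr_y.
rewrite ![(_ + _ : 'rV_n) 0 i]mxE ![(- _ : 'rV_n) 0 i]mxE ![const_mx _ 0 i]mxE ![hadamard _ _ 0 i]mxE.
by ring.
Qed.

End RowDifferentials.

(** * Gradient, continuous differentiability and semialgebraicity of the augmented Lagrangian *)

Section LagrangianGradient.
Context {R : realType}.

Section Continuity.
Context {T : topologicalType}.
Implicit Types u v : T -> R.

Lemma eq_continuous u v : (forall z, u z = v z) -> continuous v -> continuous u.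
Proof. by move=> uv; rewrite (_ : u = v) //; apply/funext. Qed.

Lemma continuous_add u v : continuous u -> continuous v ->
  continuous (fun z => u z + v z).
Proof. by move=> cu cv z; apply: cvgD; [exact: cu|exact: cv]. Qed.

Lemma continuous_mul u v : continuous u -> continuous v ->
  continuous (fun z => u z * v z).
Proof. by move=> cu cv z; apply: cvgM; [exact: cu|exact: cv]. Qed.

Lemma continuous_opp u : continuous u -> continuous (fun z => - u z).
Proof. by move=> cu z; apply: cvgN; exact: cu. Qed.

Lemma continuous_sum (I : Type) (s : seq I) (u : I -> T -> R) :
  (forall i, continuous (u i)) -> continuous (fun z => \sum_(i <- s) u i z).
Proof.
move=> cu; elim: s => [|i s ih].
  by under eq_fun do rewrite big_nil; move=> z; exact: cvg_cst.
by under eq_fun do rewrite big_cons; exact: continuous_add.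
Qed.

Lemma continuous_max0 u : continuous u -> continuous (fun z => Num.max 0 (u z)).
Proof.
move=> cu; have -> : (fun z => Num.max 0 (u z)) = (fun z => (u z + `|u z|) * 2^-1).
  by apply/funext => z; rewrite maxr_absE sub0r normrN add0r.
apply: continuous_mul; last by move=> z; exact: cvg_cst.
apply: continuous_add => // z; apply: (@cvg_norm _ _ _ (nbhs z)); exact: cu.
Qed.

Lemma continuous_cst (c : R) : continuous (fun _ : T => c).
Proof. by move=> z; exact: cvg_cst. Qed.

Lemma continuous_coord m n (u : T -> 'M[R]_(m, n)) i j :
  continuous u -> continuous (fun z => u z i j).
Proof.
move=> cu z; apply: (@continuous_comp _ _ _ u (fun M => M i j)); first exact: cu.
exact: coord_continuous.
Qed.

Lemma continuous_rV n (u : T -> 'rV[R]_n) :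
  (forall i, continuous (fun z => u z 0 i)) -> continuous u.
Proof.
move=> cu z; apply/cvgrPdist_le => e e0.
have : \forall x \near z, forall i, `|u z 0 i - u x 0 i| <= e.
  apply: (@filter_forall _ _ (fun i => [set x | `|u z 0 i - u x 0 i| <= e])) => i.
  by move: (cu i z) => /cvgrPdist_le; exact.
apply: filterS => x h; apply: norm_rV_le; first exact: ltW.
by move=> i; rewrite !mxE.
Qed.

End Continuity.

Variables (n m p : nat) (f : 'rV[R]_n -> R) (g : 'rV[R]_n -> 'rV[R]_m)
  (h : 'rV[R]_n -> 'rV[R]_p) (kappa : int).
Hypotheses (hf : C1_scalar f) (hg : C1_vector g) (hh : C1_vector h).

Local Notation JL := (joint_lagrangian f g h kappa).

Lemma delta_mx_lshift k : delta_mx 0 (lshift n k) = row_mx (delta_mx 0 k) 0 :> 'rV[R]_(n + n).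
Proof.
apply/rowP => j; rewrite !mxE; case: fintype.splitP => i ji; rewrite !mxE ?eqxx /=.
  by rewrite -!val_eqE /= ji.
by rewrite -val_eqE /= ji gtn_eqF // ltn_addr.
Qed.

Lemma delta_mx_rshift k : delta_mx 0 (rshift n k) = row_mx 0 (delta_mx 0 k) :> 'rV[R]_(n + n).
Proof.
apply/rowP => j; rewrite !mxE; case: fintype.splitP => i ji; rewrite !mxE ?eqxx /=.
  by rewrite -val_eqE /= ji ltn_eqF // ltn_addr.
by rewrite -!val_eqE /= ji eqn_add2l.
Qed.

Lemma sum_delta (u : 'rV[R]_n) k : \sum_i (delta_mx 0 k : 'rV[R]_n) 0 i * u 0 i = u 0 k.
Proof.
rewrite (bigD1 k) //= big1 ?addr0 ?mxE ?eqxx ?mul1r // => i /negPf ik.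
by rewrite mxE ik andbF mul0r.
Qed.

Lemma sum_zero (u : 'rV[R]_n) : \sum_i (0 : 'rV[R]_n) 0 i * u 0 i = 0.
Proof. by rewrite big1 // => i _; rewrite mxE mul0r. Qed.

(** A directional derivative only sees the restriction to a line; this identifies the partial
    derivatives in [x] and in [y] with derivatives of the joint function. *)
Lemma eq_derive (U V : normedModType R) (F : U -> R) (G : V -> R) a v b w :
  (forall t : R, F (t *: v + a) = G (t *: w + b)) -> 'D_v F a = 'D_w G b.
Proof.
move=> FG; have FG0 : F a = G b by have := FG 0; rewrite !scale0r !add0r.
rewrite /derive (_ : (fun h => _) = (fun h => h^-1 *: ((G \o shift b) (h *: w) - G b))) //.
by apply/funext => t /=; rewrite FG FG0.
Qed.

Lemma grad_joint_lagrangian L rho z : 0 < rho ->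
  let x := lsubmx z in let y := rsubmx z in
  let U := mult_update g h kappa x y L rho in
  grad (JL L rho) z = row_mx (lagr_x f g h x y U) (lagr_y x U).
Proof.
move=> r0 x y U; have [d1 d2] := has_diff_lagrangian kappa hf hg hh L z r0.
apply/rowP => k; rewrite mxE deriveE // d2 -/x -/y -/U.
rewrite -[k]fintype.splitK; case: fintype.split => i /=.
  by rewrite delta_mx_lshift row_mxKl row_mxKr row_mxEl sum_delta sum_zero addr0.
by rewrite delta_mx_rshift row_mxKl row_mxKr row_mxEr sum_delta sum_zero add0r.
Qed.

Lemma grad_aug_lagrangianE x y L rho : 0 < rho ->
  let U := mult_update g h kappa x y L rho in
  grad_aug_lagrangian f g h kappa x y L rho =
    row_mx (lagr_x f g h x y U) (lagr_y x U).
Proof.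
move=> r0 U; have := grad_joint_lagrangian L (row_mx x y) r0.
rewrite row_mxKl row_mxKr -/U /= => <-.
apply/rowP => k; rewrite -[k]fintype.splitK /grad_aug_lagrangian.
case: fintype.split => i /=; rewrite ?row_mxEl ?row_mxEr [LHS]mxE [RHS]mxE.
  rewrite delta_mx_lshift; apply: eq_derive => t.
  rewrite /joint_lagrangian scale_row_mx add_row_mx.
  by rewrite row_mxKl row_mxKr scaler0 add0r.
rewrite delta_mx_rshift; apply: eq_derive => t.
rewrite /joint_lagrangian scale_row_mx add_row_mx.
by rewrite row_mxKl row_mxKr scaler0 add0r.
Qed.

Lemma continuous_grad_comb (T : topologicalType) q (G : 'rV[R]_n -> 'rV[R]_q)
    (x : T -> 'rV[R]_n) (lam : T -> 'rV[R]_q) i : C1_vector G ->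
  continuous x -> (forall j, continuous (fun z => lam z 0 j)) ->
  continuous (fun z => grad_comb G (x z) (lam z) 0 i).
Proof.
move=> [_ cJ] cx cl.
have -> : (fun z => grad_comb G (x z) (lam z) 0 i) =
    (fun z => \sum_j lam z 0 j * 'J G (x z) i j).
  by apply/funext => z; rewrite mxE; apply: eq_bigr => j _; rewrite [X in _ * X]mxE.
apply: continuous_sum => j; apply: continuous_mul => //.
apply: continuous_coord => z; apply: (@continuous_comp _ _ _ x); first exact: cx.
exact: cJ.
Qed.

Lemma lagr_xE x y (U : multipliers R n m p) i : lagr_x f g h x y U 0 i =
  grad f x 0 i + grad_comb g x (m_lam U) 0 i + grad_comb h x (m_mu U) 0 i
  + m_gam U 0 i * y 0 i.
Proof.
rewrite /lagr_x [LHS]mxE; congr (_ + _); last by rewrite mxE.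
by rewrite [LHS]mxE; congr (_ + _); rewrite [LHS]mxE.
Qed.

Lemma lagr_yE x (U : multipliers R n m p) i :
  lagr_y x U 0 i = m_gam U 0 i * x 0 i - m_del U + m_eta U 0 i.
Proof. by rewrite !mxE. Qed.

Lemma C1_joint_lagrangian L rho : 0 < rho -> C1_scalar (JL L rho).
Proof.
move=> r0; split=> [z|]; first by have [] := has_diff_lagrangian kappa hf hg hh L z r0.
have -> : grad (JL L rho) = fun z =>
  row_mx (lagr_x f g h (lsubmx z) (rsubmx z) (mult_update g h kappa (lsubmx z) (rsubmx z) L rho))
   (lagr_y (lsubmx z) (mult_update g h kappa (lsubmx z) (rsubmx z) L rho)).
  by apply/funext => z; exact: grad_joint_lagrangian.
have cX : continuous (@lsubmx R 1 n n) by exact: continuous_lsubmx.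
have cY : continuous (@rsubmx R 1 n n) by exact: continuous_rsubmx.
have cXi i : continuous (fun z : 'rV[R]_(n + n) => lsubmx z 0 i : R).
  exact: continuous_coord.
have cYi i : continuous (fun z : 'rV[R]_(n + n) => rsubmx z 0 i : R).
  exact: continuous_coord.
have cvec q (G : 'rV[R]_n -> 'rV[R]_q) j : C1_vector G ->
    continuous (fun z : 'rV[R]_(n + n) => G (lsubmx z) 0 j).
  move=> [dG _]; apply: continuous_coord => z.
  apply: (@continuous_comp _ _ _ (@lsubmx R 1 n n) G); first exact: cX.
  exact: differentiable_continuous.
have clam j : continuous (fun z : 'rV[R]_(n + n) =>
    m_lam (mult_update g h kappa (lsubmx z) (rsubmx z) L rho) 0 j).
  rewrite /=; under eq_fun do rewrite !mxE.
  apply: continuous_max0; apply: continuous_add; last exact: continuous_cst.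
  by apply: continuous_mul; [exact: continuous_cst|exact: cvec].
have cmu j : continuous (fun z : 'rV[R]_(n + n) =>
    m_mu (mult_update g h kappa (lsubmx z) (rsubmx z) L rho) 0 j).
  rewrite /=; under eq_fun do rewrite !mxE.
  apply: continuous_add; last exact: continuous_cst.
  by apply: continuous_mul; [exact: continuous_cst|exact: cvec].
have cgam j : continuous (fun z : 'rV[R]_(n + n) =>
    m_gam (mult_update g h kappa (lsubmx z) (rsubmx z) L rho) 0 j).
  rewrite /=; under eq_fun do rewrite !mxE.
  apply: continuous_add; last exact: continuous_cst.
  apply: continuous_mul; first exact: continuous_cst.
  by apply: continuous_mul; exact: coord_continuous.
have cdel : continuous (fun z : 'rV[R]_(n + n) =>
    m_del (mult_update g h kappa (lsubmx z) (rsubmx z) L rho)).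
  rewrite /=; apply: continuous_max0; apply: continuous_add; last exact: continuous_cst.
  apply: continuous_mul; first exact: continuous_cst.
  apply: continuous_add; first exact: continuous_cst.
  by apply: continuous_opp; exact: continuous_sum.
have ceta j : continuous (fun z : 'rV[R]_(n + n) =>
    m_eta (mult_update g h kappa (lsubmx z) (rsubmx z) L rho) 0 j).
  rewrite /=; under eq_fun do rewrite !mxE.
  apply: continuous_max0; apply: continuous_add; last exact: continuous_cst.
  apply: continuous_mul; first exact: continuous_cst.
  by apply: continuous_add; [exact: coord_continuous|exact: continuous_cst].
set U := mult_update g h kappa in clam cmu cgam cdel ceta *.
clearbody U.
apply: continuous_rV => k; rewrite -[k]fintype.splitK; case: fintype.split => i /=.
  apply: eq_continuous => [z|]; first by rewrite row_mxEl lagr_xE.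
  apply: continuous_add; last exact: continuous_mul.
  apply: continuous_add; last exact: continuous_grad_comb.
  apply: continuous_add; last exact: continuous_grad_comb.
  apply: continuous_coord => z.
  apply: (@continuous_comp _ _ _ (@lsubmx R 1 n n)); first exact: cX.
  exact: hf.2.
apply: eq_continuous => [z|]; first by rewrite row_mxEr lagr_yE.
apply: continuous_add => //; apply: continuous_add; first exact: continuous_mul.
exact: continuous_opp.
Qed.

(** Only the constraints are assumed semialgebraic, hence the zero objective; the lemma serves the
    infeasibility measure. *)
Lemma sfunv_joint_lagrangian L rho :
  (forall x, f x = 0) -> semialgebraic_map g -> semialgebraic_map h ->
  sfunv (JL L rho).
Proof.
move=> f0 sg sh; rewrite joint_lagrangianE /sfunv.
have sX i : sfun (fun e : 'I_(n + n) -> R => lsubmx (\row_j e j) 0 i).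
  by under eq_fun do rewrite !mxE; exact: sfun_var.
have sY i : sfun (fun e : 'I_(n + n) -> R => rsubmx (\row_j e j) 0 i).
  by under eq_fun do rewrite !mxE; exact: sfun_var.
have sG q (G : 'rV[R]_n -> 'rV[R]_q) k : semialgebraic_map G ->
    sfun (fun e : 'I_(n + n) -> R => G (lsubmx (\row_j e j)) 0 k).
  move=> /(sfunv_semialgebraic k) sGk.
  have := sfunv_app sGk sX; congr sfun; apply/funext => e; congr (G _ _ _).
  by apply/rowP => j; rewrite mxE.
under eq_fun do rewrite f0 add0r.
apply: sfunM; first exact: sfun_cst.
apply: sfunD.
  apply: sfunD.
    apply: sfunD.
      apply: sfunD.
        apply: sfun_sum => i; apply: sfunX; apply: sfun_max0.
        by apply: sfunD; [exact: sG|exact: sfun_cst].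
      apply: sfun_sum => i; apply: sfunX.
      by apply: sfunD; [exact: sG|exact: sfun_cst].
    apply: sfun_sum => i; apply: sfunX.
    by apply: sfunD; [exact: sfunM|exact: sfun_cst].
  apply: sfunX; apply: sfun_max0; apply: sfunD; last exact: sfun_cst.
  by apply: sfunB; [exact: sfun_cst|exact: sfun_sum].
apply: sfun_sum => i; apply: sfunX; apply: sfun_max0.
by apply: sfunD; [apply: sfunB => //; exact: sfun_cst|exact: sfun_cst].
Qed.

End LagrangianGradient.

(** * From approximate to exact multipliers under CC-PAM-regularity *)

Section ApproximateKKT.
Context {R : realType}.

Lemma mx_entry_le_norm n m (A : 'M[R]_(n, m)) i j : `|A i j| <= `|A|.
Proof.
rewrite [leRHS]mx_normrE; exact: (le_bigmax _ (fun ij => `|A ij.1 ij.2|) (i, j)).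
Qed.

Lemma mulmx_tr_norm n m (lam : 'rV[R]_m) (A : 'M[R]_(n, m)) :
  `|lam *m A^T| <= m%:R * (`|lam| * `|A|).
Proof.
apply: norm_rV_le => [|i]; first by rewrite !mulr_ge0.
rewrite mxE; apply: (le_trans (ler_norm_sum _ _ _)).
apply: (@le_trans _ _ (\sum_(j < m) `|lam| * `|A|)).
  apply: ler_sum => j _; rewrite normrM mxE.
  by apply: ler_pM => //; [exact: coord_le_norm|exact: mx_entry_le_norm].
by rewrite sumr_const card_ord -[leLHS]mulr_natl.
Qed.

Lemma residual_diff n m p (a a' gam : 'rV[R]_n) (lam : 'rV[R]_m) (mu : 'rV[R]_p)
    (A A' : 'M[R]_(n, m)) (C C' : 'M[R]_(n, p)) :
  a' + lam *m A'^T + mu *m C'^T + gam = a + lam *m A^T + mu *m C^T + gam -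
    ((a - a') + lam *m (A - A')^T + mu *m (C - C')^T).
Proof.
rewrite ![(_ - _)^T]raddfB !mulmxBr.
move: (lam *m A^T) (lam *m A'^T) (mu *m C^T) (mu *m C'^T) => b b' c c'.
by apply/rowP => i; rewrite !mxE; ring.
Qed.

Lemma continuous_near (U V : normedModType R) (u : U -> V) x0 (e : R) :
  {for x0, continuous u} -> 0 < e ->
  exists2 d, 0 < d & forall x, `|x - x0| < d -> `|u x - u x0| <= e.
Proof.
move=> /cvgrPdist_le cu e0; have /nbhs_ballP[d d0 hd] := cu e e0.
exists d => // x xd; rewrite distrC; apply: hd.
by rewrite -ball_normE /= distrC.
Qed.

Variables (n m p : nat) (f : 'rV[R]_n -> R) (g : 'rV[R]_n -> 'rV[R]_m)
  (h : 'rV[R]_n -> 'rV[R]_p).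
Hypotheses (hf : C1_scalar f) (hg : C1_vector g) (hh : C1_vector h).
Variables (xs : 'rV[R]_n) (B : R).

Definition multiplier_pattern (lam : 'rV[R]_m) (gam : 'rV[R]_n) :=
  [/\ vnonneg lam, forall i, g xs 0 i <> 0 -> lam 0 i = 0 &
      forall i, xs 0 i <> 0 -> gam 0 i = 0].

Definition residual x (lam : 'rV[R]_m) (mu : 'rV[R]_p) (gam : 'rV[R]_n) :=
  grad f x + grad_comb g x lam + grad_comb h x mu + gam.

(** The sign conditions of [Theta], with the fixed threshold [B] in place of [beta * pi] and strict
    positivity in place of the bound [alpha]. *)
Definition sign_pattern x (lam : 'rV[R]_m) (mu : 'rV[R]_p) (gam : 'rV[R]_n) :=
  [/\ forall i, B < lam 0 i -> 0 < lam 0 i * g x 0 i,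
      forall j, B < `|mu 0 j| -> 0 < mu 0 j * h x 0 j &
      forall i, B < `|gam 0 i| -> 0 < gam 0 i * x 0 i].

Definition approx_KKT eps x lam mu gam :=
  [/\ `|x - xs| < eps, `|residual x lam mu gam| <= eps,
      multiplier_pattern lam gam & sign_pattern x lam mu gam].

Lemma residual_near M eta : 0 < eta -> exists2 d, 0 < d &
  forall x lam mu gam, `|x - xs| < d -> mult_size lam mu gam <= M ->
  `|residual xs lam mu gam| <= `|residual x lam mu gam| + eta.
Proof.
move=> eta0.
(* With all multipliers at most [M], a change of size at most [e] in each of the three derivatives
   alters the residual by at most [e * K]. *)
pose K := 1 + (m%:R + p%:R) * `|M|.
have K0 : 0 < K by rewrite ltr_wpDr // mulr_ge0 // addr_ge0.
pose e := eta / K; have e0 : 0 < e by rewrite divr_gt0.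
have [d1 d10 h1] := continuous_near (hf.2 xs) e0.
have [d2 d20 h2] := continuous_near (hg.2 xs) e0.
have [d3 d30 h3] := continuous_near (hh.2 xs) e0.
exists (Num.min d1 (Num.min d2 d3)); first by rewrite !lt_min d10 d20.
move=> x lam mu gam; rewrite !lt_min => /and3P[/h1 r1 /h2 r2 /h3 r3].
rewrite /mult_size !ge_max => /and4P[M1 Ml Mm _].
have MM : `|M| = M by rewrite ger0_norm // (le_trans ler01).
have -> : residual xs lam mu gam = residual x lam mu gam -
   ((grad f x - grad f xs) + lam *m ('J g x - 'J g xs)^T + mu *m ('J h x - 'J h xs)^T).
  exact: residual_diff.
apply: (le_trans (ler_normB _ _)); rewrite lerD2l.
apply: (le_trans (ler_normD _ _)).
apply: (@le_trans _ _ (e + m%:R * (M * e) + p%:R * (M * e))).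
  apply: lerD.
    apply: (le_trans (ler_normD _ _)); apply: lerD => //.
    apply: (le_trans (mulmx_tr_norm _ _)).
    by rewrite ler_wpM2l // ler_pM.
  apply: (le_trans (mulmx_tr_norm _ _)).
  by rewrite ler_wpM2l // ler_pM.
rewrite (_ : _ + _ = e * K); last by rewrite /K MM; ring.
by rewrite /e divfK // gt_eqF.
Qed.

(** Instead of extracting a convergent subsequence, the norm of the residual at [xs] is minimised
    over a compact box of admissible multipliers; by [residual_near] the minimum is below every
    positive number. *)
Lemma KKT_of_bounded M :
  (forall eps, 0 < eps -> exists x lam mu gam,
     approx_KKT eps x lam mu gam /\ mult_size lam mu gam <= M) ->
  exists lam mu gam, multiplier_pattern lam gam /\ residual xs lam mu gam = 0.
Proof.
move=> H.
have M1 : 1 <= M.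
  by have [x [l [mu [ga [_]]]]] := H 1 ltr01; rewrite /mult_size ge_max => /andP[].
have M0 : 0 <= M by exact: le_trans M1.
pose lamof (v : 'rV[R]_(m + (p + n))) := lsubmx v.
pose muof (v : 'rV[R]_(m + (p + n))) := lsubmx (rsubmx v).
pose gamof (v : 'rV[R]_(m + (p + n))) := rsubmx (rsubmx v).
(* The required zeros and signs are encoded by intervals, so that the admissible set is a product of
   compact intervals; a coordinate that must vanish gets [[0, 0]]. *)
pose I (k : 'I_(m + (p + n))) : set R :=
  match fintype.split k with
  | inl i => if g xs 0 i == 0 then `[0, M]%classic else `[0, 0]%classic
  | inr k => match fintype.split k with
    | inl j => `[-M, M]%classic
    | inr i => if xs 0 i == 0 then `[-M, M]%classic else `[0, 0]%classic
    end
  end.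
have cI k : compact (I k).
  rewrite /I; case: fintype.split => [i|k']; last case: fintype.split => [j|i].
  - by case: ifP => _; exact: segment_compact.
  - exact: segment_compact.
  - by case: ifP => _; exact: segment_compact.
pose A := [set v : 'rV[R]_(m + (p + n)) | forall k, I k (v ord0 k)].
have cA : compact A by exact: rV_compact.
have inA lam mu gam : multiplier_pattern lam gam -> mult_size lam mu gam <= M ->
    A (row_mx lam (row_mx mu gam)).
  move=> [l0 li gi]; rewrite /mult_size !ge_max => /and4P[_ Ml Mm Mg] k; rewrite /I.
  have bnd q (v : 'rV[R]_q) i : `|v| <= M -> - M <= v 0 i <= M.
    by move=> vM; rewrite -ler_norml (le_trans (coord_le_norm _ _)).
  rewrite -[k in row_mx _ _ _ k]fintype.splitK.
  case: fintype.split => [i|k'] /=.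
    rewrite row_mxEl; case: eqP => gi0; rewrite /= in_itv /=.
      by rewrite l0 /=; have /andP[] := bnd _ _ i Ml.
    by rewrite li // lexx.
  rewrite row_mxEr -[k' in row_mx _ _ _ k']fintype.splitK.
  case: fintype.split => [j|i] /=.
    by rewrite row_mxEl in_itv /=; exact: bnd.
  rewrite row_mxEr; case: eqP => xi0; rewrite /= in_itv /=; first exact: bnd.
  by rewrite gi // lexx.
have outA v : A v -> multiplier_pattern (lamof v) (gamof v).
  move=> Av; split=> i.
  - have := Av (lshift _ i); rewrite /I (fintype.unsplitK (inl i)) mxE.
    by case: ifP => _; rewrite /= in_itv /= => /andP[].
  - move=> gi; have := Av (lshift _ i); rewrite /I (fintype.unsplitK (inl i)) mxE.
    by case: eqP => // _; rewrite /= in_itv /= => /le_anti.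
  - move=> xi; have := Av (rshift _ (rshift _ i)).
    rewrite /I (fintype.unsplitK (inr _)) (fintype.unsplitK (inr _)) !mxE.
    by case: eqP => // _; rewrite /= in_itv /= => /le_anti.
pose Phi v := `|residual xs (lamof v) (muof v) (gamof v)|.
have cPhi : continuous Phi.
  have cl : continuous lamof by exact: continuous_lsubmx.
  have cr : continuous (@rsubmx R 1 m (p + n)) by exact: continuous_rsubmx.
  have cm : continuous muof.
    move=> v; apply: (@continuous_comp _ _ _ (@rsubmx R 1 m (p + n)) (@lsubmx R 1 p n)).
      exact: cr.
    exact: continuous_lsubmx.
  have cg : continuous gamof.
    move=> v; apply: (@continuous_comp _ _ _ (@rsubmx R 1 m (p + n)) (@rsubmx R 1 p n)).
      exact: cr.
    exact: continuous_rsubmx.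
  have cc : continuous (fun _ : 'rV[R]_(m + (p + n)) => xs) by move=> v; apply: (@cst_continuous _ _ xs).
  have cres : continuous (fun v => residual xs (lamof v) (muof v) (gamof v)).
    apply: continuous_rV => i; apply: (@eq_continuous R _ _ (fun v =>
      grad f xs 0 i + grad_comb g xs (lamof v) 0 i + grad_comb h xs (muof v) 0 i + gamof v 0 i)).
      move=> v; rewrite /residual [LHS]mxE; congr (_ + _).
      by rewrite [LHS]mxE; congr (_ + _); rewrite [LHS]mxE.
    apply: continuous_add; last exact: continuous_coord.
    apply: continuous_add.
      apply: continuous_add; first exact: continuous_cst.
      by apply: continuous_grad_comb => // j; exact: continuous_coord.
    by apply: continuous_grad_comb => // j; exact: continuous_coord.
  by move=> v; apply: (@cvg_norm _ _ _ (nbhs v)); exact: cres.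
have A0 : A !=set0.
  have [x [lam [mu [gam [[_ _ pat _] sz]]]]] := H 1 ltr01.
  by exists (row_mx lam (row_mx mu gam)); exact: inA.
have [v vA vmin] := EVT_min_rV A0 cA (continuous_subspaceT cPhi).
rewrite inE in vA.
exists (lamof v), (muof v), (gamof v); split; first exact: outA.
apply/eqP; rewrite -normr_le0; apply/ler_addgt0Pl => eta eta0; rewrite addr0.
have eta2 : 0 < eta / 2 by rewrite divr_gt0.
have [d d0 hd] := residual_near M eta2.
have [x [lam [mu [gam [[xd res pat _] sz]]]]] := H (Num.min d (eta / 2)) ltac:(by rewrite lt_min d0).
have vle : Phi v <= `|residual xs lam mu gam|.
  have := vmin (row_mx lam (row_mx mu gam)).
  rewrite inE /Phi /lamof /muof /gamof !row_mxKl !row_mxKr !row_mxKl; apply.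
  exact: inA.
apply: (le_trans vle).
have d1 : Num.min d (eta / 2) <= d by rewrite ge_min lexx.
have d2 : Num.min d (eta / 2) <= eta / 2 by rewrite ge_min lexx orbT.
apply: (le_trans (hd x lam mu gam (lt_le_trans xd d1) sz)).
apply: (@le_trans _ _ (eta / 2 + eta / 2)); last by rewrite -splitr.
by apply: lerD => //; exact: le_trans res d2.
Qed.

(** The elements of [Theta] are residuals minus [grad f], so they converge to [- grad f xs] however
    large the multipliers become; the growth of the multipliers lets [beta] tend to zero. *)
Lemma limsup_of_unbounded : 0 <= B ->
  (forall eps M, 0 < eps -> exists x lam mu gam,
     approx_KKT eps x lam mu gam /\ M < mult_size lam mu gam) ->
  limsup_Theta g h xs (- grad f xs).
Proof.
move=> B0 H.
have e0 (k : nat) : 0 < k.+1%:R^-1 :> R by rewrite invr_gt0.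
have step (k : nat) : exists t : 'rV[R]_n * R * R * 'rV[R]_n,
    let: (x, alpha, beta, w) := t in
    [/\ `|x - xs| < k.+1%:R^-1, 0 < alpha <= k.+1%:R^-1, 0 < beta <= k.+1%:R^-1,
      Theta g h xs x alpha beta w & `|w + grad f x| <= k.+1%:R^-1].
  (* The size requirement [(B + 1) * k.+1] will give [beta <= k.+1%:R^-1]. *)
  have [x [lam [mu [gam [[xe res [l0 li gi] [s1 s2 s3]] sz]]]]] :=
    H (k.+1%:R^-1) ((B + 1) * k.+1%:R) (e0 k).
  set pi := mult_size lam mu gam in sz *.
  have pi0 : 0 < pi.
    by apply: le_lt_trans sz; rewrite mulr_ge0 // addr_ge0.
  (* [beta * pi] is the constant [B + 1], so that only multipliers exceeding [B]
     have to satisfy a sign condition. *)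
  pose beta := (B + 1) / pi.
  have bpi : beta * pi = B + 1 by rewrite divfK // gt_eqF.
  have choose (J : finType) (c v : J -> R) (e : R) : 0 < e ->
      (forall j, B < c j -> 0 < v j) ->
      exists2 d, 0 < d <= e & forall j, beta * pi < c j -> d <= v j.
    move=> ee hc; apply: (fin_pos_choice (Q := fun j d => beta * pi < c j -> d <= v j)) => // j.
    case: (ltrP B (c j)) => Bc.
      have vj := hc j Bc; exists (Num.min e (v j)).
        by rewrite lt_min ee vj ge_min lexx.
      by move=> d' /andP[_]; rewrite le_min => /andP[].
    exists e; first by rewrite ee lexx.
    by move=> d' _; rewrite bpi => h'; move: (lt_le_trans h' Bc); rewrite ltNge lerDl ler01.
  (* Each threshold is at most the preceding one, so [a3] serves all three families and is the
     required [alpha]. *)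
  have [a1 /andP[a10 a1e] h1] := choose _ (fun i => lam 0 i) _ _ (e0 k) s1.
  have [a2 /andP[a20 a21] h2] := choose _ (fun i => `|mu 0 i|) _ _ a10 s2.
  have [a3 /andP[a30 a32] h3] := choose _ (fun i => `|gam 0 i|) _ _ a20 s3.
  exists (x, a3, beta, grad_comb g x lam + grad_comb h x mu + gam); split=> //.
  - by rewrite a30 (le_trans a32) // (le_trans a21).
  - rewrite divr_gt0 ?ltr_wpDl //= ler_pdivrMr // ler_pdivlMl //.
    by rewrite mulrC ltW.
  - exists lam, mu, gam; split=> //; split=> i hi.
    + by apply: le_trans (h1 i hi); rewrite (le_trans a32).
    + by apply: le_trans (h2 i hi).
    + exact: h3.
  - rewrite (_ : _ + _ = residual x lam mu gam) //.
    by rewrite addrC !addrA.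
have [t ht] := choice step.
exists (fun k => (t k).1.1.1), (fun k => (t k).1.1.2), (fun k => (t k).1.2), (fun k => (t k).2).
have {}ht k : [/\ `|(t k).1.1.1 - xs| < k.+1%:R^-1, 0 < (t k).1.1.2 <= k.+1%:R^-1,
    0 < (t k).1.2 <= k.+1%:R^-1,
    Theta g h xs (t k).1.1.1 (t k).1.1.2 (t k).1.2 (t k).2 &
    `|(t k).2 + grad f (t k).1.1.1| <= k.+1%:R^-1].
  by have := ht k; case: (t k) => [[[x a] b] w].
have inv0 (e : R) : 0 < e -> \forall k \near \oo, k.+1%:R^-1 <= e.
  move=> ee; have /cvgrPdist_le/(_ _ ee) := @cvg_harmonic R.
  by apply: filterS => k; rewrite sub0r normrN /harmonic /= ger0_norm ?invr_ge0.
have cx : (fun k => (t k).1.1.1) @ \oo --> xs.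
  apply/cvgrPdist_le => e ee; apply: filterS (inv0 e ee) => k; apply: le_trans.
  by rewrite distrC ltW //; have [] := ht k.
have cpos (a : nat -> R) : (forall k, 0 < a k <= k.+1%:R^-1) -> a @ \oo --> 0.
  move=> ha; apply/cvgrPdist_le => e ee; apply: filterS (inv0 e ee) => k; apply: le_trans.
  by rewrite sub0r normrN; have /andP[a0 ae] := ha k; rewrite gtr0_norm.
split=> //.
- by split=> [k|]; [have [_ /andP[]] := ht k|apply: cpos => k; have [] := ht k].
- by split=> [k|]; [have [_ _ /andP[]] := ht k|apply: cpos => k; have [] := ht k].
- by move=> k; have [] := ht k.
- have cgf : grad f (t k).1.1.1 @[k --> \oo] --> grad f xs.
    exact: (continuous_cvg _ (hf.2 xs) cx).
  apply/cvgrPdist_le => e ee.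
  have e2 : 0 < e / 2 by rewrite divr_gt0.
  move: cgf => /cvgrPdist_le/(_ _ e2) cgf.
  near=> k.
  have k1 : `|grad f xs - grad f (t k).1.1.1| <= e / 2 by near: k; exact: cgf.
  have k2 : k.+1%:R^-1 <= e / 2 by near: k; exact: inv0.
  have [_ _ _ _ k3] := ht k.
  rewrite (_ : _ - _ = - (grad f xs - grad f (t k).1.1.1) - ((t k).2 + grad f (t k).1.1.1)); last first.
    move: (grad f xs) (grad f _) (t k).2 => a b w.
    by apply/rowP => i; rewrite !mxE; ring.
  apply: (le_trans (ler_normB _ _)); rewrite normrN.
  by rewrite [leRHS]splitr lerD // (le_trans k3).
Unshelve. all: by end_near. Qed.

(** Either one bound [M] is met by approximations of every accuracy, or approximations of every
    accuracy have arbitrarily large multipliers; the regularity condition handles the second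
    case. *)
Lemma KKT_of_approx_KKT : 0 <= B -> CC_PAM_regular g h xs ->
  (forall eps, 0 < eps -> exists x lam mu gam, approx_KKT eps x lam mu gam) ->
  exists lam mu gam, multiplier_pattern lam gam /\ residual xs lam mu gam = 0.
Proof.
move=> B0 reg H.
case: (pselect (exists M, forall eps, 0 < eps -> exists x lam mu gam,
     approx_KKT eps x lam mu gam /\ mult_size lam mu gam <= M)) => [[M]|nb].
  exact: KKT_of_bounded.
have /reg[lam [mu [gam [E l0 li gi _]]]] : limsup_Theta g h xs (- grad f xs).
  (* If all approximations of accuracy [eps] had size at most [M], then so would the finer ones, of
     accuracy [Num.min eps eps'], and [M] would be a common bound. *)
  apply: limsup_of_unbounded => // eps M eps0; apply: contrapT => N; apply: nb.
  exists M => eps' eps'0.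
  have [x [lam [mu [gam [xe res pat sgn]]]]] := H (Num.min eps eps') ltac:(by rewrite lt_min eps0).
  have d1 : Num.min eps eps' <= eps by rewrite ge_min lexx.
  have d2 : Num.min eps eps' <= eps' by rewrite ge_min lexx orbT.
  exists x, lam, mu, gam; split.
    by split=> //; [exact: lt_le_trans xe d2|exact: le_trans res d2].
  rewrite leNgt; apply/negP => sz; apply: N; exists x, lam, mu, gam.
  by split=> //; split=> //; [exact: lt_le_trans xe d1|exact: le_trans res d1].
exists lam, mu, gam; split; first by split.
by rewrite /residual -addrA -addrA [X in _ + X]addrA -E subrr.
Qed.

End ApproximateKKT.

(** * The augmented Lagrangian method *)

Section Algorithm.
Context {R : realType}.

Lemma coord_le_enorm n (v : 'rV[R]_n) i : `|v 0 i| <= enorm v.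
Proof.
rewrite -sqrtr_sqr ler_wsqrtr // (bigD1 i) //= lerDl.
by apply: sumr_ge0 => j _; exact: sqr_ge0.
Qed.

Lemma enorm_ge0 n (v : 'rV[R]_n) : 0 <= enorm v.
Proof. exact: sqrtr_ge0. Qed.

(** With [s = r * a + b], the product of [s] and [r * a] is [s ^+ 2 - s * b], positive as soon as
    [|b| < |s|]: an update exceeding the safeguard bound has the sign of the constraint. *)
Lemma shifted_sign (r a b B : R) : 0 < r -> `|b| <= B -> B < `|r * a + b| ->
  0 < (r * a + b) * a.
Proof.
move=> r0 bB Bab.
have ra : `|b| < `|r * a + b| by exact: le_lt_trans Bab.
have : 0 < (r * a + b) * (r * a).
  move: ra; rewrite -(ltr_pXn2r (n := 2)) ?nnegrE // !real_normK ?num_real //.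
  by move: (r * a) => c; nra.
by rewrite mulrCA pmulr_rgt0.
Qed.

Lemma max0_dist (a b : R) : `|Num.max 0 a - Num.max 0 b| <= `|a - b|.
Proof.
rewrite ler_norml.
have h1 := ler_norm (a - b); have h2 := ler_norm (- (a - b)); rewrite normrN in h2.
by case: (leP 0 a) => ?; case: (leP 0 b) => ?; apply/andP; split; lra.
Qed.

Lemma archimedean_linear (a b M : R) : 0 < b -> exists j : nat, M <= a + j%:R * b.
Proof.
move=> b0; exists (Num.truncn ((M - a) / b)).+1.
rewrite -lerBlDl -ler_pdivrMr //; exact/ltW/truncnS_gt.
Qed.

Variables (n m p : nat)
  (f : 'rV[R]_n -> R) (g : 'rV[R]_n -> 'rV[R]_m) (h : 'rV[R]_n -> 'rV[R]_p)
  (kappa : int).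
Hypotheses (hf : C1_scalar f) (hg : C1_vector g) (hh : C1_vector h)
  (sg : semialgebraic_map g) (sh : semialgebraic_map h).
Variables (P : salm_params R) (S : salm_run R n m p)
  (hS : salm_generated f g h kappa P S) (xs ys : 'rV[R]_n)
  (hacc : cluster ((fun k => (s_x S k, s_y S k)) @ \oo) (xs, ys))
  (hfeas : relax_feasible g h kappa xs ys).

(* [X k], [Y k] are the iterates of index [k+1]: they are computed with the
   safeguarded multipliers and the penalty parameter of index [k]. *)
Let X k := s_x S k.+1.
Let Y k := s_y S k.+1.
Let L := s_safe S.
Let rho := s_rho S.
Let U k := mult_update g h kappa (X k) (Y k) (L k) (rho k).
Let progress := salm_progress g h kappa S.
Let hP := salm_params_valid hS.

(** * Growth of the penalty parameter and decay of the progress measure *)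

Lemma rho_gt0 k : 0 < rho k.
Proof.
elim: k => [|k ih]; first exact: salm_rho0 hS.
rewrite /rho (salm_penalty hS); case: ifP => // _.
by rewrite mulr_gt0 //; apply: lt_trans (sigma_gt1 hP).
Qed.

Lemma progress_ge0 k : 0 <= progress k.
Proof. by rewrite /progress /salm_progress /progress_measure le_max enorm_ge0. Qed.

(** The penalty never decreases and grows by at least [(sigma P - 1) * rho 0] at every increase, so
    infinitely many increases make it unbounded. Otherwise it is eventually constant, which means
    that the progress test keeps succeeding. *)
Lemma rho_dichotomy :
  (forall M, exists N, forall k, (N <= k)%N -> M <= rho k) \/
  (exists N, forall k, (N <= k)%N ->
     rho k = rho N /\ tau P * progress k.+1 <= progress k).
Proof.
have s1 := sigma_gt1 hP; have s0 : 0 < sigma P by exact: lt_trans s1.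
have step k : rho k.+1 = rho k \/ rho k.+1 = sigma P * rho k.
  by rewrite /rho (salm_penalty hS); case: ifP => _; [left|right].
have le1 k : rho k <= rho k.+1.
  by case: (step k) => ->//; rewrite ler_peMl // ?ltW // rho_gt0.
have mono : {homo rho : a b / (a <= b)%N >-> a <= b} by exact/nondecreasing_seqP.
case: (pselect (exists N, forall k, (N <= k)%N -> rho k.+1 = rho k)) => [[N hN]|nN].
  (* Starting at [N.+1] avoids [k = 0], where the penalty is kept without any test. *)
  right; exists N.+1 => k Nk; split.
    rewrite -(subnKC Nk); elim: (k - N.+1)%N => [|j ih]; first by rewrite addn0.
    by rewrite addnS hN ?ih // addSn leqW // leq_addr.
  have := salm_penalty hS k; rewrite -/(rho k.+1) -/(rho k) hN ?(ltnW Nk) //.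
  case: ifP => [/orP[/eqP[k0]|//]|_ E]; first by rewrite k0 in Nk.
  by move: (rho_gt0 k); rewrite -(ltr_pMl _ (rho_gt0 k)) in s1; rewrite -E ltxx in s1.
left => M.
have hj (j : nat) : exists N, rho 0%N + j%:R * ((sigma P - 1) * rho 0%N) <= rho N.
  elim: j => [|j [N hN]]; first by exists 0%N; rewrite mul0r addr0.
  have [k Nk rk] : exists2 k, (N <= k)%N & rho k.+1 <> rho k.
    apply: contrapT => H; apply: nN; exists N => k Nk; apply: contrapT => H2.
    by apply: H; exists k.
  exists k.+1; case: (step k) => [//|->].
  have r1 : rho 0%N <= rho k by exact: mono.
  have r2 : rho N <= rho k by exact: mono.
  have r3 : (sigma P - 1) * rho 0%N <= (sigma P - 1) * rho k.
    by rewrite ler_pM2l // subr_gt0.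
  rewrite -natr1 mulrDl mul1r.
  by move: hN r2 r3; rewrite mulrBl; lra.
have [j Mj] := archimedean_linear (rho 0%N) M
  (mulr_gt0 (eqbRL (subr_gt0 _ _) s1) (rho_gt0 0)).
have [N hN] := hj j; exists N => k Nk.
by apply: (le_trans Mj); apply: (le_trans hN); exact: mono.
Qed.

(** The decay is geometric; Bernoulli's inequality replaces [tau P ^+ j] by [1 + j (tau P - 1)],
    which already tends to infinity. *)
Lemma progress_vanishes N :
  (forall k, (N <= k)%N -> tau P * progress k.+1 <= progress k) ->
  forall e, 0 < e -> exists N', forall k, (N' <= k)%N -> progress k <= e.
Proof.
move=> hN e e0; have t1 := tau_gt1 hP.
have hj (j : nat) : progress (N + j)%N * (1 + j%:R * (tau P - 1)) <= progress N.
  elim: j => [|j ih]; first by rewrite addn0 mul0r addr0 mulr1.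
  apply: le_trans ih; rewrite addnS.
  have h1 := hN (N + j)%N (leq_addr _ _).
  have h0 := progress_ge0 (N + j).+1.
  have hj0 : 0 <= j%:R :> R by [].
  have : progress (N + j).+1 * (1 + j.+1%:R * (tau P - 1)) <=
      progress (N + j).+1 * (tau P * (1 + j%:R * (tau P - 1))).
    rewrite ler_wpM2l // -natr1 -subr_ge0.
    rewrite (_ : _ - _ = j%:R * (tau P - 1) ^+ 2); last by ring.
    by rewrite mulr_ge0 // sqr_ge0.
  move=> /le_trans; apply; rewrite mulrA [_ * tau P]mulrC ler_wpM2r //.
  by rewrite addr_ge0 // mulr_ge0 // subr_ge0 ltW.
have [j0 hj0] := archimedean_linear 1 (progress N / e) (eqbRL (subr_gt0 _ _) t1).
exists (N + j0)%N => k Nk.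
have Nk' : (N <= k)%N by exact: leq_trans (leq_addr _ _) Nk.
have := hj (k - N)%N; rewrite subnKC // => h1.
have jk : j0%:R <= (k - N)%:R :> R by rewrite ler_nat leq_subRL.
have h2 : progress N / e <= 1 + (k - N)%:R * (tau P - 1).
  by apply: (le_trans hj0); rewrite lerD2l ler_wpM2r // subr_ge0 ltW.
have h3 : 0 < 1 + (k - N)%:R * (tau P - 1).
  by rewrite ltr_pwDl // mulr_ge0 // subr_ge0 ltW.
rewrite -(ler_pM2r h3); apply: (le_trans h1).
by rewrite mulrC -ler_pdivrMr.
Qed.

(** This filter stands for a subsequence converging to [(xs, ys)]: its sets contain all late indices
    whose iterates are close enough to the limit, and finitely many asymptotic conditions can be
    intersected. *)
Definition acc_filter : set_system nat := [set Q | exists d, 0 < d /\ exists N,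
  forall k, (N <= k)%N -> `|X k - xs| < d -> `|Y k - ys| < d -> Q k].

Instance acc_filter_filter : Filter acc_filter.
Proof.
split.
- by exists 1; split=> //; exists 0%N.
- move=> A B' [d1 [d10 [N1 h1]]] [d2 [d20 [N2 h2]]].
  exists (Num.min d1 d2); split; first by rewrite lt_min d10.
  exists (maxn N1 N2) => k; rewrite geq_max !lt_min => /andP[k1 k2] /andP[x1 x2] /andP[y1 y2].
  by split; [exact: h1|exact: h2].
- move=> A B' AB [d [d0 [N hN]]]; exists d; split=> //; exists N => k Nk xd yd.
  by apply: AB; exact: hN.
Qed.

(** The filter is proper because [(xs, ys)] is a cluster point. The strict inequality [N < k] in the
    proof absorbs the index shift of [X] and [Y]. *)
Lemma acc_filter_ex Q : acc_filter Q -> exists k, Q k.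
Proof.
move=> [d [d0 [N hN]]].
pose W := [set xy : 'rV[R]_n * 'rV[R]_n | `|xy.1 - xs| < d /\ `|xy.2 - ys| < d].
have nW : nbhs (xs, ys) W.
  exists ([set x | `|x - xs| < d], [set y | `|y - ys| < d]) => //=.
  by split; apply/nbhs_ballP; exists d => //= z; rewrite -ball_normE /= distrC.
have tail : ((fun k => (s_x S k, s_y S k)) @ \oo)
    [set xy | exists2 k, (N < k)%N & xy = (s_x S k, s_y S k)].
  by exists N.+1 => // k /= Nk; exists k.
have [xy [[k Nk ->] [/= xd yd]]] := hacc tail nW.
by case: k Nk xd yd => // k Nk xd yd; exists k; exact: hN.
Qed.

Lemma acc_X e : 0 < e -> \forall k \near acc_filter, `|X k - xs| < e.
Proof. by move=> e0; exists e; split=> //; exists 0%N. Qed.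

Lemma acc_Y e : 0 < e -> \forall k \near acc_filter, `|Y k - ys| < e.
Proof. by move=> e0; exists e; split=> //; exists 0%N. Qed.

Lemma acc_tail N : \forall k \near acc_filter, (N <= k)%N.
Proof. by exists 1; split=> //; exists N. Qed.

Lemma acc_eps e : 0 < e -> \forall k \near acc_filter, eps P k.+1 <= e.
Proof.
move=> e0; have := eps_cvg0 hP => /cvgrPdist_le/(_ _ e0)[N _ hN].
exists 1; split=> //; exists N => k Nk _ _.
have := hN k.+1 (leqW Nk); rewrite sub0r normrN => /(le_trans _); apply.
exact: ler_norm.
Qed.

Definition safe_bound := `|lam_max P| + `|mu_min P| + `|mu_max P| + `|gam_min P| +
  `|gam_max P| + `|del_max P| + `|eta_max P|.

Let B := safe_bound.

Lemma safe_boundP k : [/\ forall i, 0 <= m_lam (L k) 0 i <= B,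
  forall i, `|m_mu (L k) 0 i| <= B, forall i, `|m_gam (L k) 0 i| <= B,
  0 <= m_del (L k) <= B & forall i, 0 <= m_eta (L k) 0 i <= B].
Proof.
have [h1 h2 h3 h4 h5] := salm_safe hS k.
have p1 := normr_ge0 (lam_max P); have p2 := normr_ge0 (mu_min P).
have p3 := normr_ge0 (mu_max P); have p4 := normr_ge0 (gam_min P).
have p5 := normr_ge0 (gam_max P); have p6 := normr_ge0 (del_max P).
have p7 := normr_ge0 (eta_max P).
have q1 := ler_norm (lam_max P); have q2 := ler_norm (- mu_min P).
have q3 := ler_norm (mu_max P); have q4 := ler_norm (- gam_min P).
have q5 := ler_norm (gam_max P); have q6 := ler_norm (del_max P).
have q7 := ler_norm (eta_max P); rewrite !normrN in q2 q4.
rewrite /B /safe_bound; split=> [i|i|i||i].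
- by have := h1 i; rewrite -/L; lra.
- by have := h2 i; rewrite -/L ler_norml; lra.
- by have := h3 i; rewrite -/L ler_norml; lra.
- by move: h4; rewrite -/L; lra.
- by have := h5 i; rewrite -/L; lra.
Qed.

Lemma B_ge0 : 0 <= B.
Proof. by rewrite /B /safe_bound !addr_ge0. Qed.

(** Near [xs] the constraint is at most [- c]. If [rho] is unbounded, [rho * g] outweighs the
    safeguard; if [rho] is eventually constant, the progress measure tends to zero, which forces the
    safeguard divided by [rho] below [c / 2]. In both cases the positive part vanishes. *)
Lemma inactive_multiplier i : g xs 0 i <> 0 ->
  \forall k \near acc_filter, m_lam (U k) 0 i = 0.
Proof.
have [gle _ _ _ _] := hfeas.
move=> gi; have gneg : g xs 0 i < 0 by rewrite lt_neqAle gle andbT; exact/eqP.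
pose c := - g xs 0 i / 2; have c0 : 0 < c by rewrite divr_gt0 // oppr_gt0.
have cg : {for xs, continuous g} by apply: differentiable_continuous; exact: hg.1.
have [d d0 hd] := continuous_near cg c0.
have gX : \forall k \near acc_filter, g (X k) 0 i <= - c.
  apply: filterS (acc_X d0) => k /hd hk.
  have := le_trans (coord_le_norm _ i) hk; rewrite !mxE ler_norml /c; lra.
have B0 := B_ge0.
case: rho_dichotomy => [unb|[N hN]].
  have [N hN] := unb (B / c).
  apply: filterS (filterI gX (acc_tail N)) => k [gk Nk].
  have [hl _ _ _ _] := safe_boundP k; have /andP[l0 lB] := hl i.
  rewrite !mxE; apply/eqP; rewrite eq_le le_max lexx /= andbT ge_max lexx /=.
  have : B <= rho k * c by rewrite -ler_pdivrMr // hN.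
  have : rho k * g (X k) 0 i <= rho k * - c by rewrite ler_pM2l // rho_gt0.
  by rewrite mulrN; lra.
have c2 : 0 < c / 2 by rewrite divr_gt0.
have [N' hN'] := progress_vanishes (fun k Nk => (hN k Nk).2) c2.
apply: filterS (filterI gX (acc_tail N')) => k [gk Nk].
have := hN' k.+1 (leqW Nk).
rewrite /progress /salm_progress /progress_measure ge_max => /andP[/(le_trans (coord_le_enorm _ i)) + _].
rewrite !mxE /= -/(X k) -/(L k) -/(rho k) => /(le_trans (ler_norm _)).
rewrite ge_min => /orP[h1|h1]; first lra.
have r0 := rho_gt0 k.
have h2 : m_lam (L k) 0 i <= rho k * (c / 2) by rewrite -ler_pdivrMl.
have h3 : rho k * g (X k) 0 i <= rho k * - c by rewrite ler_pM2l.
have h4 : 0 < rho k * c by rewrite mulr_gt0.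
apply/eqP; rewrite eq_le le_max lexx /= andbT ge_max lexx /=.
by move: h2 h3; rewrite mulrN mulrA; lra.
Qed.

(** Half the squared infeasibility, obtained as the augmented Lagrangian of the zero objective with
    zero multipliers and penalty 1, so that the same gradient formulas apply. *)
Let infeasibility z : R :=
  joint_lagrangian (fun=> 0) g h kappa (Multipliers 0 0 0 0 0) 1 z.

Lemma infeasibilityE z : infeasibility z = 2^-1 *
   (\sum_i Num.max 0 (g (lsubmx z) 0 i) ^+ 2 + \sum_j h (lsubmx z) 0 j ^+ 2 +
    \sum_i (lsubmx z 0 i * rsubmx z 0 i) ^+ 2 +
    Num.max 0 (card_res kappa (rsubmx z)) ^+ 2 +
    \sum_i Num.max 0 (rsubmx z 0 i - 1) ^+ 2).
Proof.
rewrite /infeasibility joint_lagrangianE /= add0r mul1r mul0r addr0.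
congr (_ * (_ + _ + _ + _ + _)); apply: eq_bigr => i _;
  by rewrite (_ : 1^-1 * _ = 0) ?addr0 // mxE mulr0.
Qed.

Lemma infeasibility_eq0 : infeasibility (row_mx xs ys) = 0.
Proof.
have [g0 h0 xy0 c0 y1] := hfeas.
rewrite infeasibilityE row_mxKl row_mxKr h0 max_l // expr0n /= addr0.
rewrite !big1 ?addr0 ?mulr0 // => i _.
- by rewrite max_l ?expr0n // subr_le0.
- by have /rowP/(_ i) := xy0; rewrite !mxE => ->; rewrite expr0n.
- by rewrite mxE expr0n.
- by rewrite max_l ?expr0n.
Qed.

Lemma infeasibility_ge (x y : 'rV[R]_n) i :
  (x 0 i * y 0 i) ^+ 2 / 2 <= infeasibility (row_mx x y).
Proof.
rewrite infeasibilityE row_mxKl row_mxKr mulrC ler_pM2l ?invr_gt0 //.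
have s0 q (u : 'I_q -> R) : 0 <= \sum_i u i ^+ 2 by apply: sumr_ge0 => j _; exact: sqr_ge0.
rewrite -!addrA; apply: ler_wpDl; first exact: s0.
apply: ler_wpDl; first exact: s0.
rewrite (bigD1 i) //= -addrA lerDl addr_ge0 //; first by apply: sumr_ge0 => j _; exact: sqr_ge0.
by apply: addr_ge0; [exact: sqr_ge0|exact: s0].
Qed.

Lemma C1_zero : C1_scalar (fun _ : 'rV[R]_n => 0 : R).
Proof.
split=> [x|]; first exact: differentiable_cst.
have -> : grad (fun _ : 'rV[R]_n => 0 : R) = fun=> 0.
  by apply/funext => x; apply/rowP => i; rewrite !mxE derive_cst.
exact: cst_continuous.
Qed.

Lemma grad_zero x : grad (fun _ : 'rV[R]_n => 0 : R) x = 0.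
Proof. by apply/rowP => i; rewrite !mxE derive_cst. Qed.

Let U0 x y := mult_update g h kappa x y (Multipliers 0 0 0 0 0) 1.

(* The gradient of the penalised infeasibility differs from that of the
   augmented Lagrangian only through [f] and the bounded safeguarded multipliers. *)
Lemma scaled_lagr_x k : rho k *: lagr_x (fun=> 0) g h (X k) (Y k) (U0 (X k) (Y k)) =
  lagr_x f g h (X k) (Y k) (U k) - grad f (X k)
  + grad_comb g (X k) (rho k *: m_lam (U0 (X k) (Y k)) - m_lam (U k))
  + grad_comb h (X k) (rho k *: m_mu (U0 (X k) (Y k)) - m_mu (U k))
  + hadamard (rho k *: m_gam (U0 (X k) (Y k)) - m_gam (U k)) (Y k).
Proof.
rewrite /lagr_x grad_zero /grad_comb; move: (grad f (X k)) (U k) (U0 _ _) => a V V0.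
move: ('J g (X k)) ('J h (X k)) (rho k) (Y k) => A C r y.
rewrite !mulmxBl -!scalemxAl.
move: (m_lam V *m _) (m_lam V0 *m _) (m_mu V *m _) (m_mu V0 *m _) => b b0 c c0.
by apply/rowP => i; rewrite !mxE; ring.
Qed.

Lemma scaled_lagr_y k : rho k *: lagr_y (X k) (U0 (X k) (Y k)) =
  lagr_y (X k) (U k)
  + hadamard (rho k *: m_gam (U0 (X k) (Y k)) - m_gam (U k)) (X k)
  - const_mx (rho k * m_del (U0 (X k) (Y k)) - m_del (U k))
  + (rho k *: m_eta (U0 (X k) (Y k)) - m_eta (U k)).
Proof.
move: (U k) (U0 _ _) => V V0.
by rewrite /lagr_y; apply/rowP => i; rewrite !mxE; ring.
Qed.

(** The positive part is nonexpansive and commutes with the factor [rho k], so removing a safeguard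
    from an update changes it by at most that safeguard. *)
Lemma multiplier_diff k : [/\ `|rho k *: m_lam (U0 (X k) (Y k)) - m_lam (U k)| <= B,
  `|rho k *: m_mu (U0 (X k) (Y k)) - m_mu (U k)| <= B,
  `|rho k *: m_gam (U0 (X k) (Y k)) - m_gam (U k)| <= B,
  `|rho k * m_del (U0 (X k) (Y k)) - m_del (U k)| <= B &
  `|rho k *: m_eta (U0 (X k) (Y k)) - m_eta (U k)| <= B].
Proof.
have [hl hm hga hd he] := safe_boundP k; have B0 := B_ge0; have r0 := rho_gt0 k.
have max_diff (a b : R) : 0 <= b <= B ->
    `|rho k * Num.max 0 (1 * a + 0) - Num.max 0 (rho k * a + b)| <= B.
  move=> /andP[b0 bB].
  rewrite addr0 mul1r maxr_pMr ?(ltW r0) // mulr0.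
  apply: (le_trans (max0_dist _ _)).
  by rewrite opprD addrA subrr sub0r normrN ger0_norm.
have lin_diff (a b : R) : `|b| <= B -> `|rho k * (1 * a + 0) - (rho k * a + b)| <= B.
  by move=> bB; rewrite addr0 mul1r opprD addrA subrr sub0r normrN.
split.
- by apply: norm_rV_le => // i; rewrite !mxE; exact: max_diff.
- by apply: norm_rV_le => // i; rewrite !mxE; exact: lin_diff.
- by apply: norm_rV_le => // i; rewrite !mxE; exact: lin_diff.
- exact: max_diff.
- by apply: norm_rV_le => // i; rewrite !mxE; exact: max_diff.
Qed.

Lemma lagr_bounds k : `|lagr_x f g h (X k) (Y k) (U k)| <= eps P k.+1 /\
  `|lagr_y (X k) (U k)| <= eps P k.+1.
Proof.
have := salm_primal hS k; rewrite (grad_aug_lagrangianE kappa hf hg hh) ?rho_gt0 //.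
rewrite -/(X k) -/(Y k) -/(L k) -/(rho k) -/(U k) => hk.
have e0 := eps_ge0 hP k.+1.
split; apply: norm_rV_le => // i; apply: le_trans hk.
  by rewrite -(row_mxEl _ (lagr_y (X k) (U k))); exact: coord_le_enorm.
by rewrite -(row_mxEr (lagr_x f g h (X k) (Y k) (U k))); exact: coord_le_enorm.
Qed.

Lemma norm_hadamard q (a b : 'rV[R]_q) : `|hadamard a b| <= `|a| * `|b|.
Proof.
apply: norm_rV_le => [|i]; first by rewrite mulr_ge0.
by rewrite mxE normrM ler_pM // coord_le_norm.
Qed.

Lemma norm_const q (a : R) : `|const_mx a : 'rV[R]_q| <= `|a|.
Proof. by apply: norm_rV_le => // i; rewrite mxE. Qed.

Lemma norm_add_le (V : normedModType R) (x y : V) a b :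
  `|x| <= a -> `|y| <= b -> `|x + y| <= a + b.
Proof. by move=> xa yb; apply: (le_trans (ler_normD _ _)); exact: lerD. Qed.

Lemma norm_le_near (V W : normedModType R) (u : V -> W) (x x0 : V) e :
  `|u x - u x0| <= e -> `|u x| <= `|u x0| + e.
Proof.
by move=> h1; rewrite -[u x](subrK (u x0)) addrC; exact: norm_add_le.
Qed.

(** By [scaled_lagr_x] and [scaled_lagr_y] the scaled gradient is made of the gradient of the
    augmented Lagrangian, bounded by [eps], of [grad f], and of safeguard corrections, possibly
    multiplied by Jacobians or iterates; all are bounded near [(xs, ys)]. *)
Lemma scaled_gradient_bounded : exists2 M, 0 < M &
  \forall k \near acc_filter,
    rho k * `|grad infeasibility (row_mx (X k) (Y k))| <= M.
Proof.
have [d1 d10 h1] := continuous_near (hf.2 xs) ltr01.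
have [d2 d20 h2] := continuous_near (hg.2 xs) ltr01.
have [d3 d30 h3] := continuous_near (hh.2 xs) ltr01.
pose Fb := `|grad f xs| + 1; pose Gb := `|'J g xs| + 1; pose Hb := `|'J h xs| + 1.
pose Xb := `|xs| + 1; pose Yb := `|ys| + 1.
have B0 := B_ge0.
have Fb0 : 0 <= Fb by rewrite addr_ge0. have Gb0 : 0 <= Gb by rewrite addr_ge0.
have Hb0 : 0 <= Hb by rewrite addr_ge0. have Xb0 : 0 <= Xb by rewrite addr_ge0.
have Yb0 : 0 <= Yb by rewrite addr_ge0.
pose M1 := 1 + Fb + m%:R * (B * Gb) + p%:R * (B * Hb) + B * Yb.
pose M2 := 1 + B * Xb + B + B.
have M10 : 0 < M1.
  by rewrite /M1 -!addrA ltr_pwDl // !addr_ge0 // !mulr_ge0.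
have M20 : 0 <= M2 by rewrite /M2 !addr_ge0 // mulr_ge0.
exists (M1 + M2); first by rewrite ltr_pwDl.
near=> k.
have x1 : `|X k - xs| < 1 by near: k; exact: acc_X.
have y1 : `|Y k - ys| < 1 by near: k; exact: acc_Y.
have fk : `|grad f (X k)| <= Fb.
  by apply: norm_le_near; apply: h1; near: k; exact: acc_X.
have gk : `|'J g (X k)| <= Gb.
  by apply: norm_le_near; apply: h2; near: k; exact: acc_X.
have hk : `|'J h (X k)| <= Hb.
  by apply: norm_le_near; apply: h3; near: k; exact: acc_X.
have xk : `|X k| <= Xb by apply: (@norm_le_near _ _ id); exact: ltW.
have yk : `|Y k| <= Yb by apply: (@norm_le_near _ _ id); exact: ltW.
have ek : eps P k.+1 <= 1 by near: k; exact: acc_eps.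
have [lx ly] := lagr_bounds k.
have [ml mm mg md me] := multiplier_diff k.
have -> : grad infeasibility (row_mx (X k) (Y k)) =
    row_mx (lagr_x (fun=> 0) g h (X k) (Y k) (U0 (X k) (Y k))) (lagr_y (X k) (U0 (X k) (Y k))).
  have := grad_joint_lagrangian kappa C1_zero hg hh (Multipliers 0 0 0 0 0) (row_mx (X k) (Y k)) ltr01.
  by rewrite row_mxKl row_mxKr.
have r0 := rho_gt0 k.
rewrite -[rho k in leLHS](gtr0_norm r0) -normrZ scale_row_mx scaled_lagr_x scaled_lagr_y.
have bx : `|lagr_x f g h (X k) (Y k) (U k) - grad f (X k)
  + grad_comb g (X k) (rho k *: m_lam (U0 (X k) (Y k)) - m_lam (U k))
  + grad_comb h (X k) (rho k *: m_mu (U0 (X k) (Y k)) - m_mu (U k))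
  + hadamard (rho k *: m_gam (U0 (X k) (Y k)) - m_gam (U k)) (Y k)| <= M1.
  apply: norm_add_le; last by apply: (le_trans (norm_hadamard _ _)); exact: ler_pM.
  apply: norm_add_le.
    apply: norm_add_le.
      apply: norm_add_le; first exact: le_trans ek.
      by rewrite normrN.
    by apply: (le_trans (mulmx_tr_norm _ _)); rewrite ler_wpM2l // ler_pM.
  by apply: (le_trans (mulmx_tr_norm _ _)); rewrite ler_wpM2l // ler_pM.
have by_ : `|lagr_y (X k) (U k)
  + hadamard (rho k *: m_gam (U0 (X k) (Y k)) - m_gam (U k)) (X k)
  - const_mx (rho k * m_del (U0 (X k) (Y k)) - m_del (U k))
  + (rho k *: m_eta (U0 (X k) (Y k)) - m_eta (U k))| <= M2.
  apply: norm_add_le => //.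
  apply: norm_add_le; last by rewrite normrN; exact: le_trans (norm_const _ _) md.
  apply: norm_add_le; first exact: le_trans ek.
  by apply: (le_trans (norm_hadamard _ _)); exact: ler_pM.
move: bx by_; set a := (X in `|X| <= M1 -> _); set b := (X in `|X| <= M2 -> _) => bx by_.
apply: norm_rV_le => [|i]; first by rewrite addr_ge0 // ltW.
rewrite -[i]fintype.splitK; case: fintype.split => j /=.
  rewrite row_mxEl; apply: (le_trans (coord_le_norm _ _)); apply: (le_trans bx).
  by rewrite lerDl.
rewrite row_mxEr; apply: (le_trans (coord_le_norm _ _)); apply: (le_trans by_).
by rewrite lerDr ltW.
Unshelve. all: by end_near. Qed.

(* The gradient inequality gives [rho * infeasibility --> 0]. *)
Lemma penalized_y_vanishes i e : xs 0 i <> 0 -> 0 < e ->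
  \forall k \near acc_filter, rho k * Y k 0 i ^+ 2 <= e.
Proof.
move=> xi e0; have [M M0 hM] := scaled_gradient_bounded.
pose a := `|xs 0 i| / 2.
have a0 : 0 < a by rewrite divr_gt0 // normr_gt0; exact/eqP.
have ae0 : 0 < a ^+ 2 * e by rewrite mulr_gt0 // exprn_gt0.
(* The gradient inequality, the bound [M] and the lower bound [a ^+ 2 * y_i ^+ 2 / 2] of the
   infeasibility give [rho * y_i ^+ 2 <= 2 * M / (C * a ^+ 2)], which this choice makes equal to
   [e]. *)
pose C := 2 * M / (a ^+ 2 * e).
have C0 : 0 < C by rewrite divr_gt0 // mulr_gt0.
have CE r y : r * (C * (a ^+ 2 * y / 2)) = M / e * (r * y).
  rewrite /C; move: (a) a0 => b b0; have b1 := gt_eqF b0; have e1 := gt_eqF e0.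
  by field; rewrite b1 e1.
have sF : sfunv infeasibility by exact: sfunv_joint_lagrangian.
have [r r0 hr] := gradient_inequality
  (C1_joint_lagrangian kappa C1_zero hg hh (Multipliers 0 0 0 0 0) ltr01) sF infeasibility_eq0 C0.
near=> k.
have xr : `|X k - xs| < r by near: k; exact: acc_X.
have yr : `|Y k - ys| < r by near: k; exact: acc_Y.
have xa : `|X k - xs| < a by near: k; exact: acc_X.
have zk : `|row_mx (X k) (Y k) - row_mx xs ys| < r.
  rewrite opp_row_mx add_row_mx.
  apply: (@le_lt_trans _ _ (Num.max `|X k - xs| `|Y k - ys|)); last by rewrite gt_max xr.
  apply: norm_rV_le => [|j]; first by rewrite le_max normr_ge0.
  rewrite -[j]fintype.splitK; case: fintype.split => l /=.
    by rewrite row_mxEl le_max coord_le_norm.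
  by rewrite row_mxEr le_max coord_le_norm orbT.
have kM : rho k * `|grad infeasibility (row_mx (X k) (Y k))| <= M by near: k.
have := hr _ zk; rewrite -/infeasibility => h1.
have h2 := infeasibility_ge (X k) (Y k) i.
have rk := rho_gt0 k.
have h3 : rho k * (C * infeasibility (row_mx (X k) (Y k))) <= M.
  by apply: le_trans kM; rewrite ler_pM2l.
have h4 : a <= `|X k 0 i|.
  have := le_lt_trans (coord_le_norm _ i) xa; rewrite !mxE => h4.
  have := ler_normD (xs 0 i - X k 0 i) (X k 0 i).
  by rewrite subrK distrC; move: h4; rewrite /a; lra.
have h6 : a ^+ 2 * Y k 0 i ^+ 2 <= (X k 0 i * Y k 0 i) ^+ 2.
  rewrite [leRHS]exprMn ler_wpM2r ?sqr_ge0 // -[leRHS]real_normK ?num_real //.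
  by rewrite ler_sqr ?nnegrE // ltW.
have h7 : rho k * (C * (a ^+ 2 * Y k 0 i ^+ 2 / 2)) <= M.
  apply: le_trans h3; rewrite ler_pM2l // ler_pM2l //.
  apply: le_trans h2; exact: ler_wpM2r.
by move: h7; rewrite CE mulrAC ler_pdivrMr // ler_pM2l.
Unshelve. all: by end_near. Qed.

(* The multiplier of [x_i = 0] is [gam_i * y_i]. Where [xs_i <> 0] it is replaced by
   zero; the error, [rho x_i y_i^2] up to a vanishing term, tends to zero. *)
Lemma approx_KKT_exists e : 0 < e -> exists x lam mu gam,
  approx_KKT f g h xs (B * (`|ys| + 1)) e x lam mu gam.
Proof.
move=> e0; have B0 := B_ge0.
have xy i : xs 0 i <> 0 -> ys 0 i = 0.
  have [_ _ /rowP/(_ i) + _ _] := hfeas; rewrite !mxE => /eqP.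
  by rewrite mulf_eq0 => /orP[/eqP//|/eqP].
(* [ex] and [ey] are tuned so that at an index with [xs_i <> 0] the two parts of [m_gam * y_i],
   namely [rho * x_i * y_i ^+ 2] and the safeguard times [y_i], are each at most [e4] in absolute
   value. *)
pose e4 := e / 4; have e40 : 0 < e4 by rewrite divr_gt0.
pose ex := e4 / (`|xs| + 1); have ex0 : 0 < ex by rewrite divr_gt0 // ltr_wpDl.
pose ey := e4 / (B + 1); have ey0 : 0 < ey by rewrite divr_gt0 // ltr_wpDl.
have [k [xk xk1 yk1 yk [ek [la yv]]]] : exists k, [/\ `|X k - xs| < e, `|X k - xs| < 1,
    `|Y k - ys| < 1, `|Y k - ys| < ey & eps P k.+1 <= e4 /\
    ((forall i, g xs 0 i <> 0 -> m_lam (U k) 0 i = 0) /\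
    (forall i, xs 0 i <> 0 -> rho k * Y k 0 i ^+ 2 <= ex))].
  apply: acc_filter_ex.
  have a1 : \forall k \near acc_filter, forall i, g xs 0 i <> 0 -> m_lam (U k) 0 i = 0.
    apply: (@filter_forall _ _ (fun i => [set k | g xs 0 i <> 0 -> m_lam (U k) 0 i = 0])) => i.
    case: (pselect (g xs 0 i <> 0)) => gi; last by apply: filterE => k /gi.
    by apply: filterS (inactive_multiplier gi) => k hk _.
  have a2 : \forall k \near acc_filter, forall i, xs 0 i <> 0 -> rho k * Y k 0 i ^+ 2 <= ex.
    apply: (@filter_forall _ _ (fun i => [set k | xs 0 i <> 0 -> rho k * Y k 0 i ^+ 2 <= ex])) => i.
    case: (pselect (xs 0 i <> 0)) => gi; last by apply: filterE => k /gi.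
    by apply: filterS (penalized_y_vanishes gi ex0) => k hk _.
  near=> k; split; [near: k; exact: acc_X|near: k; exact: acc_X|near: k; exact: acc_Y|
    near: k; exact: acc_Y|split; [near: k; exact: acc_eps|split; by near: k]].
have [hl hm hga _ _] := safe_boundP k; have r0 := rho_gt0 k.
have [lx _] := lagr_bounds k.
have Xb : `|X k| <= `|xs| + 1 by apply: (@norm_le_near _ _ id); exact: ltW.
have Yb : `|Y k| <= `|ys| + 1 by apply: (@norm_le_near _ _ id); exact: ltW.
have BB : B <= B * (`|ys| + 1) by rewrite ler_peMr // lerDr.
have gE i : m_gam (U k) 0 i = rho k * (X k 0 i * Y k 0 i) + m_gam (L k) 0 i.
  by rewrite !mxE.
pose gam : 'rV[R]_n := \row_i (if xs 0 i == 0 then m_gam (U k) 0 i * Y k 0 i else 0).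
exists (X k), (m_lam (U k)), (m_mu (U k)), gam; split.
- exact: xk.
- have -> : residual f g h (X k) (m_lam (U k)) (m_mu (U k)) gam =
      lagr_x f g h (X k) (Y k) (U k) - (hadamard (m_gam (U k)) (Y k) - gam).
    rewrite /residual /lagr_x; move: (grad f _ + _ + _) (hadamard _ _) gam => a b c.
    by apply/rowP => i; rewrite !mxE; ring.
  have -> : e = e4 + (e4 + e4 + e4) by rewrite /e4; lra.
  apply: norm_add_le; first exact: le_trans lx ek.
  rewrite normrN; apply: norm_rV_le => [|i]; first by rewrite !addr_ge0 // ltW.
  have -> : (hadamard (m_gam (U k)) (Y k) - gam) 0 i =
      if xs 0 i == 0 then 0 else m_gam (U k) 0 i * Y k 0 i.
    rewrite /gam; move: (m_gam (U k)) => c; rewrite !mxE.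
    by case: ifP => _; rewrite ?subrr ?subr0.
  case: eqP => xi; first by rewrite normr0 !addr_ge0 // ltW.
  rewrite gE mulrDl; apply: (@le_trans _ _ (e4 + e4)); last by rewrite lerDl ltW.
  apply: norm_add_le.
    rewrite (_ : _ * _ = X k 0 i * (rho k * Y k 0 i ^+ 2)); last by ring.
    have p0 : 0 <= rho k * Y k 0 i ^+ 2 by rewrite mulr_ge0 ?sqr_ge0 // ltW.
    rewrite normrM (ger0_norm p0).
    apply: (@le_trans _ _ ((`|xs| + 1) * ex)).
      apply: ler_pM => //; last exact: yv.
      exact: le_trans (coord_le_norm _ _) Xb.
    by rewrite /ex mulrC divfK // gt_eqF // ltr_wpDl.
  rewrite normrM; apply: (@le_trans _ _ ((B + 1) * ey)); last first.
    by rewrite /ey mulrC divfK // gt_eqF // ltr_wpDl.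
  apply: ler_pM => //; first by apply: le_trans (hga i) _; rewrite lerDl.
  have := le_trans (coord_le_norm _ i) (ltW yk); rewrite !mxE.
  by rewrite xy // subr0.
- split=> [i|i|i xi]; last by rewrite mxE; case: eqP.
    by rewrite !mxE le_max lexx.
  exact: la.
- split=> i.
  + rewrite !mxE /= => hi.
    have /andP[l0 lB] := hl i.
    have pos : 0 < rho k * g (X k) 0 i + m_lam (L k) 0 i.
      rewrite ltNge; apply/negP => le0; move: hi; rewrite max_l // ltNge.
      by rewrite (le_trans B0 BB).
    move: hi; rewrite max_r ?(ltW pos) // => hi.
    apply: (shifted_sign (B := B)) => //; first by rewrite ger0_norm.
    by rewrite gtr0_norm // (le_lt_trans BB).
  + rewrite !mxE /= => hi; apply: (shifted_sign (B := B)) => //.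
    exact: le_lt_trans hi.
  + rewrite [gam 0 i]mxE; case: eqP => xi; last first.
      by rewrite normr0 ltNge (le_trans B0 BB).
    rewrite normrM => hi.
    (* Since [|y_i| <= |ys| + 1], a product [m_gam * y_i] above the threshold forces [|m_gam|] above
       [B]; then [m_gam] has the sign of [x_i * y_i], so [m_gam * y_i * x_i] is positive. *)
    have hg' : B < `|m_gam (U k) 0 i|.
      rewrite ltNge; apply/negP => le0; move: hi; rewrite ltNge.
      by rewrite ler_pM // (le_trans (coord_le_norm _ _)).
    rewrite -mulrA [Y k 0 i * _]mulrC.
    by rewrite gE in hg' *; exact: shifted_sign r0 (hga i) hg'.
Unshelve. all: by end_near. Qed.

Lemma accumulation_KKT : CC_PAM_regular g h xs ->
  exists lam mu gam, multiplier_pattern g xs lam gam /\ residual f g h xs lam mu gam = 0.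
Proof.
move=> reg; apply: (KKT_of_approx_KKT hf hg hh) reg _; last exact: approx_KKT_exists.
by rewrite mulr_ge0 ?B_ge0 ?addr_ge0.
Qed.

End Algorithm.

Theorem theorem5p2 (R : realType) (n m p : nat)
    (f : 'rV[R]_n -> R) (g : 'rV[R]_n -> 'rV[R]_m) (h : 'rV[R]_n -> 'rV[R]_p)
    (kappa : int)
    (hf : C1_scalar f) (hg : C1_vector g) (hh : C1_vector h)
    (hkappa : kappa < n%:Z)
    (hg_semialg : semialgebraic_map g) (hh_semialg : semialgebraic_map h)
    (P : salm_params R) (S : salm_run R n m p)
    (hS : salm_generated f g h kappa P S)
    (xs ys : 'rV[R]_n)
    (hacc : cluster ((fun k => (s_x S k, s_y S k)) @ \oo) (xs, ys))
    (hfeas : relax_feasible g h kappa xs ys)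
    (hPAM : CC_PAM_regular g h xs) :
  CC_M_stationary f g h kappa xs ys /\
  exists zs : 'rV[R]_n, CC_S_stationary f g h kappa xs zs.
Proof.
have [lam [mu [gam [[l0 li gi] res]]]] :=
  accumulation_KKT hf hg hh hg_semialg hh_semialg hS hacc hfeas hPAM.
split; first by split=> //; exists lam, mu, gam.
(* [zs] is nonzero exactly where [xs] vanishes, so its condition on [gam] is that of
   CC-M-stationarity. It dominates [ys], which is at most 1 and vanishes wherever [xs] does not,
   hence the cardinality constraint. *)
pose zs : 'rV[R]_n := \row_i (xs 0 i == 0)%:R.
have [g0 h0 xy0 c0 y1] := hfeas.
exists zs; split.
  split=> // [||i].
  - apply/rowP => i; rewrite !mxE; case: eqP => [->|_]; first by rewrite mul0r.
    by rewrite mulr0.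
  - apply: le_trans c0; rewrite /card_res lerD2l lerN2; apply: ler_sum => i _.
    rewrite mxE; case: eqP => [_|xi]; first exact: y1.
    have /rowP/(_ i) := xy0; rewrite !mxE => /eqP; rewrite mulf_eq0 => /orP[/eqP//|/eqP->].
    by rewrite lexx.
  - by rewrite mxE; case: eqP; rewrite ?ler01 ?lexx.
exists lam, mu, gam; split=> // i; rewrite mxE; case: eqP => [_ /eqP|xi _].
  by rewrite oner_eq0.
exact: gi.
Qed.
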